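(* For each $n$ there is a constant $C_n$, depending only on $n$, such that the following holds. Let $N$ be a simply connected nilpotent Lie group of dimension $n$ endowed with a left-invariant Riemannian metric $g$. Then the Ricci flow $g(t)$ with $g(0)=g$ is a type-III solution with constant $C_n$; that is, $g(t)$ is defined for all $t\in[0,\infty)$ and $$\|\operatorname{Rm}(g(t))\|\le\frac{C_n}{t}\qquad\text{for all }t\in(0,\infty).$$
   Context: The Ricci flow is $\frac{\partial}{\partial t}g(t)=-2\operatorname{Rc}(g(t))$, with $\operatorname{Rc}$ the Ricci tensor; the solution considered is the one that is left-invariant on $N$ for all $t$ (equivalently the unique complete solution with bounded curvature). $\operatorname{Rm}$ is the Riemann curvature tensor and its norm is taken with respect to $g(t)$ (it is constant on $N$ by homogeneity). *)

(* Defs.v *)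
From HB Require Import structures.
From mathcomp Require Import all_boot all_order all_algebra.
From mathcomp Require Import all_classical all_reals all_analysis.

Set Implicit Arguments.
Unset Strict Implicit.
Unset Printing Implicit Defensive.

Import Order.TTheory GRing.Theory Num.Theory.
Import numFieldNormedType.Exports.

Local Open Scope classical_set_scope.
Local Open Scope ring_scope.

Section Smooth.
Context {R : realType} {m : nat}.

Definition partial (i : 'I_m) (f : 'rV[R]_m -> R) (x : 'rV[R]_m) : R :=
  'D_(delta_mx 0 i) f x.

(* C^k on U; only used for open U. *)
Fixpoint Ck_on (k : nat) (U : set 'rV[R]_m) (f : 'rV[R]_m -> R) : Prop :=
  (forall x, U x -> {for x, continuous f}) /\
  match k with
  | 0 => True
  | k'.+1 => forall i : 'I_m,
      (forall x, U x -> derivable f x (delta_mx 0 i)) /\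
      Ck_on k' U (partial i f)
  end.

Definition smooth_on (U : set 'rV[R]_m) (f : 'rV[R]_m -> R) : Prop :=
  forall k, Ck_on k U f.

Definition smooth_map_on n (U : set 'rV[R]_m) (f : 'rV[R]_m -> 'rV[R]_n) :=
  forall j, smooth_on U (fun x => f x 0 j).

End Smooth.

Section Topology.
Variables (R : realType) (T : topologicalType).
Let I01 : set R := `[0, 1].

Definition path_connected : Prop :=
  forall x y : T, exists f : R -> T,
    [/\ {within I01, continuous f}, f 0 = x & f 1 = y].

Definition null_homotopic_loop (f : R -> T) : Prop :=
  exists H : R * R -> T,
    [/\ {within I01 `*` I01, continuous H},
        forall s, I01 s -> H (s, 0) = f s /\ H (s, 1) = f 0
      & forall t, I01 t -> H (0, t) = f 0 /\ H (1, t) = f 0].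

Definition simply_connected : Prop :=
  path_connected /\
  forall f : R -> T, {within I01, continuous f} -> f 0 = f 1 ->
    null_homotopic_loop f.

End Topology.

Section NilpotentGroup.
Local Open Scope group_scope.
Variable G : groupType.

Definition is_subgroup (H : set G) : Prop :=
  [/\ H 1, forall x y, H x -> H y -> H (x * y) & forall x, H x -> H x^-1].

Fixpoint lower_central (k : nat) : set G :=
  match k with
  | 0 => setT
  | k'.+1 => smallest is_subgroup
               [set z | exists x y, lower_central k' x /\ z = [~ x, y]]
  end.

Definition nilpotent_group : Prop := exists k, lower_central k = [set 1].

End NilpotentGroup.

Section Manifold.
Variables (R : realType) (n : nat) (T : topologicalType).

(* chart_inv is only meaningful on chart_map @` chart_dom. *)
Record chart := Chart {
  chart_dom : set T;
  chart_map : T -> 'rV[R]_n;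
  chart_inv : 'rV[R]_n -> T;
  chart_dom_open : open chart_dom;
  chart_cod_open : open (chart_map @` chart_dom);
  chart_mapK : forall p, chart_dom p -> chart_inv (chart_map p) = p;
  chart_map_continuous : {within chart_dom, continuous chart_map};
  chart_inv_continuous :
    {within chart_map @` chart_dom, continuous chart_inv}
}.

Definition chart_cod (c : chart) : set 'rV[R]_n := chart_map c @` chart_dom c.

Record smooth_atlas := SmoothAtlas {
  chart_index : Type;
  chart_at :> chart_index -> chart;
  atlas_cover : forall p, exists c, chart_dom (chart_at c) p;
  atlas_smooth : forall c d,
    smooth_map_on
      (chart_map (chart_at c) @`
         (chart_dom (chart_at c) `&` chart_dom (chart_at d)))
      (chart_map (chart_at d) \o chart_inv (chart_at c))
}.

End Manifold.

#[short(type="topGroupType")]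
HB.structure Definition TopGroup := {N of Group N & Topological N}.

Record lie_group (R : realType) (n : nat) := LieGroup {
  lg_carrier :> topGroupType;
  lg_hausdorff : hausdorff_space lg_carrier;
  lg_second_countable : @second_countable lg_carrier;
  lg_atlas : smooth_atlas R n lg_carrier;
  lg_mul_continuous :
    continuous (fun z : lg_carrier * lg_carrier => (z.1 * z.2)%g);
  lg_inv_continuous : continuous (fun p : lg_carrier => p^-1%g);
  lg_mul_smooth : forall c d e : chart_index lg_atlas,
    smooth_map_on
      [set z : 'rV[R]_(n + n) | exists p q,
         [/\ chart_dom (lg_atlas c) p, chart_dom (lg_atlas d) q,
             chart_dom (lg_atlas e) (p * q)%g
           & z = row_mx (chart_map (lg_atlas c) p) (chart_map (lg_atlas d) q)]]
      (fun z => chart_map (lg_atlas e)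
                  (chart_inv (lg_atlas c) (lsubmx z) *
                   chart_inv (lg_atlas d) (rsubmx z))%g);
  lg_inv_smooth : forall c d : chart_index lg_atlas,
    smooth_map_on
      (chart_map (lg_atlas c) @`
         [set p | chart_dom (lg_atlas c) p /\ chart_dom (lg_atlas d) p^-1%g])
      (fun x => chart_map (lg_atlas d) (chart_inv (lg_atlas c) x)^-1%g)
}.

(* Curvature in one coordinate chart, g x being the Gram matrix of the
   coordinate frame at x. *)
Section LocalCurvature.
Context {R : realType} {n : nat}.
Implicit Types (g : 'rV[R]_n -> 'M[R]_n) (x : 'rV[R]_n).

(* Gamma^k_ij *)
Definition christoffel g (k i j : 'I_n) x : R :=
  2^-1 * \sum_(l < n) invmx (g x) k l *
    (partial i (fun y => g y j l) x + partial j (fun y => g y i l) x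
     - partial l (fun y => g y i j) x).

(* R(e_i, e_j) e_k = \sum_l riemann g l k i j x e_l, with
   R(X, Y) Z = D_X D_Y Z - D_Y D_X Z - D_[X, Y] Z. *)
Definition riemann g (l k i j : 'I_n) x : R :=
  partial i (christoffel g l j k) x - partial j (christoffel g l i k) x
  + \sum_(m < n) (christoffel g l i m x * christoffel g m j k x
                  - christoffel g l j m x * christoffel g m i k x).

(* Rc(e_j, e_k) is the trace of X |-> R(X, e_j) e_k. *)
Definition ricci g x : 'M[R]_n :=
  \matrix_(j, k) \sum_(i < n) riemann g i k i j x.

Definition riemann_norm g x : R :=
  let gi := invmx (g x) in
  Num.sqrt (
    \sum_(l < n) \sum_(l' < n) \sum_(k < n) \sum_(k' < n)
    \sum_(i < n) \sum_(i' < n) \sum_(j < n) \sum_(j' < n)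
      g x l l' * gi k k' * gi i i' * gi j j' *
      riemann g l k i j x * riemann g l' k' i' j' x).

End LocalCurvature.

Section RicciFlow.
Context {R : realType} {n : nat} (N : lie_group R n).

Local Notation idx := (chart_index (lg_atlas N)).
Local Notation dom c := (chart_dom (lg_atlas N c)).
Local Notation phi c := (chart_map (lg_atlas N c)).
Local Notation psi c := (chart_inv (lg_atlas N c)).
Local Notation cod c := (chart_cod (lg_atlas N c)).

(* A covariant 2-tensor field, given by its components in every chart; the
   values of g c outside cod c are irrelevant. *)
Definition tensor_field := idx -> 'rV[R]_n -> 'M[R]_n.

Definition tensor_eq (g h : tensor_field) : Prop :=
  forall c x, cod c x -> g c x = h c x.

(* f^* g = g; the library's Jacobian acts on row vectors, v |-> v *m 'J f x. *)
Definition pullback_invariant (f : N -> N) (g : tensor_field) : Prop :=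
  forall c d p, dom c p -> dom d (f p) ->
    let J := 'J (phi d \o f \o psi c) (phi c p) in
    g c (phi c p) = J *m g d (phi d (f p)) *m J^T.

(* Invariance under id is the transformation law under changes of chart. *)
Definition riemannian_metric (g : tensor_field) : Prop :=
  [/\ pullback_invariant id g,
      forall c x, cod c x -> (g c x)^T = g c x,
      forall c x, cod c x ->
        forall v : 'rV[R]_n, v != 0 -> 0 < (v *m g c x *m v^T) 0 0
    & forall c i j, smooth_on (cod c) (fun x => g c x i j)].

Definition left_invariant (g : tensor_field) : Prop :=
  forall a : N, pullback_invariant (fun p => (a * p)%g) g.

(* Ricci flow on [0, T); the time derivative at t = 0 is one-sided. *)
Definition ricci_flow (T : \bar R) (G : R -> tensor_field) : Prop :=
  forall t : R, 0 <= t -> (t%:E < T)%E ->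
    riemannian_metric (G t) /\
    forall c x i j, cod c x ->
      h^-1 * (G (t + h) c x i j - G t c x i j)
        @[h --> within [set h | 0 <= t + h] 0^']
      --> - 2 * ricci (G t c) x i j.

Definition left_invariant_ricci_flow (T : \bar R) (g : tensor_field)
    (G : R -> tensor_field) : Prop :=
  [/\ ricci_flow T G,
      forall t : R, 0 <= t -> (t%:E < T)%E -> left_invariant (G t)
    & tensor_eq (G 0) g].

(* The Riemann tensor norm is at most B at every point of N. *)
Definition riemann_norm_le (g : tensor_field) (B : R) : Prop :=
  forall c x, cod c x -> riemann_norm (g c) x <= B.

Definition type_III (C : R) (G : R -> tensor_field) : Prop :=
  ricci_flow +oo%E G /\ forall t : R, 0 < t -> riemann_norm_le (G t) (C / t).

End RicciFlow.

(* Main.v *)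
(* Every left-invariant metric has an orthonormal frame of the form E Q, where
   E is a fixed left-invariant frame and Q a constant matrix, and its curvature
   is a polynomial in the structure constants k of that frame.  Nilpotency makes
   k unimodular with vanishing Killing form, so the Ricci tensor is
     r_ef = - 1/2 sum k_ei^j k_fi^j + 1/4 sum k_ij^e k_ij^f.
   The Ricci flow is therefore the ordinary differential equation Q' = - Q r,
   along which u = |k|^2 satisfies u' = - 8 |r|^2.  Since u does not increase,
   Q grows at most exponentially and the solution exists for all time.  Since
   tr r = - u / 4, Cauchy-Schwarz gives u' <= - u^2 / (2 (n + 1)), hence
   u <= 2 (n + 1) / t; and |Rm| <= 6 n^3 u. *)
Require Import Defs.
From HB Require Import structures.
From mathcomp Require Import all_boot all_order all_algebra.
From mathcomp Require Import all_classical all_reals all_analysis.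
From mathcomp Require Import ring lra.

Set Implicit Arguments.
Unset Strict Implicit.
Unset Printing Implicit Defensive.

Import Order.TTheory GRing.Theory Num.Theory.
Import numFieldNormedType.Exports.

Local Open Scope classical_set_scope.
Local Open Scope ring_scope.

(** * Smooth functions *)

(** Curvature is defined by second derivatives in each chart. In a left-invariant coframe the
    Maurer-Cartan equation replaces these derivatives by structure constants, so the partial
    differential equation becomes one for a matrix.

    Nilpotency is a condition on group commutators and must reach the structure constants without an
    exponential map. An iterated commutator of sufficient length is constant, so its differential at
    the identity, a product of operators Ad - 1, is zero. Differentiating the factors one after
    another shows that long products of matrices ad are zero, and nilpotent matrices have trace
    zero: this gives unimodularity and the Killing form.

    The inverse S of Q is carried as a second unknown, which keeps the vector field polynomial; Q S
    = 1 is recovered as a conserved quantity. The equation Q' = - Q r is a choice of gauge: r being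
    symmetric, P = Q Q^T satisfies P' = - 2 Q r Q^T, the Ricci flow at the identity. A competing
    solution brings no frame with it, so uniqueness is proved for P and not for Q. *)

Lemma continuous_at_sum {R : realType} {T : topologicalType} (I : Type)
    (r : seq I) (P : pred I) (f : I -> T -> R) (x : T) :
  (forall i, {for x, continuous (f i)}) ->
  {for x, continuous (fun y => \sum_(i <- r | P i) f i y)}.
Proof.
move=> cf; elim: r => [|i r IH].
  rewrite (_ : (fun _ => _) = cst 0); first exact: cvg_cst.
  by apply/funext => y; rewrite big_nil.
rewrite (_ : (fun _ => _) = fun y => if P i then f i y + \sum_(j <- r | P j) f j y
   else \sum_(j <- r | P j) f j y); last by apply/funext => y; rewrite big_cons.
case: (P i) => //.
exact: (cvgD (cf i) IH).
Qed.

Lemma differentiable_intro {R : realType} {V W : normedModType R} (f : V -> W)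
    (L : {linear V -> W}) (x : V) : continuous L ->
  (forall e : R, 0 < e -> \forall h \near 0, `|f (x + h) - f x - L h| <= e * `|h|) ->
  differentiable f x.
Proof.
move=> Lc H; have E : f \o shift x = cst (f x) + L +o_ 0 id.
  apply/eqaddoP => e /H; apply: filterS => h.
  rewrite -[(_ - _) h]/(f (h + x) - (f x + L h)) opprD addrA [h + x]addrC; exact.
by apply/diff_locallyP; rewrite (diff_unique Lc E).
Qed.

Section Lines.
Context {R : realType} {V : normedModType R}.
Implicit Types (f : V -> R) (x y v : V) (a s d : R).

Lemma is_derive_line f y v s d :
  is_derive (y + s *: v) v f d ->
  is_derive s 1 (fun r : R => f (y + r *: v)) d.
Proof.
move=> [df <-]; have E : (fun h : R => h^-1 *: ((f \o shift (y + s *: v)) (h *: v) - f (y + s *: v)))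
  = (fun h : R => h^-1 *: (((fun r : R => f (y + r *: v)) \o shift s) (h *: 1) - f (y + s *: v))).
  apply/funext => h /=; congr (_ *: (f _ - _)).
  by rewrite [h%:A]mulr1 scalerDl addrCA.
by split; [move: df; rewrite /derivable /= E | rewrite /derive /= E].
Qed.

Lemma is_derive_translate f y w v d :
  is_derive (y + w) v f d -> is_derive y v (fun z => f (z + w)) d.
Proof.
move=> [df <-]; have E : (fun h : R => h^-1 *: ((f \o shift (y + w)) (h *: v) - f (y + w)))
  = (fun h : R => h^-1 *: (((fun z => f (z + w)) \o shift y) (h *: v) - f (y + w))).
  by apply/funext => h /=; rewrite addrA.
by split; [move: df; rewrite /derivable E | rewrite /derive E].
Qed.

(** Bounding the intermediate point by [|s| <= |a|] lets one statement serve both signs of [a]. *)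
Lemma mvt_line f y v (a : R) :
  (forall s : R, `|s| <= `|a| -> derivable f (y + s *: v) v) ->
  exists2 s : R, `|s| <= `|a| & f (y + a *: v) - f y = a * 'D_v f (y + s *: v).
Proof.
move=> df; pose g (r : R) := f (y + r *: v).
have dg s : `|s| <= `|a| -> is_derive s 1 g ('D_v f (y + s *: v)).
  by move=> sa; apply/is_derive_line/derivableP/df.
have g0 : g 0 = f y by rewrite /g scale0r addr0.
have ga : g a = f (y + a *: v) by [].
have cg u w : (forall s, s \in `[u, w] -> `|s| <= `|a|) -> {within `[u, w], continuous g}.
  move=> uw; apply: derivable_within_continuous => s /uw sa.
  by have [] := dg _ sa.
have [a0|a0] := leP 0 a.
  have W s : s \in `[0, a] -> `|s| <= `|a|.
    by rewrite in_itv /= => /andP[s0 sa]; rewrite !ger0_norm.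
  have [|c cab e] := MVT_segment (df := fun s => 'D_v f (y + s *: v)) a0 _ (cg _ _ W).
    by move=> x xa; apply/dg/W; apply: subset_itv_oo_cc xa.
  exists c; first exact: W.
  by rewrite -g0 -ga e subr0 mulrC.
have W s : s \in `[a, 0] -> `|s| <= `|a|.
  by rewrite in_itv /= => /andP[s0 sa]; rewrite (ler0_norm sa) (ltr0_norm a0) lerN2.
have [|c cab e] := MVT_segment (df := fun s => 'D_v f (y + s *: v)) (ltW a0) _ (cg _ _ W).
  by move=> x xa; apply/dg/W; apply: subset_itv_oo_cc xa.
exists c; first exact: W.
by rewrite -g0 -ga -opprB e sub0r mulrN opprK mulrC.
Qed.

End Lines.

Section PartialDerivatives.
Context {R : realType} {m : nat}.
Implicit Types (f : 'rV[R]_m -> R) (x y h : 'rV[R]_m).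

Lemma norm_coord h i : `|h 0 i| <= `|h|.
Proof.
rewrite [leRHS]/Num.Def.normr/= mx_normrE.
exact: (le_bigmax _ (fun ij : 'I_1 * 'I_m => `|h ij.1 ij.2|) (0, i)).
Qed.

Lemma rV_norm_le h (e : R) : 0 <= e -> (forall i, `|h 0 i| <= e) -> `|h| <= e.
Proof.
move=> e0 H; rewrite [leLHS]/Num.Def.normr/= mx_normrE.
by apply: bigmax_le => // -[i j] _; rewrite /= ord1.
Qed.

Definition gradient_map (c : 'I_m -> R) (h : 'rV[R]_m) : R := \sum_i h 0 i * c i.

Lemma gradient_map_is_linear c : linear (gradient_map c).
Proof.
move=> a u v; rewrite /gradient_map scaler_sumr -big_split /=.
by apply: eq_bigr => i _; rewrite !mxE mulrDl -[_ *: _]/(_ * _) mulrA.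
Qed.

HB.instance Definition _ c :=
  GRing.isLinear.Build R 'rV[R]_m R *:%R (gradient_map c)
    (gradient_map_is_linear c).

Lemma gradient_map_continuous c : continuous (gradient_map c).
Proof.
move=> x; apply: continuous_at_sum => i.
have H : {for x, continuous (fun y : 'rV[R]_m => y 0 i)} by exact: coord_continuous.
exact: (cvgM H (cvg_cst (c i))).
Qed.

(** The increment is telescoped along a path that changes one coordinate at a time. On each leg the
    mean value theorem produces a partial derivative at a point no farther from [x] than [x + h],
    and continuity compares it with its value at [x]. *)
Lemma differentiable_of_partial f x :
  (\forall y \near x, forall i, derivable f y (delta_mx 0 i)) ->
  (forall i, {for x, continuous (partial i f)}) ->
  differentiable f x.
Proof.
move=> nd cd; pose L := gradient_map (fun i => partial i f x).
apply: (@differentiable_intro _ _ _ f L x); first exact: gradient_map_continuous.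
move=> e e0.
(* The successor keeps the division meaningful for [m = 0]; the surplus share of [e] is dropped at
   the end. *)
pose e' := e / m.+1%:R.
have e'0 : 0 < e' by rewrite divr_gt0.
have nc : \forall y \near x, forall i, `|partial i f y - partial i f x| < e'.
  apply: (@filter_forall _ _ (fun (i : 'I_m) y => `|partial i f y - partial i f x| < e') _ (nbhs_filter x)) => i.
  by have /cvgrPdistC_lt := cd i; exact.
have [r /= r0 xr] := (nbhs_ballP _ _).1 (filterI nd nc).
have {}xr y : `|y - x| < r -> (forall i, derivable f y (delta_mx 0 i)) /\
   (forall i, `|partial i f y - partial i f x| < e').
  by move=> yx; apply: xr; rewrite -ball_normE /= distrC.
near=> h.
have hr : `|h| < r.
  near: h; apply/nbhs_ballP; exists r => //= h.
  by rewrite -ball_normE /= sub0r normrN.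
pose tr (k : nat) : 'rV[R]_m := \row_j (if (j < k)%N then h 0 j else 0).
(* [tr k] keeps the first [k] coordinates of [h], so it runs from 0 to [h] along the axes. *)
have trS (k : 'I_m) : tr k.+1 = tr k + h 0 k *: delta_mx 0 k.
  apply/rowP => j; rewrite !mxE eqxx /= ltnS leq_eqVlt -val_eqE /=.
  by case: eqP => [/val_inj ->|_]; rewrite ?ltnn /= ?mulr1 ?mulr0 ?add0r ?addr0.
have tr0 : tr 0%N = 0 by apply/rowP => j; rewrite !mxE.
have trm : tr m = h by apply/rowP => j; rewrite !mxE ltn_ord.
have trn (k : 'I_m) s : `|s| <= `|h 0 k| -> `|tr k + s *: delta_mx 0 k| <= `|h|.
  move=> sh; apply: rV_norm_le => // j; rewrite !mxE eqxx /=.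
  have [jk|jk] := eqVneq j k.
    by rewrite jk ltnn mulr1 add0r (le_trans sh)// norm_coord.
  by rewrite mulr0 addr0; case: ifP => _; rewrite ?normr0 // norm_coord.
rewrite /L /gradient_map /=.
have -> : f (x + h) - f x = \sum_(k < m) (f (x + tr k.+1) - f (x + tr k)).
  rewrite -(big_mkord xpredT (fun k => f (x + tr k.+1) - f (x + tr k))).
  by rewrite telescope_sumr // trm tr0 addr0.
rewrite -sumrB; apply: le_trans (ler_norm_sum _ _ _) _.
have -> : e * `|h| = \sum_(k < m.+1) e' * `|h|.
  rewrite sumr_const card_ord -[RHS]mulr_natl mulrA /e'.
  by rewrite [m.+1%:R * _]mulrC divfK.
rewrite big_ord_recr /= -[leLHS]addr0 lerD ?mulr_ge0 ?(ltW e'0) ?(ltW e0) //.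
apply: ler_sum => k _; rewrite trS addrA.
have [|s sh ->] := @mvt_line _ _ f (x + tr k) (delta_mx 0 k) (h 0 k).
  move=> s sh; apply: (xr _ _).1; rewrite -[x + _ + _]addrA [x + _]addrC addrK.
  by rewrite (le_lt_trans _ hr)// trn.
rewrite -mulrBr normrM mulrC ler_pM ?norm_coord //.
apply/ltW/(xr _ _).2; rewrite -[x + _ + _]addrA [x + _]addrC addrK.
by rewrite (le_lt_trans _ hr)// trn.
Unshelve. all: by end_near. Qed.

(* The second difference of [f] over a small square equals both mixed
   derivatives at nearby points. *)
Lemma partialC f x (i j : 'I_m) :
  (\forall y \near x, [/\ derivable f y (delta_mx 0 i), derivable f y (delta_mx 0 j),
     derivable (partial i f) y (delta_mx 0 j) &
     derivable (partial j f) y (delta_mx 0 i)]) ->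
  {for x, continuous (partial i (partial j f))} ->
  {for x, continuous (partial j (partial i f))} ->
  partial i (partial j f) x = partial j (partial i f) x.
Proof.
move=> nd ci cj; apply/eqP; rewrite -subr_eq0 -normr_eq0; apply/eqP/le_anti.
rewrite normr_ge0 andbT; apply/ler_addgt0Pl => e e0.
rewrite addr0.
have e20 : 0 < e / 2 by rewrite divr_gt0.
have ni : \forall y \near x,
    `|partial i (partial j f) y - partial i (partial j f) x| < e / 2.
  by have /cvgrPdistC_lt H := ci; apply: H.
have nj : \forall y \near x,
    `|partial j (partial i f) y - partial j (partial i f) x| < e / 2.
  by have /cvgrPdistC_lt H := cj; apply: (H (e / 2) e20).
have [r /= r0 xr] := (nbhs_ballP _ _).1 (filterI nd (filterI ni nj)).
(* Two steps of length [s], one in each direction, stay inside the ball of radius [r]. *)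
pose s := r / 3.
have s0 : 0 < s by rewrite divr_gt0.
have close a b : `|a| <= `|s| -> `|b| <= `|s| ->
    ball x r (x + a *: delta_mx 0 i + b *: delta_mx 0 j).
  move=> sa sb; rewrite -ball_normE /= distrC -[x + _ + _]addrA [x + _]addrC addrK.
  have N k : `|delta_mx 0 k : 'rV[R]_m| <= 1.
    by apply: rV_norm_le => // l; rewrite !mxE; case: (_ && _); rewrite ?mulr1n ?mulr0n ?normr1 ?normr0 ?ler01.
  rewrite (le_lt_trans (ler_normD _ _)) // !normrZ.
  have: `|a| * `|delta_mx 0 i : 'rV[R]_m| <= s.
    by rewrite -[s]mulr1 ler_pM // -(gtr0_norm s0).
  have: `|b| * `|delta_mx 0 j : 'rV[R]_m| <= s.
    by rewrite -[s]mulr1 ler_pM // -(gtr0_norm s0).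
  rewrite /s; lra.
have s0' : `|0 : R| <= `|s| by rewrite normr0.
pose D := f (x + s *: delta_mx 0 i + s *: delta_mx 0 j) - f (x + s *: delta_mx 0 i)
  - (f (x + s *: delta_mx 0 j) - f x).
have [a sa [b sb Di]] : exists2 a, `|a| <= `|s| & exists2 b, `|b| <= `|s| &
   D = s * s * partial j (partial i f) (x + a *: delta_mx 0 i + b *: delta_mx 0 j).
  pose g y := f (y + s *: delta_mx 0 j) - f y.
  have dg a : `|a| <= `|s| -> is_derive (x + a *: delta_mx 0 i) (delta_mx 0 i) g
     (partial i f (x + a *: delta_mx 0 i + s *: delta_mx 0 j)
      - partial i f (x + a *: delta_mx 0 i)).
    move=> sa; apply: is_deriveB; last first.
      apply: derivableP; have := xr _ (close a 0 sa s0').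
      by rewrite scale0r addr0 => -[[H _ _ _] _]; apply: H.
    have [[/derivableP H _ _ _] _] := xr _ (close a s sa (lexx _)).
    exact: is_derive_translate H.
  have [|a sa Da] := @mvt_line _ _ g x (delta_mx 0 i) s; first by move=> a /dg[].
  exists a => //.
  have [|b sb Db] := @mvt_line _ _ (partial i f) (x + a *: delta_mx 0 i) (delta_mx 0 j) s.
    by move=> b sb; have [[_ _ H _] _] := xr _ (close a b sa sb); apply: H.
  exists b => //; rewrite -mulrA -Db.
  have [_ E] := dg _ sa.
  by move: Da; rewrite E => <-.
have [a' sa' [b' sb' Dj]] : exists2 a, `|a| <= `|s| & exists2 b, `|b| <= `|s| &
   D = s * s * partial i (partial j f) (x + a *: delta_mx 0 i + b *: delta_mx 0 j).
  pose g y := f (y + s *: delta_mx 0 i) - f y.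
  have dg b1 : `|b1| <= `|s| -> is_derive (x + b1 *: delta_mx 0 j) (delta_mx 0 j) g
     (partial j f (x + b1 *: delta_mx 0 j + s *: delta_mx 0 i)
      - partial j f (x + b1 *: delta_mx 0 j)).
    move=> sb1; apply: is_deriveB; last first.
      apply: derivableP; have := xr _ (close 0 b1 s0' sb1).
      by rewrite scale0r addr0 => -[[_ H _ _] _]; apply: H.
    have [[_ /derivableP H _ _] _] := xr _ (close s b1 (lexx _) sb1).
    move: H; rewrite addrAC => H.
    exact: is_derive_translate H.
  have [|b1 sb1 Db] := @mvt_line _ _ g x (delta_mx 0 j) s; first by move=> b2 /dg[].
  have [|a1 sa1 Da] := @mvt_line _ _ (partial j f) (x + b1 *: delta_mx 0 j) (delta_mx 0 i) s.
    move=> a2 sa2; have := xr _ (close a2 b1 sa2 sb1); rewrite addrAC.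
    by case=> [[_ _ _ H] _]; apply: H.
  exists a1; [exact: sa1|exists b1; [exact: sb1|]].
  rewrite -mulrA -[x + a1 *: _ + _]addrAC -[partial i _ _]/('D_(delta_mx 0 i) _ _) -Da.
  have [_ E] := dg _ sb1.
  move: Db; rewrite E => <-; rewrite /g /D -[x + s *: _ + _]addrAC.
  by move: (f _) (f _) (f _) (f _) => p q r1 t; ring.
have [_ [_ Hj]] := xr _ (close a b sa sb).
have [_ [Hi _]] := xr _ (close a' b' sa' sb').
have E := etrans (esym Di) Dj; move: E Hi Hj.
move: (partial i (partial j f)) (partial j (partial i f)) => A B.
have /mulfI inj : s * s != 0 by rewrite mulf_neq0 // gt_eqF.
move=> /inj <- Hi Hj; apply/ltW; rewrite (splitr e).
by apply: le_lt_trans (ler_distD (B (x + a *: delta_mx 0 i + b *: delta_mx 0 j)) _ _) _; rewrite distrC; apply: ltrD.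
Qed.

End PartialDerivatives.

Section PointwiseDerivatives.
Context {R : realType} {V : normedModType R}.
Implicit Types (f g : V -> R) (x v : V) (df dg : R).

Lemma is_derive_add f g x v df dg : is_derive x v f df -> is_derive x v g dg ->
  is_derive x v (fun y => f y + g y) (df + dg).
Proof. exact: is_deriveD. Qed.

Lemma is_derive_sub f g x v df dg : is_derive x v f df -> is_derive x v g dg ->
  is_derive x v (fun y => f y - g y) (df - dg).
Proof. exact: is_deriveB. Qed.

Lemma is_derive_mul f g x v df dg : is_derive x v f df -> is_derive x v g dg ->
  is_derive x v (fun y => f y * g y) (df * g x + f x * dg).
Proof.
move=> Df Dg; rewrite addrC [df * _]mulrC.
by rewrite (_ : (fun y => f y * g y) = f * g); [exact: is_deriveM|exact/funext].
Qed.

Lemma is_derive_bigsum (I : Type) (r : seq I) (P : pred I) (f : I -> V -> R)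
    (df : I -> R) x v : (forall i, is_derive x v (f i) (df i)) ->
  is_derive x v (fun y => \sum_(i <- r | P i) f i y) (\sum_(i <- r | P i) df i).
Proof.
move=> Df; elim: r => [|i r IH].
  rewrite big_nil (_ : (fun y => _) = cst 0); first exact: is_derive_cst.
  by apply/funext => y; rewrite big_nil.
rewrite big_cons (_ : (fun y => _) = fun y => if P i then f i y + \sum_(j <- r | P j) f j y
   else \sum_(j <- r | P j) f j y); last by apply/funext => y; rewrite big_cons.
by case: (P i) => //; exact: is_derive_add.
Qed.

End PointwiseDerivatives.

Section SmoothFunctions.
Context {R : realType} {m : nat}.
Implicit Types (f g : 'rV[R]_m -> R) (x y : 'rV[R]_m) (U V : set 'rV[R]_m) (k : nat).

Lemma open_near U x (P : 'rV[R]_m -> Prop) :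
  open U -> U x -> (forall y, U y -> P y) -> \forall y \near x, P y.
Proof. by move=> oU Ux UP; apply: filterS UP _; exact: open_nbhs_nbhs. Qed.

Lemma partial_eq_on U f g i x : open U -> (forall y, U y -> f y = g y) -> U x ->
  partial i f x = partial i g x.
Proof. by move=> oU fg Ux; apply/near_eq_derive/(open_near oU Ux). Qed.

Lemma continuous_eq_on U f g x : open U -> (forall y, U y -> f y = g y) -> U x ->
  {for x, continuous f} -> {for x, continuous g}.
Proof.
move=> oU fg Ux; rewrite /prop_for /continuous_at -(fg x Ux).
apply: cvg_trans; apply: (near_eq_cvg (FF := nbhs_filter x)).
by apply: (open_near oU Ux) => y Uy; rewrite fg.
Qed.

Lemma Ck_on_continuous k U f x : Ck_on k U f -> U x -> {for x, continuous f}.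
Proof. by case: k => [|k] [cf _]; apply: cf. Qed.

Lemma Ck_on_derivable k U f x i :
  Ck_on k.+1 U f -> U x -> derivable f x (delta_mx 0 i).
Proof. by move=> [_ df] Ux; have [+ _] := df i; apply. Qed.

Lemma Ck_on_partial k U f i : Ck_on k.+1 U f -> Ck_on k U (partial i f).
Proof. by case=> _ df; have [_] := df i. Qed.

Lemma Ck_onW k U f : Ck_on k.+1 U f -> Ck_on k U f.
Proof.
elim: k f => [|k IH] f [cf df]; first by split.
by split=> // i; have [d1 d2] := df i; split => //; apply: IH.
Qed.

Lemma Ck_on_sub k U V f : U `<=` V -> Ck_on k V f -> Ck_on k U f.
Proof.
move=> UV; elim: k f => [|k IH] f [cf df]; split=> //; first by move=> x /UV/cf.
  by move=> x /UV/cf.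
by move=> i; have [d1 d2] := df i; split; [move=> x /UV/d1|exact: IH].
Qed.

Lemma Ck_on_eq k U f g : open U -> (forall x, U x -> f x = g x) ->
  Ck_on k U f -> Ck_on k U g.
Proof.
move=> oU; elim: k f g => [|k IH] f g fg [cf df]; split=> //.
- by move=> x Ux; apply: continuous_eq_on fg _ (cf x Ux).
- by move=> x Ux; apply: continuous_eq_on fg _ (cf x Ux).
- move=> i; have [d1 d2] := df i; split.
    move=> x Ux; apply: near_eq_derivable (d1 x Ux).
    exact: (open_near oU Ux).
  apply: IH d2 => x Ux; exact: partial_eq_on oU fg Ux.
Qed.

Lemma Ck_on_cst k U (c : R) : Ck_on k U (fun=> c).
Proof.
elim: k c => [|k IH] c; split=> //; try by move=> x _; exact: cst_continuous.
move=> i; split; first by move=> x _; exact: derivable_cst.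
rewrite (_ : partial i _ = fun=> 0); first exact: IH.
by apply/funext => x; rewrite /partial derive_cst.
Qed.

Lemma Ck_on_add k U f g : open U -> Ck_on k U f -> Ck_on k U g ->
  Ck_on k U (fun x => f x + g x).
Proof.
move=> oU; elim: k f g => [|k IH] f g [cf df] [cg dg]; split=> //.
- by move=> x Ux; exact: (cvgD (cf x Ux) (cg x Ux)).
- by move=> x Ux; exact: (cvgD (cf x Ux) (cg x Ux)).
move=> i; have [f1 f2] := df i; have [g1 g2] := dg i; split.
  by move=> x Ux; exact: derivableD (f1 x Ux) (g1 x Ux).
apply: Ck_on_eq oU _ (IH _ _ f2 g2) => x Ux.
by rewrite [RHS](deriveD (f1 x Ux) (g1 x Ux)).
Qed.

Lemma Ck_on_mul k U f g : open U -> Ck_on k U f -> Ck_on k U g ->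
  Ck_on k U (fun x => f x * g x).
Proof.
move=> oU; elim: k f g => [|k IH] f g sf sg.
  by split=> // x Ux; exact: (cvgM (Ck_on_continuous sf Ux) (Ck_on_continuous sg Ux)).
split; first by move=> x Ux; exact: (cvgM (Ck_on_continuous sf Ux) (Ck_on_continuous sg Ux)).
move=> i; have D x (Ux : U x) := is_derive_mul (v := delta_mx 0 i) (derivableP (Ck_on_derivable sf Ux))
  (derivableP (Ck_on_derivable sg Ux)); split.
  by move=> x Ux; have [] := D x Ux.
apply: (@Ck_on_eq _ _ (fun x => partial i f x * g x + f x * partial i g x) _ oU).
  by move=> x Ux; have [_ E] := D x Ux; rewrite /partial E.
apply: (Ck_on_add oU).
  by apply: IH; [exact: Ck_on_partial|exact: Ck_onW].
by apply: IH; [exact: Ck_onW|exact: Ck_on_partial].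
Qed.

Lemma Ck_on_sum k U (I : Type) (r : seq I) (P : pred I) (f : I -> 'rV[R]_m -> R) :
  open U -> (forall i, Ck_on k U (f i)) -> Ck_on k U (fun x => \sum_(i <- r | P i) f i x).
Proof.
move=> oU sf; elim: r => [|i r IH].
  by apply: Ck_on_eq oU _ (Ck_on_cst k U 0) => x _; rewrite big_nil.
apply: (@Ck_on_eq _ _ (fun x => if P i then f i x + \sum_(j <- r | P j) f j x
   else \sum_(j <- r | P j) f j x)) => //; first by move=> x _; rewrite big_cons.
by case: (P i) => //; exact: Ck_on_add.
Qed.

Lemma Ck_on_prod k U (I : Type) (r : seq I) (P : pred I) (f : I -> 'rV[R]_m -> R) :
  open U -> (forall i, Ck_on k U (f i)) -> Ck_on k U (fun x => \prod_(i <- r | P i) f i x).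
Proof.
move=> oU sf; elim: r => [|i r IH].
  by apply: Ck_on_eq oU _ (Ck_on_cst k U 1) => x _; rewrite big_nil.
apply: (@Ck_on_eq _ _ (fun x => if P i then f i x * \prod_(j <- r | P j) f j x
   else \prod_(j <- r | P j) f j x)) => //; first by move=> x _; rewrite big_cons.
by case: (P i) => //; exact: Ck_on_mul.
Qed.

Lemma Ck_on_inv k U f : open U -> (forall x, U x -> f x != 0) -> Ck_on k U f ->
  Ck_on k U (fun x => (f x)^-1).
Proof.
move=> oU f0; elim: k => [|k IH] sf.
  by split=> // x Ux; exact: (cvgV (f0 x Ux) (Ck_on_continuous sf Ux)).
split; first by move=> x Ux; exact: (cvgV (f0 x Ux) (Ck_on_continuous sf Ux)).
have iW := IH (Ck_onW sf); move=> i; split.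
  by move=> x Ux; exact: derivableV (f0 x Ux) (Ck_on_derivable sf Ux).
apply: (@Ck_on_eq _ _ (fun x => (-1 * ((f x)^-1 * (f x)^-1)) * partial i f x)) => //.
  move=> x Ux; rewrite [RHS](deriveV (f0 x Ux) (Ck_on_derivable sf Ux)).
  by rewrite -[_ *: _]/(_ * _) mulN1r -expr2 exprVn.
apply: Ck_on_mul => //; last exact: Ck_on_partial.
by apply: Ck_on_mul => //; [exact: Ck_on_cst|exact: Ck_on_mul].
Qed.

Lemma differentiable_Ck k U f x : open U -> Ck_on k.+1 U f -> U x -> differentiable f x.
Proof.
move=> oU sf Ux; apply: differentiable_of_partial.
  by apply: (open_near oU Ux) => y Uy i; exact: Ck_on_derivable sf Uy.
by move=> i; exact: (@Ck_on_continuous k U (partial i f) x (Ck_on_partial _ sf) Ux).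
Qed.

Lemma partialC_Ck k U f x i j : open U -> Ck_on k.+2 U f -> U x ->
  partial i (partial j f) x = partial j (partial i f) x.
Proof.
move=> oU sf Ux; apply: partialC.
- apply: (open_near oU Ux) => y Uy; split.
  + exact: Ck_on_derivable sf Uy.
  + exact: Ck_on_derivable sf Uy.
  + exact: Ck_on_derivable (Ck_on_partial _ sf) Uy.
  + exact: Ck_on_derivable (Ck_on_partial _ sf) Uy.
- exact: (@Ck_on_continuous k U (partial _ (partial _ f)) x (Ck_on_partial _ (Ck_on_partial _ sf)) Ux).
- exact: (@Ck_on_continuous k U (partial _ (partial _ f)) x (Ck_on_partial _ (Ck_on_partial _ sf)) Ux).
Qed.

End SmoothFunctions.

(** A step along basis vector [i] in the source is a step along basis vector [s i] in the target, so
    the difference quotients coincide literally and no chain rule is needed. The intended maps are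
    the slices of the product chart with one factor fixed. *)
Lemma Ck_on_affine {R : realType} {m n : nat} (iota : 'rV[R]_n -> 'rV[R]_m)
    (s : 'I_n -> 'I_m) k (U : set 'rV[R]_m) (f : 'rV[R]_m -> R) :
  continuous iota ->
  (forall (h : R) x i, iota (h *: delta_mx 0 i + x) = h *: delta_mx 0 (s i) + iota x) ->
  Ck_on k U f -> Ck_on k (iota @^-1` U) (f \o iota).
Proof.
move=> ci si; elim: k f => [|k IH] f [cf df]; split=> //.
- by move=> x Ux; apply: continuous_comp; [exact: ci|exact: cf].
- by move=> x Ux; apply: continuous_comp; [exact: ci|exact: cf].
move=> i; have [d1 d2] := df (s i).
have E x : (fun h : R => h^-1 *: (((f \o iota) \o shift x) (h *: delta_mx 0 i) - (f \o iota) x))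
   = (fun h : R => h^-1 *: ((f \o shift (iota x)) (h *: delta_mx 0 (s i)) - f (iota x))).
  by apply/funext => h; rewrite /= si.
split; first by move=> x Ux; have := d1 _ Ux; rewrite /derivable E.
have -> : partial i (f \o iota) = partial (s i) f \o iota.
  by apply/funext => x; rewrite /partial /derive E.
exact: IH.
Qed.

(** * Curvature in a frame *)

Section MatrixPartial.
Context {R : realType} {m : nat}.

Definition pmx {p q} (i : 'I_m) (M : 'rV[R]_m -> 'M[R]_(p, q)) (x : 'rV[R]_m) : 'M[R]_(p, q) :=
  \matrix_(a, b) partial i (fun y => M y a b) x.

Definition dmx {p q} (i : 'I_m) (M : 'rV[R]_m -> 'M[R]_(p, q)) (x : 'rV[R]_m) : Prop :=
  forall a b, derivable (fun y => M y a b) x (delta_mx 0 i).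

Lemma pmx_is_derive {p q} i (M : 'rV[R]_m -> 'M[R]_(p, q)) x a b : dmx i M x ->
  is_derive x (delta_mx 0 i) (fun y => M y a b) (pmx i M x a b).
Proof. by move=> dM; rewrite mxE; apply/derivableP/dM. Qed.

Lemma pmx_intro {p q} i (M : 'rV[R]_m -> 'M[R]_(p, q)) x (D : 'M[R]_(p, q)) :
  (forall a b, is_derive x (delta_mx 0 i) (fun y => M y a b) (D a b)) ->
  dmx i M x /\ pmx i M x = D.
Proof.
move=> H; split; first by move=> a b; have [] := H a b.
by apply/matrixP => a b; rewrite mxE; have [_ E] := H a b; rewrite /partial E.
Qed.

Lemma pmx_add {p q} i (M N : 'rV[R]_m -> 'M[R]_(p, q)) x : dmx i M x -> dmx i N x ->
  dmx i (fun y => M y + N y) x /\ pmx i (fun y => M y + N y) x = pmx i M x + pmx i N x.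
Proof.
move=> dM dN; apply: pmx_intro => a b.
rewrite [X in is_derive _ _ _ X]mxE (_ : (fun y => _) = fun y => M y a b + N y a b).
  by apply: is_derive_add; exact: pmx_is_derive.
by apply/funext => y; rewrite mxE.
Qed.

Lemma pmx_mul {p q r} i (M : 'rV[R]_m -> 'M[R]_(p, q)) (N : 'rV[R]_m -> 'M[R]_(q, r)) x :
  dmx i M x -> dmx i N x -> dmx i (fun y => M y *m N y) x /\
  pmx i (fun y => M y *m N y) x = pmx i M x *m N x + M x *m pmx i N x.
Proof.
move=> dM dN; apply: pmx_intro => a b.
rewrite !mxE -big_split /= (_ : (fun y => _) = fun y => \sum_j M y a j * N y j b).
  apply: (@is_derive_bigsum _ 'rV[R]_m _ _ _ (fun j y => M y a j * N y j b)
    (fun j => pmx i M x a j * N x j b + M x a j * pmx i N x j b)).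
  by move=> j; apply: is_derive_mul; exact: pmx_is_derive.
by apply/funext => y; rewrite mxE.
Qed.

Lemma pmx_tr {p q} i (M : 'rV[R]_m -> 'M[R]_(p, q)) x : dmx i M x ->
  dmx i (fun y => (M y)^T) x /\ pmx i (fun y => (M y)^T) x = (pmx i M x)^T.
Proof.
move=> dM; apply: pmx_intro => a b.
rewrite mxE (_ : (fun y => _) = fun y => M y b a); first exact: pmx_is_derive.
by apply/funext => y; rewrite mxE.
Qed.

Lemma pmx_cst {p q} i (A : 'M[R]_(p, q)) x : dmx i (fun=> A) x /\ pmx i (fun=> A) x = 0.
Proof. by apply: pmx_intro => a b; rewrite mxE; exact: is_derive_cst. Qed.

Lemma pmx_eq_on {p q} (U : set 'rV[R]_m) i (M N : 'rV[R]_m -> 'M[R]_(p, q)) x :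
  open U -> (forall y, U y -> M y = N y) -> U x -> pmx i M x = pmx i N x.
Proof.
move=> oU MN Ux; apply/matrixP => a b; rewrite !mxE.
by apply: (partial_eq_on _ oU _ Ux) => y Uy; rewrite MN.
Qed.

End MatrixPartial.

Lemma pmxE {R : realType} {m p q : nat} (i : 'I_m) (M : 'rV[R]_m -> 'M[R]_(p, q)) x a b :
  pmx i M x a b = partial i (fun y => M y a b) x.
Proof. by rewrite mxE. Qed.

Opaque pmx.

(** One frame index of the Koszul formula. The [t] are derivatives of the coframe, paired with the
    derivatives where the two indices are exchanged; the [c] are the Maurer-Cartan defects of these
    exchanges. *)
Lemma koszul_summand (R : realType) (t1 t2 t3 t4 t5 t6 c1 c2 c3 fi fj fl : R) :
  t1 = t2 - c1 -> t3 = t4 - c2 -> t5 = t6 - c3 ->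
  t1 * fl + fj * t3 + (t2 * fl + fi * t5) - (t4 * fj + fi * t6)
  = 2 * (fl * t1) + (c1 * fl - fj * c2 - fi * c3).
Proof. by move=> -> -> ->; ring. Qed.

(* How the curvature of a connection changes under the gauge transformation [F],
   whose first derivatives are [A] and [B]; [V] and [W] are two components of the
   connection form. *)
Lemma gauge_algebra {R : comPzRingType} {n} (A B F E W V H D : 'M[R]_n) :
  E *m F = 1%:M ->
  (H + (A *m V + F *m D)) *m E + (B + F *m V) *m - (E *m A *m E)
   + (B + F *m V) *m E *m ((A + F *m W) *m E)
  = (H + (A *m V + B *m W) + F *m (D + V *m W)) *m E.
Proof.
move=> EF; have -> : (B + F *m V) *m E *m ((A + F *m W) *m E) =
    (B + F *m V) *m (E *m A *m E) + (B + F *m V) *m W *m E.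
  rewrite [in LHS]mulmxA mulmxDr mulmxDl !mulmxA; congr (_ + _).
  by rewrite -[_ *m E *m F]mulmxA EF mulmx1.
rewrite mulmxN -addrA addKr -mulmxDl; congr (_ *m _).
by rewrite mulmxDr mulmxDl !mulmxA -!addrA; congr (_ + (_ + _)); rewrite addrCA addrC -addrA.
Qed.

Lemma mx_curvature_entry {R : comPzRingType} {n} (A B C D G H : 'M[R]_n) k l :
  (A + B *m C - (D + G *m H)) k l =
  A k l - D k l + (\sum_m B k m * C m l - \sum_m G k m * H m l).
Proof. by rewrite !mxE opprD addrACA. Qed.

Lemma gauge_cancel {R : comPzRingType} {n} (F A B D G H : 'M[R]_n) :
  H + (A + B) + F *m D - (H + (B + A) + F *m G) = F *m (D - G).
Proof. by rewrite [B + A]addrC [_ + F *m D]addrC addrKA mulmxBr. Qed.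

(** [F x i a] is the value of the coframe form a on the coordinate field i, and the rows of [E x]
    are the frame vectors in coordinates. [maurer_cartan] is the structure equation of a frame whose
    brackets have constant coefficients [c]. *)
Section FrameCurvature.
Context {R : realType} {n : nat}.
Variables (U : set 'rV[R]_n) (F E : 'rV[R]_n -> 'M[R]_n) (c : 'I_n -> 'M[R]_n).
Hypotheses (oU : open U)
  (sF : forall i j, Ck_on 2 U (fun x => F x i j))
  (sE : forall i j, Ck_on 1 U (fun x => E x i j))
  (FE : forall x, U x -> F x *m E x = 1%:M)
  (maurer_cartan : forall x, U x -> forall k i a,
     pmx k F x i a - pmx i F x k a = - \sum_b \sum_d F x k b * F x i d * c b d a).

(* The Levi-Civita connection of the orthonormal frame [e] with [F *m F^T] as
   Gram matrix: the coefficient of [e_a] in [D_(e_b) e_d]. *)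
Definition frame_connection (b : 'I_n) : 'M[R]_n :=
  \matrix_(d, a) (2^-1 * (c b d a - c b a d - c d a b)).

Local Notation Om := frame_connection.

Definition connection_form (i : 'I_n) (x : 'rV[R]_n) : 'M[R]_n := \sum_b F x i b *: Om b.

Local Notation W := connection_form.

(** The curvature operator of e_d and e_e. Rows are inputs, so composing covariant derivatives
    reverses the matrix product; the last sum is the derivative along the bracket of e_d and e_e. *)
Definition frame_curvature (d e : 'I_n) : 'M[R]_n :=
  Om e *m Om d - Om d *m Om e - \sum_b c d e b *: Om b.

(** Row j holds the frame coefficients of the covariant derivative of the coordinate field j along
    the coordinate field i. *)
Let X i x := pmx i F x + F x *m W i x.

Lemma frame_EF x : U x -> E x *m F x = 1%:M.
Proof. by move=> Ux; apply: mulmx1C; exact: FE. Qed.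

Lemma frame_dF i x : U x -> dmx i F x.
Proof. by move=> Ux a b; exact: Ck_on_derivable (sF a b) Ux. Qed.

Lemma frame_dE i x : U x -> dmx i E x.
Proof. by move=> Ux a b; exact: Ck_on_derivable (sE a b) Ux. Qed.

Lemma frame_gram_inv x : U x -> invmx (F x *m (F x)^T) = (E x)^T *m E x.
Proof.
move=> Ux; have H : F x *m (F x)^T *m ((E x)^T *m E x) = 1%:M.
  by rewrite mulmxA -[_ *m _ *m (E x)^T]mulmxA -trmx_mul frame_EF // trmx1 mulmx1 FE.
have [uG _] := mulmx1_unit H.
by rewrite -[LHS]mulmx1 -[X in _ *m X]H [LHS]mulmxA (mulVmx uG) mul1mx.
Qed.

(** The Koszul formula: the left side is the combination of metric derivatives in the Christoffel
    symbol, the right side twice the inner product of coordinate field l with the covariant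
    derivative whose coefficients are [X i x j]. Maurer-Cartan moves every derivative onto
    [pmx i F x j]; the remaining structure constants are those that define [Om]. *)
Lemma frame_koszul i j l x : U x ->
  \sum_a (pmx i F x j a * F x l a + F x j a * pmx i F x l a)
  + \sum_a (pmx j F x i a * F x l a + F x i a * pmx j F x l a)
  - \sum_a (pmx l F x i a * F x j a + F x i a * pmx l F x j a)
  = 2 * \sum_a F x l a * X i x j a.
Proof.
move=> Ux; pose C u v a := \sum_b \sum_d F x u b * F x v d * c b d a.
have MC k k' a : pmx k F x k' a = pmx k' F x k a - C k k' a.
  by rewrite -(maurer_cartan Ux) addrC subrK.
rewrite -big_split -sumrB /= mulr_sumr.
transitivity (\sum_a (2 * (F x l a * pmx i F x j a)
   + (C i j a * F x l a - F x j a * C i l a - F x i a * C j l a))).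
  apply: eq_bigr => a _.
  exact: koszul_summand (MC i j a) (MC i l a) (MC j l a).
have YE a : (F x *m W i x) j a =
    \sum_b \sum_d F x i b * F x j d * (2^-1 * (c b d a - c b a d - c d a b)).
  rewrite mxE exchange_big; apply: eq_bigr => d _.
  rewrite /W summxE mulr_sumr; apply: eq_bigr => b _.
  by rewrite !mxE; ring.
have XE a : X i x j a = pmx i F x j a + (F x *m W i x) j a by rewrite /X [LHS]mxE.
rewrite big_split /=; under [RHS]eq_bigr do rewrite XE mulrDr mulrDr.
rewrite [RHS]big_split /=; congr (_ + _).
rewrite !sumrB.
have -> : \sum_a F x j a * C i l a = \sum_a \sum_b \sum_d F x l a * F x i b * F x j d * c b a d.
  under eq_bigr => a _ do rewrite mulr_sumr.
  rewrite exchange_big.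
  transitivity (\sum_b \sum_a \sum_d F x l a * F x i b * F x j d * c b a d); last exact: exchange_big.
  apply: eq_bigr => b _; rewrite exchange_big; apply: eq_bigr => a _.
  by rewrite mulr_sumr; apply: eq_bigr => d _; ring.
have -> : \sum_a F x i a * C j l a = \sum_a \sum_b \sum_d F x l a * F x i b * F x j d * c d a b.
  under eq_bigr => b _ do rewrite mulr_sumr.
  rewrite exchange_big /=.
  transitivity (\sum_a \sum_d \sum_b F x l a * F x i b * F x j d * c d a b); last first.
    by apply: eq_bigr => a _; exact: exchange_big.
  rewrite [RHS]exchange_big /=; apply: eq_bigr => d _.
  under eq_bigr do rewrite mulr_sumr.
  rewrite exchange_big /=; apply: eq_bigr => a _; apply: eq_bigr => b _; ring.
rewrite -!sumrB; apply: eq_bigr => a _; rewrite YE mulr_sumr mulr_sumr.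
rewrite mulr_suml -!sumrB; apply: eq_bigr => b _; rewrite !mulr_sumr mulr_suml -!sumrB.
by apply: eq_bigr => d _; field.
Qed.

Let g x := F x *m (F x)^T.

Definition frame_christoffel i x : 'M[R]_n := (pmx i F x + F x *m W i x) *m E x.

Local Notation Gam := frame_christoffel.

Lemma frame_metric_partial i j l x : U x ->
  partial i (fun y => g y j l) x =
  \sum_a (pmx i F x j a * F x l a + F x j a * pmx i F x l a).
Proof.
move=> Ux; have dF : dmx i F x := frame_dF Ux; have [dT eT] := pmx_tr dF.
have [_ e] := pmx_mul dF dT.
have -> : partial i (fun y => g y j l) x = pmx i g x j l by rewrite [RHS]pmxE.
by rewrite /g e eT !mxE -big_split /=; apply: eq_bigr => a _; rewrite !mxE.
Qed.

Lemma christoffel_frame k i j x : U x -> christoffel g k i j x = Gam i x j k.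
Proof.
move=> Ux; rewrite /christoffel /g frame_gram_inv //.
have Kz l : partial i (fun y => g y j l) x + partial j (fun y => g y i l) x
     - partial l (fun y => g y i j) x = 2 * (F x *m (X i x)^T) l j.
  rewrite !frame_metric_partial // frame_koszul // mxE; congr (_ * _).
  by apply: eq_bigr => a _; rewrite [in RHS]mxE.
under eq_bigr => l _ do rewrite Kz mulrCA.
rewrite -mulr_sumr mulrA mulVf ?pnatr_eq0 // mul1r.
transitivity (((E x)^T *m E x *m (F x *m (X i x)^T)) k j); first by rewrite mxE.
rewrite mulmxA -[_ *m _ *m F x]mulmxA frame_EF // mulmx1 -trmx_mul.
by rewrite [LHS]mxE.
Qed.

Lemma pmx_dF i j x : U x -> dmx i (pmx j F) x.
Proof.
move=> Ux a b; have := Ck_on_derivable (i := i) (Ck_on_partial j (sF a b)) Ux.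
by rewrite (_ : (fun y => pmx j F y a b) = partial j (fun y => F y a b)) //;
  apply/funext => y; rewrite pmxE.
Qed.

Lemma pmx_sym i j x : U x -> pmx i (pmx j F) x = pmx j (pmx i F) x.
Proof.
move=> Ux; apply/matrixP => a b; rewrite [LHS]pmxE [RHS]pmxE.
have H k : (fun y => pmx k F y a b) = partial k (fun y => F y a b).
  by apply/funext => y; exact: pmxE.
have S := partialC_Ck i j oU (sF a b) Ux.
exact: etrans (congr1 (fun h => partial i h x) (H j))
  (etrans S (esym (congr1 (fun h => partial j h x) (H i)))).
Qed.

Lemma pmx_E i x : U x -> pmx i E x = - (E x *m pmx i F x *m E x).
Proof.
move=> Ux; have [_ e] := pmx_mul (frame_dF (i := i) Ux) (frame_dE (i := i) Ux).
have : pmx i (fun y => F y *m E y) x = 0.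
  by rewrite (pmx_eq_on i (N := fun=> 1%:M) oU FE Ux); have [_ ->] := pmx_cst i (1%:M : 'M[R]_n) x.
rewrite e => /(congr1 (mulmx (E x))).
rewrite mulmx0 mulmxDr !mulmxA frame_EF // mul1mx => /eqP.
by rewrite addr_eq0 => /eqP ->; rewrite opprK.
Qed.

Lemma pmx_W i j x : U x -> dmx i (W j) x /\
  pmx i (W j) x = \sum_b pmx i F x j b *: Om b.
Proof.
move=> Ux; apply: pmx_intro => a b.
rewrite summxE (_ : (fun y => _) = fun y => \sum_k F y j k * Om k a b); last first.
  by apply/funext => y; rewrite /W summxE; apply: eq_bigr => k _; rewrite mxE.
have -> : \sum_k (pmx i F x j k *: Om k) a b =
    \sum_k (pmx i F x j k * Om k a b + F x j k * 0).
  by apply: eq_bigr => k _; rewrite [LHS]mxE mulr0 addr0.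
apply: (@is_derive_bigsum _ 'rV[R]_n _ _ _ (fun k y => F y j k * Om k a b)
  (fun k => pmx i F x j k * Om k a b + F x j k * 0)) => k.
have D := pmx_is_derive j k (frame_dF (i := i) Ux).
exact: is_derive_mul D (is_derive_cst (Om k a b) x _).
Qed.

(** Antisymmetrising the left side in i and j gives the Riemann tensor. On the right, everything
    except [F x *m (pmx i (W j) x + W j x *m W i x)] is symmetric in i and j and will cancel. *)
Lemma pmx_christoffel i j x : U x ->
  pmx i (Gam j) x + Gam j x *m Gam i x =
  (pmx i (pmx j F) x + (pmx i F x *m W j x + pmx j F x *m W i x)
   + F x *m (pmx i (W j) x + W j x *m W i x)) *m E x.
Proof.
move=> Ux; have [dW _] := pmx_W i j Ux.
have [d1 e1] := pmx_mul (frame_dF (i := i) Ux) dW.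
have [d2 e2] := pmx_add (pmx_dF (i := i) (j := j) Ux) d1.
have [_ ->] := pmx_mul d2 (frame_dE (i := i) Ux).
rewrite e2 e1 pmx_E //; exact: gauge_algebra (frame_EF Ux).
Qed.

Lemma connection_form_mul i j x :
  W j x *m W i x = \sum_d \sum_e (F x i d * F x j e) *: (Om e *m Om d).
Proof.
rewrite /W mulmx_suml exchange_big /=; apply: eq_bigr => e _.
rewrite mulmx_sumr; apply: eq_bigr => d _.
by rewrite -scalemxAl -scalemxAr scalerA mulrC.
Qed.

Lemma riemann_frame l k i j x : U x -> riemann g l k i j x =
  \sum_d \sum_e F x i d * F x j e * (F x *m frame_curvature d e *m E x) k l.
Proof.
move=> Ux.
have dG a b p q : partial a (christoffel g q b p) x = pmx a (Gam b) x p q.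
  rewrite pmxE; apply: (partial_eq_on _ oU _ Ux) => y Uy.
  exact: christoffel_frame.
rewrite /riemann !dG sumrB.
under eq_bigr => m _ do rewrite !christoffel_frame // mulrC.
rewrite addrA; under [X in _ - X]eq_bigr => m _ do rewrite !christoffel_frame // mulrC.
transitivity ((pmx i (Gam j) x + Gam j x *m Gam i x
   - (pmx j (Gam i) x + Gam i x *m Gam j x)) k l).
  by rewrite mx_curvature_entry addrA.
rewrite (pmx_christoffel i j Ux) (pmx_christoffel j i Ux) (pmx_sym j i Ux) -mulmxBl.
have -> : pmx i (pmx j F) x + (pmx i F x *m W j x + pmx j F x *m W i x)
    + F x *m (pmx i (W j) x + W j x *m W i x)
  - (pmx i (pmx j F) x + (pmx j F x *m W i x + pmx i F x *m W j x)
    + F x *m (pmx j (W i) x + W i x *m W j x))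
  = F x *m (\sum_d \sum_e (F x i d * F x j e) *: frame_curvature d e).
  rewrite gauge_cancel; congr (_ *m _); have [_ ->] := pmx_W i j Ux; have [_ ->] := pmx_W j i Ux.
  rewrite opprD addrACA -sumrB.
  (* Since the matrices [Om b] are constant, the exterior derivative of the connection form only
     sees the coframe, and Maurer-Cartan turns it into the bracket term of [frame_curvature]. *)
  have -> : \sum_b (pmx i F x j b *: Om b - pmx j F x i b *: Om b) =
     - \sum_d \sum_e (F x i d * F x j e) *: \sum_b c d e b *: Om b.
    under eq_bigr => b _ do rewrite -scalerBl maurer_cartan // scaleNr scaler_suml.
    rewrite sumrN; congr (- _); rewrite exchange_big /=; apply: eq_bigr => d _.
    under eq_bigr => b _ do rewrite scaler_suml.
    rewrite exchange_big /=; apply: eq_bigr => e _; rewrite scaler_sumr.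
    by apply: eq_bigr => b _; rewrite scalerA.
  rewrite (connection_form_mul i j) (connection_form_mul j i).
  rewrite [X in _ - X]exchange_big /= addrC -sumrB -sumrB; apply: eq_bigr => d _.
  rewrite -!sumrB; apply: eq_bigr => e _.
  by rewrite [F x j e * F x i d]mulrC -!scalerBr.
rewrite mulmx_sumr mulmx_suml summxE; apply: eq_bigr => d _.
rewrite mulmx_sumr mulmx_suml summxE; apply: eq_bigr => e _.
by rewrite -scalemxAr -scalemxAl mxE.
Qed.

End FrameCurvature.

(** * Brackets and their Ricci forms *)

Lemma mx_subB_entry {R : pzRingType} {p q} (A B C : 'M[R]_(p, q)) i j :
  (A - B - C) i j = A i j - B i j - C i j.
Proof. by rewrite !mxE. Qed.

Lemma mx_addB_entry {R : pzRingType} {p q} (A B C : 'M[R]_(p, q)) i j :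
  (A + B - C) i j = A i j + B i j - C i j.
Proof. by rewrite !mxE. Qed.

Section BracketAlgebra.
Context {R : realType} {n : nat}.
Implicit Types (c : 'I_n -> 'M[R]_n) (Q S P W : 'M[R]_n).

(* [c a b e] is the coefficient of [e_e] in [[e_a, e_b]]. *)
Definition bracket_anti c := forall a b e, c a b e = - c b a e.

Definition killing_null c := forall a b, \tr (c a *m c b) = 0.

Definition unimodular c := forall a, \tr (c a) = 0.

Definition ricci_form c : 'M[R]_n := \matrix_(e, f)
  (- 2^-1 * (\sum_i \sum_j c e i j * c f i j) + 4^-1 * (\sum_i \sum_j c i j e * c i j f)).

Definition bracket_norm c : R := \sum_a \sum_b \sum_e c a b e ^+ 2.

(* The structure constants in the frame obtained by the change of basis [Q], with
   [S] its inverse. *)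
Definition frame_bracket S Q c (a : 'I_n) : 'M[R]_n :=
  \sum_d S a d *: (S *m c d *m Q).

Lemma ricci_form_sym c : (ricci_form c)^T = ricci_form c.
Proof.
apply/matrixP => e f; rewrite !mxE; congr (_ * _ + _ * _);
  by apply: eq_bigr => i _; apply: eq_bigr => j _; rewrite mulrC.
Qed.

Lemma frame_connection_torsion c a b e : bracket_anti c ->
  c a b e = frame_connection c a b e - frame_connection c b a e.
Proof. by move=> anti; rewrite !mxE (anti b a); field. Qed.

(** The sum is the divergence of e_b, which is minus the trace of its adjoint. *)
Lemma frame_connection_trace c b : bracket_anti c -> unimodular c ->
  \sum_d frame_connection c d b d = 0.
Proof.
move=> anti uni; transitivity (- \sum_d c b d d).
  rewrite -sumrN; apply: eq_bigr => d _; rewrite mxE (anti d b).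
  have : c d d b = 0 by have := anti d d b; lra.
  by move=> ->; field.
by rewrite -/(\tr (c b)) uni oppr0.
Qed.

(** Each product of two connection coefficients expands into nine terms. Two sum to the Killing
    form, the mixed sums [Z1] and [Z2] each occur with both signs by antisymmetry, and [A] and [B]
    remain. *)
Lemma frame_connection_pair c e f : bracket_anti c -> killing_null c ->
  - (\sum_d \sum_b frame_connection c d e b * frame_connection c b f d) =
  ricci_form c e f.
Proof.
move=> anti kil; pose x (h d b : 'I_n) := c h d b.
pose SS (h : 'I_n -> 'I_n -> R) := \sum_d \sum_b h d b.
have swap h : SS (fun d b => h b d) = SS h by rewrite /SS exchange_big.
have SD h k : SS (fun d b => h d b + k d b) = SS h + SS k.
  by rewrite /SS -big_split; apply: eq_bigr => d _; rewrite big_split.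
have SN h : SS (fun d b => - h d b) = - SS h.
  by rewrite /SS -sumrN; apply: eq_bigr => d _; rewrite sumrN.
have SZ a h : SS (fun d b => a * h d b) = a * SS h.
  by rewrite /SS mulr_sumr; apply: eq_bigr => d _; rewrite mulr_sumr.
have Seq h k : (forall d b, h d b = k d b) -> SS h = SS k.
  by move=> hk; apply: eq_bigr => d _; apply: eq_bigr => b _.
have kil' : SS (fun d b => c e d b * c f b d) = 0.
  rewrite -(kil e f) /SS /mxtrace; apply: eq_bigr => d _; by rewrite mxE.
pose A := SS (fun d b => c e d b * c f d b).
pose B := SS (fun d b => c d b e * c d b f).
pose Z1 := SS (fun d b => c d b e * c f d b).
pose Z2 := SS (fun d b => c d b f * c e d b).
have -> : ricci_form c e f = - 2^-1 * A + 4^-1 * B by rewrite mxE.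
rewrite -/(SS (fun d b => frame_connection c d e b * frame_connection c b f d)).
have E1 : SS (fun d b => c e b d * c f b d) = A by rewrite -[RHS]swap.
have E2 : SS (fun d b => c e b d * c f d b) = 0 by rewrite -[RHS]kil' -[RHS]swap.
have E3 : SS (fun d b => c d b e * c f b d) = - Z1.
  by rewrite -SN -[RHS]swap; apply: Seq => d b; rewrite (anti d b); ring.
have E4 : SS (fun d b => c d b f * c e b d) = - Z2.
  by rewrite -SN -[RHS]swap; apply: Seq => d b; rewrite (anti d b); ring.
rewrite (Seq _ (fun d b => 4^-1 * ((((c e d b * c f d b + c e b d * c f b d)
   + (c e d b * c f b d + c e b d * c f d b)) + - (c d b e * c d b f))
   + ((c d b e * c f d b + c d b e * c f b d) + - (c d b f * c e d b + c d b f * c e b d))))).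
  by rewrite SZ !SD !SN !SD -/A -/B E1 kil' E2 -/Z1 E3 -/Z2 E4; field.
by move=> d b; rewrite !mxE (anti b d f) (anti d e b) (anti b f d); field.
Qed.

(** Of the two quadratic terms in the curvature, the first contains a divergence and vanishes. The
    second cancels against half of the bracket term, once the bracket is written as a difference of
    connection coefficients. *)
Lemma ricci_trace c e f : bracket_anti c -> unimodular c -> killing_null c ->
  \sum_d frame_curvature c d e f d = ricci_form c e f.
Proof.
move=> anti uni kil; rewrite -frame_connection_pair //.
transitivity (\sum_d (\sum_m frame_connection c e f m * frame_connection c d m d)
   - (\sum_d \sum_m frame_connection c d f m * frame_connection c e m d
      + \sum_d \sum_b c d e b * frame_connection c b f d)).
  rewrite -big_split -sumrB; apply: eq_bigr => d _ /=.
  rewrite /frame_curvature mx_subB_entry summxE opprD addrA; congr (_ - _ - _).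
  - by rewrite mxE.
  - by rewrite !mxE.
  - by apply: eq_bigr => b _; rewrite [LHS]mxE.
rewrite exchange_big /= big1 ?sub0r; last first.
  by move=> m _; rewrite -mulr_sumr frame_connection_trace // mulr0.
congr (- _).
have -> : \sum_d \sum_b c d e b * frame_connection c b f d =
  \sum_d \sum_b frame_connection c d e b * frame_connection c b f d
  - \sum_d \sum_b frame_connection c e d b * frame_connection c b f d.
  rewrite -sumrB; apply: eq_bigr => d _; rewrite -sumrB; apply: eq_bigr => b _.
  by rewrite {1}(frame_connection_torsion d e b anti) mulrBl.
rewrite addrCA [X in _ + (X - _)]exchange_big /=.
rewrite -[RHS]addr0; congr (_ + _).
apply/eqP; rewrite subr_eq0; apply/eqP.
by apply: eq_bigr => d _; apply: eq_bigr => m _; rewrite mulrC.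
Qed.

Lemma bracket_norm_ge0 c : 0 <= bracket_norm c.
Proof. by do 3!apply: sumr_ge0 => ? _; exact: sqr_ge0. Qed.

Lemma bracket_entry_le c a b e : c a b e ^+ 2 <= bracket_norm c.
Proof.
rewrite /bracket_norm (bigD1 a) //= (bigD1 b) //= (bigD1 e) //= -!addrA lerDl.
do !apply: addr_ge0; apply: sumr_ge0 => ? _; rewrite ?sqr_ge0 //;
  by do ?[apply: sumr_ge0 => ? _]; rewrite ?sqr_ge0.
Qed.

Lemma ricci_form_trace c : \tr (ricci_form c) = - 4^-1 * bracket_norm c.
Proof.
rewrite /mxtrace; under eq_bigr do rewrite mxE.
rewrite big_split /= -!mulr_sumr.
have -> : \sum_e \sum_i \sum_j c e i j * c e i j = bracket_norm c.
  by do 3!apply: eq_bigr => ? _; rewrite expr2.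
have -> : \sum_e \sum_i \sum_j c i j e * c i j e = bracket_norm c.
  rewrite exchange_big /=; apply: eq_bigr => i _.
  by rewrite exchange_big /=; do 2!apply: eq_bigr => ? _; rewrite expr2.
by field.
Qed.

Lemma ricci_form_le c e f : `|ricci_form c e f| <= bracket_norm c.
Proof.
have am (x y : R) : `|x * y| <= 2^-1 * (x ^+ 2 + y ^+ 2).
  have := sqr_ge0 (x - y); have := sqr_ge0 (x + y); rewrite sqrrB sqrrD !expr2.
  by rewrite ler_norml; set p := x * y; set q := x * x; set r := y * y => *; lra.
have H (h k : 'I_n -> 'I_n -> R) :
    `|\sum_i \sum_j h i j * k i j| <= 2^-1 * (\sum_i \sum_j h i j ^+ 2 + \sum_i \sum_j k i j ^+ 2).
  apply: le_trans (ler_norm_sum _ _ _) _; rewrite -big_split mulr_sumr.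
  apply: ler_sum => i _; apply: le_trans (ler_norm_sum _ _ _) _.
  rewrite -big_split mulr_sumr; exact: ler_sum.
have A1 h : \sum_i \sum_j c h i j ^+ 2 <= bracket_norm c.
  rewrite /bracket_norm [leRHS](bigD1 h) //= lerDl.
  by do 3!apply: sumr_ge0 => ? _; exact: sqr_ge0.
have A2 h : \sum_i \sum_j c i j h ^+ 2 <= bracket_norm c.
  apply: ler_sum => i _; apply: ler_sum => j _.
  by rewrite [leRHS](bigD1 h) //= lerDl; apply: sumr_ge0 => ? _; exact: sqr_ge0.
rewrite mxE; apply: le_trans (ler_normD _ _) _.
have h1 := H (fun i j => c e i j) (fun i j => c f i j).
have h2 := H (fun i j => c i j e) (fun i j => c i j f).
have := A1 e; have := A1 f; have := A2 e; have := A2 f.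
rewrite !normrM normrN ![`|_^-1|]gtr0_norm ?invr_gt0 //.
have := bracket_norm_ge0 c; move: h1 h2 => /=.
lra.
Qed.

(* Completing the square with the multiple [u / (4 (n + 1))] of the identity,
   where [u] is the squared norm of the bracket. *)
Lemma ricci_form_sqr_ge c :
  bracket_norm c ^+ 2 / (16 * n.+1%:R) <= \sum_e \sum_f ricci_form c e f ^+ 2.
Proof.
set u := bracket_norm c; have N0 : 0 < n.+1%:R :> R by [].
pose l := u / (4 * n.+1%:R).
apply: (@le_trans _ _ (\sum_e ricci_form c e e ^+ 2)); last first.
  apply: ler_sum => e _; rewrite (bigD1 e) //= lerDl.
  by apply: sumr_ge0 => f _; exact: sqr_ge0.
have : 0 <= \sum_e (ricci_form c e e + l) ^+ 2 by apply: sumr_ge0 => e _; exact: sqr_ge0.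
have -> : \sum_e (ricci_form c e e + l) ^+ 2 =
    \sum_e ricci_form c e e ^+ 2 + 2 * l * (\sum_e ricci_form c e e) + l ^+ 2 *+ n.
  have -> : l ^+ 2 *+ n = \sum_(e < n) l ^+ 2 by rewrite sumr_const card_ord.
  by rewrite mulr_sumr -!big_split /=; apply: eq_bigr => e _; ring.
have -> : \sum_e ricci_form c e e = - 4^-1 * u by exact: ricci_form_trace.
have -> : 2 * l * (- 4^-1 * u) = - 2 * (u ^+ 2 / (16 * n.+1%:R)).
  by rewrite /l; field; rewrite gt_eqF.
have : l ^+ 2 *+ n <= u ^+ 2 / (16 * n.+1%:R).
  rewrite -mulr_natr.
  have -> : u ^+ 2 / (16 * n.+1%:R) = l ^+ 2 * n.+1%:R by rewrite /l; field; rewrite gt_eqF.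
  by rewrite ler_wpM2l ?sqr_ge0 // ler_nat.
move: (l ^+ 2 *+ n) (u ^+ 2 / _) (\sum_e _) => p q r; lra.
Qed.

(** With s the square root of u, entries of [c] are at most s and connection coefficients at most 3
    s / 2. The three sums of n terms then give 9/4 + 9/4 + 3/2 = 6. *)
Lemma frame_curvature_le c d e f h :
  `|frame_curvature c d e f h| <= 6 * n%:R * bracket_norm c.
Proof.
set u := bracket_norm c; pose s := Num.sqrt u.
have u0 : 0 <= u := bracket_norm_ge0 c.
have s0 : 0 <= s := sqrtr_ge0 u.
have ss : s * s = u by rewrite -expr2 sqr_sqrtr.
have cs i j k : `|c i j k| <= s.
  by rewrite -sqrtr_sqr ler_sqrt // ?bracket_entry_le.
have os i j k : `|frame_connection c i j k| <= 3 / 2 * s.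
  rewrite mxE normrM gtr0_norm ?invr_gt0 //.
  have := cs i j k; have := cs i k j; have := cs j k i.
  have := ler_normB (c i j k - c i k j) (c j k i).
  have := ler_normB (c i j k) (c i k j); lra.
have oo i j k i' j' k' : `|frame_connection c i j k * frame_connection c i' j' k'| <= 9 / 4 * u.
  rewrite normrM -ss; apply: le_trans (ler_pM _ _ (os i j k) (os i' j' k')) _ => //; lra.
have co i j k i' j' k' : `|c i j k * frame_connection c i' j' k'| <= 3 / 2 * u.
  rewrite normrM -ss; apply: le_trans (ler_pM _ _ (cs i j k) (os i' j' k')) _ => //; lra.
have S (g : 'I_n -> R) B : (forall i, `|g i| <= B) -> `|\sum_i g i| <= n%:R * B.
  move=> gB; apply: le_trans (ler_norm_sum _ _ _) _.
  by apply: le_trans (ler_sum _ (fun i _ => gB i)) _; rewrite sumr_const card_ord mulr_natl.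
rewrite mx_subB_entry summxE.
have h1 := S _ _ (fun m => oo e f m d m h).
have h2 := S _ _ (fun m => oo d f m e m h).
have h3 : `|\sum_b (c d e b *: frame_connection c b) f h| <= n%:R * (3 / 2 * u).
  by apply: S => b; rewrite mxE.
apply: le_trans (ler_normB _ _) _; apply: le_trans (lerD (ler_normB _ _) h3) _.
rewrite mxE [X in _ + `|X| + _]mxE.
apply: le_trans (lerD (lerD h1 h2) (lexx _)) _.
have : 0 <= n%:R * u by rewrite mulr_ge0.
lra.
Qed.

Lemma frame_bracketE S Q c a b e :
  frame_bracket S Q c a b e = \sum_d S a d * (S *m c d *m Q) b e.
Proof. by rewrite summxE; apply: eq_bigr => d _; rewrite mxE. Qed.

Lemma frame_bracket_anti S Q c : bracket_anti c -> bracket_anti (frame_bracket S Q c).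
Proof.
move=> anti a b e.
have E a' b' : frame_bracket S Q c a' b' e =
    \sum_d \sum_j \sum_i S a' d * S b' i * c d i j * Q j e.
  rewrite frame_bracketE; apply: eq_bigr => d _; rewrite mxE mulr_sumr.
  by apply: eq_bigr => j _; rewrite mxE mulr_suml mulr_sumr; apply: eq_bigr => i _; ring.
rewrite !E exchange_big [in RHS]exchange_big /= -sumrN; apply: eq_bigr => j _.
rewrite exchange_big -sumrN; apply: eq_bigr => i _ /=; rewrite -sumrN.
by apply: eq_bigr => d _; rewrite (anti d i); ring.
Qed.

Lemma frame_bracket_unimodular S Q c : Q *m S = 1%:M ->
  unimodular c -> unimodular (frame_bracket S Q c).
Proof.
move=> QS uni a; rewrite /frame_bracket raddf_sum big1 // => d _ /=.
by rewrite mxtraceZ mxtrace_mulC mulmxA QS mul1mx uni mulr0.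
Qed.

Lemma frame_bracket_killing S Q c : Q *m S = 1%:M ->
  killing_null c -> killing_null (frame_bracket S Q c).
Proof.
move=> QS kil a b; rewrite /frame_bracket mulmx_suml raddf_sum big1 // => d _ /=.
rewrite mulmx_sumr raddf_sum big1 // => e _ /=.
rewrite -scalemxAl -scalemxAr !mxtraceZ.
have -> : S *m c d *m Q *m (S *m c e *m Q) = S *m (c d *m c e) *m Q.
  by rewrite !mulmxA -[_ *m Q *m S]mulmxA QS mulmx1.
by rewrite mxtrace_mulC !mulmxA QS mul1mx kil !mulr0.
Qed.

(* The Ricci tensor in terms of the Gram matrix [P] and its inverse [W], with no
   orthonormal frame: this makes sense along flows that do not come from one. *)
Definition gram_ricci c P W : 'M[R]_n :=
  - 2^-1 *: (\matrix_(a, b) \tr (W *m c a *m P *m (c b)^T))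
  + 4^-1 *: (P *m (\sum_a \sum_d W a d *: ((c a)^T *m W *m c d)) *m P).

(** The Ricci tensor does not depend on the orthonormal frame: after expansion, the frame enters
    only through [Q *m Q^T] and [S^T *m S]. *)
Lemma gram_ricciE S Q c :  Q *m S = 1%:M ->
  Q *m ricci_form (frame_bracket S Q c) *m Q^T = gram_ricci c (Q *m Q^T) (S^T *m S).
Proof.
move=> QS; have SQ : S *m Q = 1%:M := mulmx1C QS.
set k := frame_bracket S Q c.
pose T : 'M[R]_n := \matrix_(a, b) \tr (S^T *m S *m c a *m (Q *m Q^T) *m (c b)^T).
pose B := \sum_a \sum_d (S^T *m S) a d *: ((c a)^T *m (S^T *m S) *m c d).
have -> : ricci_form k = - 2^-1 *: (S *m T *m S^T) + 4^-1 *: (Q^T *m B *m Q).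
  apply/matrixP => e f; rewrite [LHS]mxE [RHS]mxE [X in _ = X + _]mxE [X in _ = _ + X]mxE.
  congr (_ * _ + _ * _).
    transitivity (\tr (k e *m (k f)^T)).
      rewrite /mxtrace; apply: eq_bigr => i _; rewrite mxE.
      by apply: eq_bigr => j _; rewrite mxE.
    have TE d d' : \tr (S *m c d *m Q *m (S *m c d' *m Q)^T) = T d d'.
      by rewrite mxE !trmx_mul !mulmxA mxtrace_mulC !mulmxA.
    transitivity (\sum_d \sum_d' S e d * S f d' * T d d').
      rewrite /k /frame_bracket mulmx_suml raddf_sum; apply: eq_bigr => d _ /=.
      rewrite raddf_sum mulmx_sumr raddf_sum; apply: eq_bigr => d' _ /=.
      by rewrite linearZ /= -scalemxAl -scalemxAr !mxtraceZ TE mulrA.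
    rewrite mxE exchange_big /=; apply: eq_bigr => d' _.
    rewrite [(S *m T) e d']mxE mulr_suml; apply: eq_bigr => d _.
    by rewrite [X in _ = _ * X]mxE; ring.
  transitivity ((\sum_i (k i)^T *m k i) e f).
    rewrite summxE; apply: eq_bigr => i _; rewrite mxE.
    by apply: eq_bigr => j _; rewrite mxE.
  congr (fun_of_matrix _ e f); rewrite /B mulmx_sumr mulmx_suml.
  transitivity (\sum_i \sum_d \sum_d' (S i d * S i d') *:
      (Q^T *m ((c d)^T *m (S^T *m S) *m c d') *m Q)).
    apply: eq_bigr => i _.
    have -> : (k i)^T = \sum_d S i d *: (S *m c d *m Q)^T.
      by rewrite /k /frame_bracket raddf_sum; apply: eq_bigr => d _; rewrite /= linearZ.
    rewrite mulmx_suml; apply: eq_bigr => d _ /=.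
    rewrite mulmx_sumr; apply: eq_bigr => d' _ /=.
    by rewrite -scalemxAl -scalemxAr scalerA !trmx_mul !mulmxA.
  rewrite exchange_big /=; apply: eq_bigr => d _.
  rewrite exchange_big mulmx_sumr mulmx_suml /=; apply: eq_bigr => d' _.
  rewrite -scalemxAr -scalemxAl -scaler_suml; congr (_ *: _).
  by rewrite mxE; apply: eq_bigr => i _; rewrite mxE.
rewrite /gram_ricci -/T -/B mulmxDr mulmxDl -!scalemxAr -!scalemxAl !mulmxA.
rewrite QS mul1mx -[T *m S^T *m Q^T]mulmxA -trmx_mul QS trmx1 mulmx1.
by [].
Qed.

(** The second factor is the velocity of the bracket along the flow, with one term for each of its
    three slots. Antisymmetry makes the two lower slots contribute equally, so the pairing is twice
    that of r with 2 A - B, and 2 A - B = - 4 r. *)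
Lemma bracket_evolution_pairing c (r := ricci_form c) : bracket_anti c ->
  \sum_a \sum_b \sum_e
     2 * c a b e * (\sum_d r a d *: c d + r *m c a - c a *m r) b e
  = - 8 * \sum_e \sum_f r e f ^+ 2.
Proof.
move=> anti; pose A e f := \sum_i \sum_j c e i j * c f i j.
pose B e f := \sum_i \sum_j c i j e * c i j f.
have rE e f : - 8 * r e f ^+ 2 = 2 * (r e f * A e f + r e f * A e f - r e f * B e f).
  have -> : r e f = - 2^-1 * A e f + 4^-1 * B e f by rewrite mxE.
  by field.
rewrite mulr_sumr.
transitivity (2 * (\sum_e \sum_f r e f * A e f + \sum_e \sum_f r e f * A e f
   - \sum_e \sum_f r e f * B e f)); last first.
  rewrite -big_split -sumrB /= mulr_sumr; apply: eq_bigr => e _.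
  rewrite -big_split -sumrB /= !mulr_sumr; apply: eq_bigr => f _.
  by rewrite rE.
transitivity (2 * (\sum_a \sum_b \sum_e \sum_d r a d * (c a b e * c d b e)
   + \sum_a \sum_b \sum_e \sum_d r b d * (c a b e * c a d e)
   - \sum_a \sum_b \sum_e \sum_d r d e * (c a b d * c a b e))).
  rewrite -big_split -sumrB /= mulr_sumr; apply: eq_bigr => a _.
  rewrite -big_split -sumrB /= mulr_sumr; apply: eq_bigr => b _.
  rewrite -big_split -sumrB /= mulr_sumr; apply: eq_bigr => e _.
  rewrite mx_addB_entry -mulrA [c a b e * _]mulrBr [c a b e * _]mulrDr summxE.
  congr (_ * (_ + _ - _)).
  + by rewrite mulr_sumr; apply: eq_bigr => d _; rewrite [X in _ * X = _]mxE; ring.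
  + by rewrite mxE mulr_sumr; apply: eq_bigr => d _; ring.
  + by rewrite mxE mulr_sumr; apply: eq_bigr => d _; ring.
congr (_ * (_ + _ - _)).
- apply: eq_bigr => a _.
  under eq_bigr => b _ do rewrite exchange_big.
  rewrite exchange_big /=; apply: eq_bigr => d _.
  by rewrite mulr_sumr; apply: eq_bigr => b _; rewrite mulr_sumr.
- rewrite exchange_big /=; apply: eq_bigr => b _.
  under eq_bigr => a _ do rewrite exchange_big.
  rewrite exchange_big /=; apply: eq_bigr => d _.
  rewrite mulr_sumr; apply: eq_bigr => a _; rewrite mulr_sumr; apply: eq_bigr => e _.
  by rewrite (anti a b) (anti a d) mulrNN.
- under eq_bigr => a _ do under eq_bigr => b _ do rewrite exchange_big.
  under eq_bigr => a _ do rewrite exchange_big /=.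
  rewrite exchange_big /=; apply: eq_bigr => d _.
  under eq_bigr => a _ do rewrite exchange_big /=.
  rewrite exchange_big /=; apply: eq_bigr => e _.
  by rewrite mulr_sumr; apply: eq_bigr => a _; rewrite mulr_sumr.
Qed.

End BracketAlgebra.

(** * Ordinary differential equations *)

Section RealLine.
Context {R : realType}.
Implicit Types (f g : R -> R) (a b t x : R).

Lemma is_derive_continuous f t d : is_derive t 1 f d -> {for t, continuous f}.
Proof. by move=> [df _]; apply/differentiable_continuous/derivable1_diffP. Qed.

Lemma continuous_within_itv f a b :
  (forall t, a <= t <= b -> {for t, continuous f}) -> {within `[a, b], continuous f}.
Proof.
by move=> cf; apply: continuous_in_subspaceT => t; rewrite inE /= in_itv /=; exact: cf.
Qed.

Lemma derive_le0_le f df a b : a <= b ->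
  (forall t, a < t < b -> is_derive t 1 f (df t) /\ df t <= 0) ->
  (forall t, a <= t <= b -> {for t, continuous f}) -> f b <= f a.
Proof.
rewrite le_eqVlt => /predU1P[->//|ab] D /continuous_within_itv cf.
have D1 x : x \in `]a, b[ -> is_derive x 1 f (df x) by rewrite in_itv /= => /D[].
have [x xab e] := MVT ab D1 cf; rewrite -subr_le0 e.
have [_ d0] : is_derive x 1 f (df x) /\ df x <= 0 by apply: D; move: xab; rewrite in_itv.
by rewrite mulr_le0_ge0 // subr_ge0 ltW.
Qed.

Lemma derive_norm_le f df g dg a b : a <= b -> `|f a| <= g a ->
  (forall t, a < t < b -> [/\ is_derive t 1 f (df t), is_derive t 1 g (dg t) & `|df t| <= dg t]) ->
  (forall t, a <= t <= b -> {for t, continuous f} /\ {for t, continuous g}) ->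
  `|f b| <= g b.
Proof.
move=> ab fa D c; move: fa; rewrite !ler_norml => /andP[fa1 fa2].
have h1 : f b - g b <= f a - g a.
  apply: (@derive_le0_le (fun t => f t - g t) (fun t => df t - dg t)) => //.
    move=> t /D[d1 d2]; rewrite ler_norml => /andP[_ h]; split; last by rewrite subr_le0.
    exact: is_derive_sub.
  by move=> t /c[c1 c2]; exact: (cvgB c1 c2).
have h2 : - f b - g b <= - f a - g a.
  apply: (@derive_le0_le (fun t => - f t - g t) (fun t => - df t - dg t)) => //.
    move=> t /D[d1 d2]; rewrite ler_norml => /andP[h _]; split; last by lra.
    exact: is_derive_sub (is_deriveN d1) d2.
  by move=> t /c[c1 c2]; exact: (cvgB (cvgN c1) c2).
by apply/andP; split; lra.
Qed.

Lemma is_derive_expR_scale k t : is_derive t 1 (fun s => expR (k * s)) (k * expR (k * t)).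
Proof.
have D : is_derive t 1 (fun s : R => k * s) k.
  have := is_derive_mul (is_derive_cst k t 1) (is_derive_id t (1 : R)).
  by rewrite mul0r add0r mulr1.
by have := is_derive1_comp (is_derive_expR (k * t)) D; rewrite mulrC.
Qed.

(** Integrating from -1 puts 0 in the interior of the interval, so that the fundamental theorem
    yields a two-sided derivative at 0 as well. *)
Definition primitive g x : R :=
  (\int[lebesgue_measure]_(s in `[-1, x]) g s - \int[lebesgue_measure]_(s in `[-1, 0%R]) g s)%R.

Lemma primitive0 g : primitive g 0 = 0.
Proof. exact: subrr. Qed.

Lemma is_derive_primitive g x : continuous g -> 0 <= x -> is_derive x 1 (primitive g) (g x).
Proof.
move=> cg x0; have x1 : x < x + 1 by rewrite ltrDl.
have ig : lebesgue_measure.-integrable `[-1, x + 1] (EFin \o g).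
  apply: continuous_compact_integrable; first exact: segment_compact.
  exact: continuous_subspaceT.
have m1x : -1 < x by rewrite (lt_le_trans _ x0) // oppr_lt0.
have [D e] := continuous_FTC1_closed x1 ig m1x (cg x).
pose k : R := (\int[lebesgue_measure]_(s in `[-1, 0%R]) g s)%R.
rewrite -[g x]subr0 -e derive1E.
exact: is_derive_sub (derivableP D) (is_derive_cst k x _).
Qed.

(** The intervals of radius 2 C / 2^k around [u k] are nested; the supremum of their left ends lies
    in all of them. The bound for k = 0 already forces C to be nonnegative. *)
Lemma geometric_limit (u : nat -> R) (C : R) :
  (forall k, `|u k.+1 - u k| <= C / 2 ^+ k) ->
  exists l, forall k, `|l - u k| <= 2 * C / 2 ^+ k.
Proof.
move=> H; pose b k := u k - 2 * C / 2 ^+ k; pose d k := u k + 2 * C / 2 ^+ k.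
have C0 : 0 <= C by have := le_trans (normr_ge0 _) (H 0%N); rewrite expr0 divr1.
have e2 k : 2 * C / 2 ^+ k.+1 = C / 2 ^+ k.
  by rewrite exprS; field; rewrite expf_neq0.
have e1 k : 2 * C / 2 ^+ k = 2 * (C / 2 ^+ k) by rewrite mulrA.
have bS k : b k <= b k.+1.
  have := H k; rewrite ler_norml /b e2 e1 => /andP[]; lra.
have dS k : d k.+1 <= d k.
  have := H k; rewrite ler_norml /d e2 e1 => /andP[]; lra.
have bm j k : (j <= k)%N -> b j <= b k.
  by apply: (@homo_leq _ b (fun x y => x <= y)) => // y x z; exact: le_trans.
have dm j k : (j <= k)%N -> d k <= d j.
  by apply: (@homo_leq _ d (fun x y => y <= x)) => // y x z xy yz; exact: le_trans yz xy.
have bd j k : b j <= d k.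
  apply: (le_trans (bm _ (maxn j k) (leq_maxl _ _))).
  apply: le_trans (dm _ (maxn j k) (leq_maxr _ _)).
  rewrite /b /d lerD2l -subr_ge0 opprK addr_ge0 // divr_ge0 ?mulr_ge0 ?exprn_ge0 //.
have hs : has_sup (range b).
  by split; [exists (b 0%N), 0%N|exists (d 0%N) => _ [j _ <-]].
exists (sup (range b)) => k.
have h1 : b k <= sup (range b) by apply: ub_le_sup; [case: hs|exists k].
have h2 : sup (range b) <= d k by apply: ge_sup; [case: hs|move=> _ [j _ <-]].
by rewrite ler_norml; move: h1 h2; rewrite /b /d => h1 h2; apply/andP; split; lra.
Qed.

Lemma le0_of_geometric (x C : R) : (forall k, x <= C / 2 ^+ k) -> x <= 0.
Proof.
move=> H; rewrite leNgt; apply/negP => x0.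
have C0 : 0 < C by have := lt_le_trans x0 (H 0%N); rewrite expr0 divr1.
have [k hk] : exists k : nat, C / x < k%:R.
  by exists (Num.bound (C / x)); rewrite archi_boundP // divr_ge0 ?ltW.
have k2 : k%:R <= 2 ^+ k :> R by rewrite -natrX ler_nat ltnW // ltn_expl.
have := H k; rewrite ler_pdivlMr ?exprn_gt0 // leNgt; apply/negP; rewrite negbK.
by rewrite mulrC -ltr_pdivrMr // (lt_le_trans hk).
Qed.

Lemma continuous_family_bounded (I : finType) (y : R -> I -> R) (T : R) : 0 <= T ->
  (forall i (t : R), 0 <= t <= T -> {for t, continuous (fun s => y s i)}) ->
  exists2 B : R, 0 <= B & forall i (t : R), 0 <= t <= T -> `|y t i| <= B.
Proof.
move=> T0 cy.
have H i : exists2 B : R, 0 <= B & forall t : R, 0 <= t <= T -> `|y t i| <= B.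
  have cw : {within `[0, T], continuous (fun t => `|y t i|)}.
    apply: continuous_within_itv => t tT.
    apply: (@continuous_comp _ _ _ (fun t => y t i) (fun s : R => `|s|)).
      exact: cy.
    exact: norm_continuous.
  have [c _ hc] := EVT_max T0 cw.
  by exists `|y c i| => // t tT; apply: hc; rewrite in_itv.
pose B i := sval (cid2 (H i)).
have B0 i : 0 <= B i by rewrite /B; case: cid2.
exists (\sum_i B i); first exact: sumr_ge0.
move=> i t tT; apply: (@le_trans _ _ (B i)).
  by rewrite /B; case: cid2 => /= x _; apply.
by rewrite (bigD1 i) //= lerDl sumr_ge0.
Qed.

End RealLine.

(** * Picard iteration for globally Lipschitz vector fields *)

Section GlobalLipschitzODE.
Context {R : realType} {I : finType}.
Variables (f : R -> (I -> R) -> I -> R) (y0 : I -> R).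
Hypothesis fcont : forall y : R -> I -> R,
  (forall i, continuous (fun s => y s i)) -> forall i, continuous (fun s => f s (y s) i).
Hypothesis flip : forall T : R, exists2 L : R, 0 <= L & forall s : R, 0 <= s <= T ->
  forall y z i, `|f s y i - f s z i| <= L * \sum_j `|y j - z j|.

(** The absolute values reflect the integrand at time 0. Curves are controlled only for nonnegative
    times, while [is_derive_primitive] needs an integrand continuous on the whole line. *)
Definition picard_step (y : R -> I -> R) (t : R) (i : I) : R :=
  y0 i + primitive (fun s => f `|s| (y `|s|) i) t.

Definition continuous_ge0 (y : R -> I -> R) :=
  forall (i : I) (t : R), 0 <= t -> {for t, continuous (fun s => y s i)}.

Lemma continuous_comp_norm (g : R -> R) :
  (forall t, 0 <= t -> {for t, continuous g}) -> continuous (fun s : R => g `|s|).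
Proof.
move=> cg s; apply: (@continuous_comp _ _ _ (fun s : R => `|s|) g).
  exact: norm_continuous.
exact: cg.
Qed.

Lemma picard_integrand_continuous y i : continuous_ge0 y ->
  continuous (fun s : R => f `|s| (y `|s|) i).
Proof.
move=> cy; have H j : continuous (fun s : R => y `|s| j) by exact: (@continuous_comp_norm (fun s => y s j) (cy j)).
have H2 := fcont H (i := i).
have := continuous_comp_norm (fun t _ => H2 t).
by under eq_fun do rewrite normr_id.
Qed.

Lemma picard_step_derive y (i : I) (t : R) : continuous_ge0 y -> 0 <= t ->
  is_derive t 1 (fun s => picard_step y s i) (f t (y t) i).
Proof.
move=> cy t0; have := is_derive_primitive (picard_integrand_continuous (i := i) cy) t0.
rewrite ger0_norm // => D.
by have := is_derive_add (is_derive_cst (y0 i) t 1) D; rewrite add0r.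
Qed.

Lemma picard_step_continuous y : continuous_ge0 y -> continuous_ge0 (picard_step y).
Proof. by move=> cy i t t0; exact: is_derive_continuous (picard_step_derive i cy t0). Qed.

Definition picard (k : nat) : R -> I -> R := iter k picard_step (fun=> y0).

Lemma picard_continuous k : continuous_ge0 (picard k).
Proof.
elim: k => [|k IH]; last exact: picard_step_continuous.
by move=> i t _; exact: cst_continuous.
Qed.

Lemma picard_at0 k i : picard k 0 i = y0 i.
Proof. by case: k => [|k] //=; rewrite /picard_step primitive0 addr0. Qed.

(** Measured against the weight exp (K t), one Picard step halves distances on an interval of any
    length, so no subdivision of [0, T] is needed. *)
Lemma picard_contract (T : R) : 0 <= T -> exists2 C : R, 0 <= C & forall k i (t : R), 0 <= t <= T ->
  `|picard k.+1 t i - picard k t i| <= C / 2 ^+ k.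
Proof.
move=> T0; have [L L0 lip] := flip T.
(* The Lipschitz bound costs a factor m L, the derivative of the weight returns K; their ratio is
   the contraction factor 1/2. *)
pose m : R := #|I|%:R; pose K := 2 * m * L.
have K0 : 0 <= K by rewrite !mulr_ge0.
have [M M0 hM] : exists2 M : R, 0 <= M & forall i (t : R), 0 <= t <= T ->
    `|picard 1 t i - picard 0 t i| <= M.
  apply: (continuous_family_bounded (y := fun t i => picard 1 t i - picard 0 t i)) => // i t /andP[t0 _].
  have c1 : {for t, continuous (fun s => picard 1 s i)} := @picard_continuous 1%N i t t0.
  have c0 : {for t, continuous (fun s => picard 0 s i)} := @picard_continuous 0%N i t t0.
  exact: (cvgB c1 c0).
have claim k i (t : R) : 0 <= t <= T ->
    `|picard k.+1 t i - picard k t i| <= M / 2 ^+ k * expR (K * t).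
  elim: k i t => [|k IH] i t /andP[t0 tT].
    rewrite expr0 divr1 (le_trans (hM _ _ _)) ?t0 ?tT // -[leLHS]mulr1 ler_wpM2l //.
    by rewrite -expR0 ler_expR mulr_ge0.
  have c1 k' (s : R) (s0 : 0 <= s) : {for s, continuous (fun x => picard k' x i)} := @picard_continuous k' i s s0.
  apply: (@derive_norm_le _ (fun s => picard k.+2 s i - picard k.+1 s i)
    (fun s => f s (picard k.+1 s) i - f s (picard k s) i)
    (fun s => M / 2 ^+ k.+1 * expR (K * s))
    (fun s => M / 2 ^+ k.+1 * (K * expR (K * s))) 0 t) => //.
  - by rewrite !picard_at0 subrr normr0 mulr_ge0 ?expR_ge0 // divr_ge0 // exprn_ge0.
  - move=> s /andP[/ltW s0 /ltW st]; split.
    + exact: (is_derive_sub (picard_step_derive i (@picard_continuous k.+1) s0)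
        (picard_step_derive i (@picard_continuous k) s0)).
    + have := is_derive_mul (is_derive_cst (M / 2 ^+ k.+1) s 1) (is_derive_expR_scale K s).
      by rewrite mul0r add0r.
    + have sT : 0 <= s <= T by rewrite s0 (le_trans st tT).
      apply: (le_trans (lip _ sT _ _ i)).
      apply: (@le_trans _ _ (L * \sum_(j : I) (M / 2 ^+ k * expR (K * s)))).
        by rewrite ler_wpM2l //; apply: ler_sum => j _; exact: IH.
      rewrite sumr_const -mulr_natl -/m /K exprS le_eqVlt; apply/orP; left; apply/eqP.
      by field; rewrite expf_neq0.
  - move=> s /andP[s0 _]; split; first exact: (cvgB (c1 _ _ s0) (c1 _ _ s0)).
    have := is_derive_mul (is_derive_cst (M / 2 ^+ k.+1) s 1) (is_derive_expR_scale K s).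
    exact: is_derive_continuous.
exists (M * expR (K * T)); first by rewrite mulr_ge0 ?expR_ge0.
move=> k i t /andP[t0 tT]; apply: (le_trans (claim _ _ _ _)); first by rewrite t0.
rewrite mulrAC ler_wpM2r ?invr_ge0 ?exprn_ge0 // ler_wpM2l // ler_expR.
by rewrite ler_wpM2l.
Qed.

(** The limit is chosen separately for each time and index, whereas the rate depends on T. The
    choice therefore carries the estimate for every T and C at once. *)
Lemma picard_limit : exists y : R -> I -> R, forall T : R, 0 <= T ->
  exists2 C, 0 <= C & forall k i (t : R), 0 <= t <= T -> `|y t i - picard k t i| <= C / 2 ^+ k.
Proof.
have H (t : R) i : exists l : R, forall T C : R, 0 <= t <= T ->
    (forall k i (t : R), 0 <= t <= T -> `|picard k.+1 t i - picard k t i| <= C / 2 ^+ k) ->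
    forall k, `|l - picard k t i| <= 2 * C / 2 ^+ k.
  have [t0|t0] : 0 <= t \/ t < 0 by case: (leP 0 t); [left|right].
    2: by exists 0 => T C /andP[t1 _]; have := lt_le_trans t0 t1; rewrite ltxx.
  have [C0 _ hC0] := picard_contract t0.
  have tt : 0 <= t <= t by rewrite t0 lexx.
  have [l hl] := geometric_limit (fun k => hC0 k i t tt).
  exists l => T C tT hC k.
  have [l' hl'] := geometric_limit (fun k => hC k i t tT).
  suff -> : l = l' by exact: hl'.
  (* Limits obtained from two different rates agree, both being close to the same iterate. *)
  apply/eqP; rewrite -subr_eq0 -normr_le0; apply: (@le0_of_geometric _ _ (2 * C0 + 2 * C)) => j.
  rewrite mulrDl; apply: le_trans (ler_distD (picard j t i) _ _) _.
  by rewrite lerD // distrC.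
pose y t i := sval (cid (H t i)); exists y => T T0.
have [C C0 hC] := picard_contract T0; exists (2 * C); first by rewrite mulr_ge0.
move=> k i t tT; rewrite /y; case: cid => l /= hl; exact: hl tT hC k.
Qed.

Lemma ode_global_lipschitz : exists y : R -> I -> R, (forall i, y 0 i = y0 i) /\
  forall (t : R) i, 0 <= t -> is_derive t 1 (fun s => y s i) (f t (y t) i).
Proof.
have [y hy] := picard_limit.
have cyT i (t : R) : 0 <= t -> {for t, continuous (fun s : R => y `|s| i)}.
  move=> t0; apply/cvgrPdistC_lt => e e0.
  have T0 : 0 <= t + 1 by rewrite addr_ge0.
  have [C C0 hC] := hy _ T0.
  have [k hk] : exists k, C / 2 ^+ k < e / 3.
    apply: contrapT => /forallNP H; have e3 : 0 < e / 3 by rewrite divr_gt0.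
    have : e / 3 <= 0 by apply: (@le0_of_geometric _ _ C) => k; have /negP := H k; rewrite -leNgt.
    by rewrite leNgt e3.
  have pc := continuous_comp_norm (@picard_continuous k i).
  have e3 : 0 < e / 3 by rewrite divr_gt0.
  have /cvgrPdistC_lt /(_ _ e3) near1 := pc t.
  have near2 : \forall s \near t, `|s - t| < 1.
    have /cvgrPdistC_lt H := @cvg_id _ (nbhs t); exact: H.
  near=> s; have s1 : `|s - t| < 1 by near: s.
  have s2 : `|picard k `|s| i - picard k `|t| i| < e / 3 by near: s.
  have bs : 0 <= `|s| <= t + 1.
    rewrite normr_ge0 /=; apply: (@le_trans _ _ (`|s - t| + `|t|)).
      by rewrite -{1}(subrK t s) ler_normD.
    by rewrite (ger0_norm t0) addrC lerD2l ltW.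
  have bt : 0 <= `|t| <= t + 1 by rewrite normr_ge0 ger0_norm //= lerDl.
  have h1 := hC k i _ bs; have h2 := hC k i _ bt.
  have h3 := ler_distD (picard k `|s| i) (y `|s| i) (y `|t| i).
  have h4 := ler_distD (picard k `|t| i) (picard k `|s| i) (y `|t| i).
  rewrite [`|picard k `|t| i - y `|t| i|]distrC in h4.
  by apply: le_lt_trans h3 _; lra.
pose y1 (t : R) (i : I) := y `|t| i.
have cy1 : continuous_ge0 y1 by move=> i t t0; exact: cyT.
(* The limit is a fixed point: iterate k + 1 is within C / 2^k of [y1], and also close to the Picard
   step of [y1], by integrating the Lipschitz bound. *)
have y1E t i : 0 <= t -> y1 t i = picard_step y1 t i.
  move=> t0; have [C C0 hC] := hy _ t0; have [L L0 lip] := flip t.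
  pose m : R := #|I|%:R.
  apply/eqP; rewrite -subr_eq0 -normr_le0.
  apply: (@le0_of_geometric _ _ (C + L * (m * C) * t)) => k.
  have h1 : `|y1 t i - picard k.+1 t i| <= C / 2 ^+ k.
    rewrite /y1 (ger0_norm t0); apply: le_trans (hC k.+1 i t _) _; first by rewrite t0 lexx.
    by rewrite ler_wpM2l // lef_pV2 ?posrE ?exprn_gt0 // ler_weXn2l // ler1n.
  have h2 : `|picard k.+1 t i - picard_step y1 t i| <= L * (m * (C / 2 ^+ k)) * t.
    apply: (@derive_norm_le _ (fun s => picard k.+1 s i - picard_step y1 s i)
      (fun s => f s (picard k s) i - f s (y1 s) i)
      (fun s => L * (m * (C / 2 ^+ k)) * s) (fun s => L * (m * (C / 2 ^+ k))) 0 t) => //.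
    - by rewrite picard_at0 /picard_step primitive0 addr0 subrr normr0 mulr0.
    - move=> s /andP[/ltW s0 /ltW st]; split.
      + exact: (is_derive_sub (picard_step_derive i (@picard_continuous k) s0)
          (picard_step_derive i cy1 s0)).
      + have := is_derive_mul (is_derive_cst (L * (m * (C / 2 ^+ k))) s 1) (is_derive_id s (1 : R)).
        by rewrite mul0r add0r mulr1.
      + apply: (le_trans (lip s _ _ _ i)); first by rewrite s0.
        rewrite ler_wpM2l // /m mulr_natl -sumr_const; apply: ler_sum => j _.
        by rewrite distrC /y1 (ger0_norm s0) hC // s0.
    - move=> s /andP[s0 _]; split.
        have c1 : {for s, continuous (fun x => picard k.+1 x i)} := @picard_continuous k.+1 i s s0.
        have c2 : {for s, continuous (fun x => picard_step y1 x i)} := picard_step_continuous cy1 s0.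
        exact: (cvgB c1 c2).
      by apply: cvgM; [exact: cvg_cst|exact: cvg_id].
  apply: le_trans (ler_distD (picard k.+1 t i) _ _) _.
  apply: le_trans (lerD h1 h2) _; rewrite le_eqVlt; apply/orP; left; apply/eqP; ring.
(* [y1] is even in time, so it need not be differentiable at 0. Its Picard step agrees with it for
   nonnegative times and has a two-sided derivative there. *)
exists (picard_step y1); split=> [i|t i t0].
  by rewrite /picard_step primitive0 addr0.
have -> : picard_step y1 t = y1 t by apply/funext => j; rewrite -y1E.
exact: picard_step_derive.
Unshelve. all: by end_near.
Qed.

End GlobalLipschitzODE.

(** * Gronwall estimates *)

Section Gronwall.
Context {R : realType}.

Lemma gronwall (u du : R -> R) (K T : R) : 0 <= T ->
  (forall t : R, 0 < t < T -> is_derive t 1 u (du t) /\ du t <= K * u t) ->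
  (forall t : R, 0 <= t <= T -> {for t, continuous u}) -> u T <= expR (K * T) * u 0.
Proof.
move=> T0 D cu.
have ce (t : R) : is_derive t 1 (fun s => expR (- K * s)) (- K * expR (- K * t)).
  exact: is_derive_expR_scale.
have H : expR (- K * T) * u T <= expR (- K * 0) * u 0.
  apply: (@derive_le0_le _ (fun t => expR (- K * t) * u t)
    (fun t => - K * expR (- K * t) * u t + expR (- K * t) * du t)) => //.
    move=> t /D[Du le]; split; first exact: is_derive_mul.
    have -> : - K * expR (- K * t) * u t + expR (- K * t) * du t =
      expR (- K * t) * (du t - K * u t) by ring.
    by rewrite mulr_ge0_le0 ?expR_ge0 // subr_le0.
  by move=> t tT; have c1 := is_derive_continuous (ce t); exact: (cvgM c1 (cu t tT)).
move: H; rewrite mulr0 expR0 mul1r mulNr expRN -ler_pdivlMl ?invr_gt0 ?expR_gt0 //.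
by rewrite invrK.
Qed.

(** [gronwall] is applied to the sum of squares, which is differentiable where the sum of absolute
    values is not. The rate 2 L m comes from 2 |D_j| |D_k| <= D_j^2 + D_k^2 summed over both
    indices. *)
Lemma gronwall_zero (I : finType) (D d : R -> I -> R) (L T : R) : 0 <= T -> 0 <= L ->
  (forall i (t : R), 0 < t < T -> is_derive t 1 (fun s => D s i) (d t i) /\
     `|d t i| <= L * \sum_j `|D t j|) ->
  (forall i (t : R), 0 <= t <= T -> {for t, continuous (fun s => D s i)}) ->
  (forall i, D 0 i = 0) -> forall i, D T i = 0.
Proof.
move=> T0 L0 HD cD D0 i; pose m : R := #|I|%:R.
have : \sum_i D T i * D T i <= expR (2 * L * m * T) * \sum_i D 0 i * D 0 i.
  apply: (@gronwall (fun t => \sum_i D t i * D t i)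
     (fun t => \sum_i (d t i * D t i + D t i * d t i))) => //.
    move=> t tT; split.
      apply: (@is_derive_bigsum _ R _ _ _ (fun i t => D t i * D t i)) => j.
      by have [Dj _] := HD j t tT; exact: is_derive_mul.
    have H j : d t j * D t j + D t j * d t j <= L * \sum_k (D t j ^+ 2 + D t k ^+ 2).
      have [_ dj] := HD j t tT.
      apply: (@le_trans _ _ (2 * (`|D t j| * `|d t j|))).
        have -> : d t j * D t j + D t j * d t j = 2 * (D t j * d t j) by ring.
        by rewrite ler_wpM2l // -normrM ler_norm.
      apply: (@le_trans _ _ (2 * (`|D t j| * (L * \sum_k `|D t k|)))).
        by rewrite ler_wpM2l // ler_wpM2l.
      have -> : 2 * (`|D t j| * (L * \sum_k `|D t k|)) =
          L * \sum_k (2 * `|D t j| * `|D t k|) by rewrite -mulr_sumr; ring.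
      rewrite ler_wpM2l //; apply: ler_sum => k _.
      rewrite -(real_normK (num_real (D t j))) -(real_normK (num_real (D t k))).
      by have := sqr_ge0 (`|D t j| - `|D t k|); rewrite sqrrB; lra.
    apply: le_trans (ler_sum _ (fun j _ => H j)) _.
    rewrite -mulr_sumr.
    have -> : \sum_j \sum_k (D t j ^+ 2 + D t k ^+ 2) = 2 * m * \sum_j D t j * D t j.
      have e : \sum_j D t j * D t j = \sum_j D t j ^+ 2.
        by apply: eq_bigr => j _; rewrite expr2.
      have c (x : R) : \sum_(k : I) x = m * x by rewrite sumr_const mulr_natl.
      under eq_bigr do rewrite big_split c.
      by rewrite e big_split /= c -mulr_sumr; ring.
    by rewrite le_eqVlt; apply/orP; left; apply/eqP; ring.
  move=> t tT; apply: continuous_at_sum => j.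
  by have c := cD j t tT; exact: (cvgM c c).
rewrite [X in _ * X]big1 ?mulr0; last by move=> j _; rewrite D0 mulr0.
move=> le0; have /eqP : \sum_i D T i * D T i = 0.
  by apply/le_anti; rewrite le0 sumr_ge0 // => j _; rewrite -expr2 sqr_ge0.
rewrite psumr_eq0; last by move=> j _; rewrite -expr2 sqr_ge0.
by move=> /allP /(_ i); rewrite mem_index_enum => /(_ isT); rewrite mulf_eq0 orbb => /eqP.
Qed.

End Gronwall.

Section LocallyLipschitz.
Context {R : realType} {I : finType}.
Implicit Types (F G : (I -> R) -> R).

(** Lipschitz on every box. The class is closed under sums and products, so polynomial vector fields
    belong to it by construction, and [loc_lip_continuous] derives continuity along curves without a
    topology on [I -> R]. *)
Definition loc_lip F := forall B : R, 0 <= B -> exists2 L : R, 0 <= L &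
  forall y z, (forall i, `|y i| <= B) -> (forall i, `|z i| <= B) ->
    `|F y - F z| <= L * \sum_j `|y j - z j|.

Lemma loc_lip_bound F B : loc_lip F -> 0 <= B -> exists2 M : R, 0 <= M &
  forall y, (forall i, `|y i| <= B) -> `|F y| <= M.
Proof.
move=> lF B0; have [L L0 hL] := lF B B0.
exists (`|F (fun=> 0)| + L * \sum_(j : I) B).
  by rewrite addr_ge0 // mulr_ge0 // sumr_ge0.
move=> y yB; rewrite -[F y](subrK (F (fun=> 0))) addrC.
apply: le_trans (ler_normD _ _) _; rewrite lerD2l.
apply: le_trans (hL y (fun=> 0) yB _) _; first by move=> i; rewrite normr0.
by rewrite ler_wpM2l //; apply: ler_sum => j _; rewrite subr0.
Qed.

Lemma loc_lip_cst (c : R) : loc_lip (fun=> c).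
Proof. by move=> B _; exists 0 => // y z _ _; rewrite subrr normr0 mul0r. Qed.

Lemma loc_lip_proj i : loc_lip (fun y => y i).
Proof.
move=> B _; exists 1 => // y z _ _; rewrite mul1r (bigD1 i) //= lerDl.
exact: sumr_ge0.
Qed.

Lemma loc_lip_add F G : loc_lip F -> loc_lip G -> loc_lip (fun y => F y + G y).
Proof.
move=> lF lG B B0; have [L L0 hL] := lF B B0; have [M M0 hM] := lG B B0.
exists (L + M); first exact: addr_ge0.
move=> y z yB zB; rewrite opprD addrACA mulrDl.
by apply: le_trans (ler_normD _ _) _; rewrite lerD ?hL ?hM.
Qed.

Lemma loc_lip_mul F G : loc_lip F -> loc_lip G -> loc_lip (fun y => F y * G y).
Proof.
move=> lF lG B B0; have [L L0 hL] := lF B B0; have [M M0 hM] := lG B B0.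
have [f f0 hf] := loc_lip_bound lF B0; have [g g0 hg] := loc_lip_bound lG B0.
exists (L * g + f * M); first by rewrite addr_ge0 // mulr_ge0.
move=> y z yB zB.
have -> : F y * G y - F z * G z = (F y - F z) * G y + F z * (G y - G z) by ring.
apply: le_trans (ler_normD _ _) _; rewrite !normrM mulrDl lerD //.
  by rewrite mulrAC ler_pM // ?hL ?hg.
by rewrite -mulrA ler_pM // ?hM ?hf.
Qed.

Lemma loc_lip_opp F : loc_lip F -> loc_lip (fun y => - F y).
Proof.
move=> lF B B0; have [L L0 hL] := lF B B0; exists L => // y z yB zB.
by rewrite -opprD normrN hL.
Qed.

Lemma loc_lip_sum (J : Type) (r : seq J) (P : pred J) (F : J -> (I -> R) -> R) :
  (forall j, loc_lip (F j)) -> loc_lip (fun y => \sum_(j <- r | P j) F j y).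
Proof.
move=> lF; elim: r => [|j r IH].
  by under eq_fun do rewrite big_nil; exact: loc_lip_cst.
under eq_fun do rewrite big_cons; case: (P j) => //; exact: loc_lip_add.
Qed.

Lemma loc_lip_continuous F (y : R -> I -> R) (t : R) : loc_lip F ->
  (forall i, {for t, continuous (fun s => y s i)}) -> {for t, continuous (fun s => F (y s))}.
Proof.
move=> lF cy; pose B := \sum_i (`|y t i| + 1).
have B0 : 0 <= B by apply: sumr_ge0 => i _; rewrite addr_ge0.
have tB i : `|y t i| + 1 <= B by rewrite /B (bigD1 i) //= lerDl sumr_ge0 // => j _; rewrite addr_ge0.
have [L L0 hL] := lF B B0.
have cd : {for t, continuous (fun s => L * \sum_j `|y s j - y t j|)}.
  apply: cvgM; first exact: cvg_cst.
  apply: continuous_at_sum => j; apply: (@continuous_comp _ _ _ (fun s => y s j - y t j) (fun s : R => `|s|)); last exact: norm_continuous.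
  exact: (cvgB (cy j) (cvg_cst (y t j))).
apply/cvgrPdistC_lt => e e0.
have /cvgrPdistC_lt /(_ e e0) n1 := cd.
have n2 : \forall s \near t, forall i, `|y s i - y t i| < 1.
  apply: (@filter_forall _ _ (fun i s => `|y s i - y t i| < 1) _ (nbhs_filter t)) => i.
  by have /cvgrPdistC_lt H := cy i; exact: H.
near=> s; apply: (@le_lt_trans _ _ (L * \sum_j `|y s j - y t j|)).
  apply: hL => i; last by rewrite (le_trans _ (tB i)) // lerDl.
  have si : `|y s i - y t i| < 1 by move: i; near: s.
  rewrite (le_trans _ (tB i)) // -{1}(subrK (y t i) (y s i)) addrC.
  by rewrite (le_trans (ler_normD _ _)) // lerD2l ltW.
have : `|L * \sum_j `|y s j - y t j| - L * \sum_j `|y t j - y t j| | < e by near: s.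
rewrite [X in _ - _ * X]big1 ?mulr0 ?subr0; last by move=> j _; rewrite subrr normr0.
by apply: le_lt_trans; exact: ler_norm.
Unshelve. all: by end_near. Qed.

End LocallyLipschitz.

(** * Global solutions from an a priori bound *)

Section Continuation.
Context {R : realType} {I : finType}.
Variables (F : (I -> R) -> I -> R) (y0 : I -> R) (beta : R -> R).
Hypotheses (lF : forall i, loc_lip (fun y => F y i)) (cbeta : continuous beta)
  (beta_homo : forall s t : R, 0 <= s -> s <= t -> beta s <= beta t)
  (beta0 : forall t : R, 0 <= t -> 0 <= beta t).
Hypothesis a_priori : forall (T : R) (y : R -> I -> R), 0 <= T ->
  (forall i, y 0 i = y0 i) ->
  (forall i (t : R), 0 <= t <= T -> {for t, continuous (fun s => y s i)}) ->
  (forall i (t : R), 0 < t < T -> is_derive t 1 (fun s => y s i) (F (y t) i)) ->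
  forall i, `|y T i| < beta T.

(* The truncation of [x] to [[-b, b]]. *)
Definition clip (b x : R) : R := 2^-1 * (`|x + b| - `|x - b|).

Lemma clip_lip b x y : `|clip b x - clip b y| <= `|x - y|.
Proof.
rewrite /clip -mulrBr normrM gtr0_norm ?invr_gt0 //.
have h1 := ler_dist_dist (x + b) (y + b); have h2 := ler_dist_dist (x - b) (y - b).
have e1 : x + b - (y + b) = x - y by ring.
have e2 : x - b - (y - b) = x - y by ring.
rewrite e1 in h1; rewrite e2 in h2.
have -> : `|x + b| - `|x - b| - (`|y + b| - `|y - b|) =
  (`|x + b| - `|y + b|) - (`|x - b| - `|y - b|) by ring.
have := ler_normB (`|x + b| - `|y + b|) (`|x - b| - `|y - b|); lra.
Qed.

Lemma clip_le b x : 0 <= b -> `|clip b x| <= b.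
Proof.
move=> b0; rewrite /clip normrM gtr0_norm ?invr_gt0 //.
have := ler_dist_dist (x + b) (x - b).
have -> : x + b - (x - b) = 2 * b by ring.
rewrite normrM (ger0_norm b0) (ger0_norm (ler0n R 2)).
by move: (`| _ - _ |) => u; lra.
Qed.

Lemma clip_id b x : `|x| <= b -> clip b x = x.
Proof.
rewrite ler_norml => /andP[h1 h2].
have h3 : 0 <= x + b by lra.
have h4 : x - b <= 0 by lra.
by rewrite /clip (ger0_norm h3) (ler0_norm h4); field.
Qed.

(* Truncating at the a priori bound [beta] makes the vector field globally Lipschitz
   without changing the solution. *)
Lemma ode_global : exists y : R -> I -> R, (forall i, y 0 i = y0 i) /\
  forall (t : R) i, 0 <= t -> is_derive t 1 (fun s => y s i) (F (y t) i).
Proof.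
pose f (s : R) (y : I -> R) i := F (fun j => clip (beta `|s|) (y j)) i.
have fc y : (forall i, continuous (fun s => y s i)) -> forall i, continuous (fun s => f s (y s) i).
  move=> cy i s; apply: (loc_lip_continuous (y := fun s j => clip (beta `|s|) (y s j)) (lF i)) => j.
  have cb : {for s, continuous (fun s : R => beta `|s|)}.
    by apply: continuous_comp; [exact: norm_continuous|exact: cbeta].
  have n g : {for s, continuous g} -> {for s, continuous (fun s => `|g s : R|)}.
    by move=> cg; apply: (@continuous_comp _ _ _ g (fun s : R => `|s|)) => //; exact: norm_continuous.
  apply: cvgM; first exact: cvg_cst.
  exact: (cvgB (n _ (cvgD (cy j s) cb)) (n _ (cvgB (cy j s) cb))).
have fl (T : R) : exists2 L : R, 0 <= L & forall s : R, 0 <= s <= T ->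
    forall y z i, `|f s y i - f s z i| <= L * \sum_j `|y j - z j|.
  have [T0|T0] := leP 0 T; last first.
    by exists 0 => // s /andP[s0 sT]; have := le_lt_trans (le_trans s0 sT) T0; rewrite ltxx.
  have HL i := lF i (beta0 T0); pose L i := sval (cid2 (HL i)).
  have L0 i : 0 <= L i by rewrite /L; case: cid2.
  exists (\sum_i L i); first exact: sumr_ge0.
  move=> s /andP[s0 sT] y z i; rewrite /f (ger0_norm s0).
  have bs x : `|clip (beta s) x| <= beta T by rewrite (le_trans (clip_le _ _)) ?beta0 ?beta_homo.
  apply: (@le_trans _ _ (L i * \sum_j `|clip (beta s) (y j) - clip (beta s) (z j)|)).
    by rewrite /L; case: cid2 => /= l l0 h; apply: h => j; exact: bs.
  apply: ler_pM => //; first exact: sumr_ge0.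
    by rewrite (bigD1 i) //= lerDl sumr_ge0.
  by apply: ler_sum => j _; exact: clip_lip.
have [y [yi yd]] := ode_global_lipschitz y0 fc fl.
suff small : forall t : R, 0 <= t -> forall i, `|y t i| < beta t.
  exists y; split=> // t i t0; have := yd t i t0; rewrite /f (ger0_norm t0).
  have -> // : (fun j => clip (beta t) (y t j)) = y t.
  by apply/funext => j; rewrite clip_id // ltW // small.
have cy i (t : R) : 0 <= t -> {for t, continuous (fun s => y s i)}.
  by move=> t0; exact: is_derive_continuous (yd t i t0).
(* Before the first time [tau] at which the bound fails, truncation is invisible and the curve
   solves the original equation. The a priori bound then holds strictly at [tau], hence for a short
   time after it by continuity, which contradicts the choice of [tau]. *)
pose S := [set t : R | 0 <= t /\ exists i, beta t <= `|y t i|].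
suff S0 : S = set0.
  move=> t t0 i; rewrite ltNge; apply/negP => h.
  by have : S t by [split => //; exists i]; rewrite S0.
apply: contrapT => /eqP /set0P Sne.
have lbS : has_inf S by split => //; exists 0 => t [].
pose tau := inf S.
have tau0 : 0 <= tau by apply: lb_le_inf => // t [].
have before (t : R) : 0 <= t -> t < tau -> forall i, `|y t i| < beta t.
  move=> t0 tt i; rewrite ltNge; apply/negP => h.
  have : tau <= t by apply: ge_inf; [case: lbS|split => //; exists i].
  by rewrite leNgt tt.
have at_tau := a_priori tau0 yi.
have {}at_tau : forall i, `|y tau i| < beta tau.
  apply: at_tau; first by move=> i t /andP[t0 _]; exact: cy.
  move=> i t /andP[t0 tt]; have := yd t i (ltW t0); rewrite /f (gtr0_norm t0).
  have -> // : (fun j => clip (beta t) (y t j)) = y t.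
  by apply/funext => j; rewrite clip_id // ltW // before // ltW.
have nt : \forall t \near tau, forall i, 0 < beta t - `|y t i|.
  apply: (@filter_forall _ _ (fun i t => 0 < beta t - `|y t i|) _ (nbhs_filter tau)) => i.
  have c : {for tau, continuous (fun t => beta t - `|y t i|)}.
    apply: cvgB; first exact: cbeta.
    by apply: (@continuous_comp _ _ _ (fun t => y t i) (fun s : R => `|s|)); [exact: cy|exact: norm_continuous].
  have p : 0 < beta tau - `|y tau i| by rewrite subr_gt0.
  have /cvgrPdist_lt /(_ _ p) := c; apply: filterS => t.
  by move=> /(le_lt_trans (ler_norm _)); rewrite ltrBlDl ltrDr.
have [e /= e0 he] := (nbhs_ballP _ _).1 nt.
have [t St tlt] := inf_adherent e0 lbS.
have taut : tau <= t by apply: ge_inf => //; case: lbS.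
case: St => _ [i]; apply/negP; rewrite -ltNge -subr_gt0; apply: he.
by rewrite /ball /= distrC ger0_norm ?subr_ge0 // ltrBlDl.
Qed.

End Continuation.

(** * The flow of frames *)

Section MatrixCurves.
Context {R : realType}.

Definition mx_derive {p q} (M : R -> 'M[R]_(p, q)) (t : R) (D : 'M[R]_(p, q)) :=
  forall i j, is_derive t 1 (fun s => M s i j) (D i j).

Lemma mx_derive_mul {p q r} (M : R -> 'M[R]_(p, q)) (N : R -> 'M[R]_(q, r)) t D D' :
  mx_derive M t D -> mx_derive N t D' ->
  mx_derive (fun s => M s *m N s) t (D *m N t + M t *m D').
Proof.
move=> dM dN i j; rewrite [X in is_derive _ _ _ X]mxE [X in X + _]mxE [X in _ + X]mxE -big_split /=.
rewrite (_ : (fun s => _) = fun s => \sum_k M s i k * N s k j); last first.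
  by apply/funext => s; rewrite mxE.
apply: (@is_derive_bigsum _ R _ _ _ (fun k s => M s i k * N s k j)
  (fun k => D i k * N t k j + M t i k * D' k j)) => k.
exact: is_derive_mul.
Qed.

Lemma mx_derive_cst {p q} (A : 'M[R]_(p, q)) t : mx_derive (fun=> A) t 0.
Proof. by move=> i j; rewrite mxE; exact: is_derive_cst. Qed.

Lemma mx_derive_tr {p q} (M : R -> 'M[R]_(p, q)) t D :
  mx_derive M t D -> mx_derive (fun s => (M s)^T) t D^T.
Proof.
move=> dM i j; rewrite mxE (_ : (fun s => _) = fun s => M s j i) //.
by apply/funext => s; rewrite mxE.
Qed.

Lemma mx_derive_eq {p q} (M : R -> 'M[R]_(p, q)) t D D' :
  mx_derive M t D -> D = D' -> mx_derive M t D'.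
Proof. by move=> + <-. Qed.

Lemma mx_derive_sum {p q} (I : Type) (r : seq I) (P : pred I) (M : I -> R -> 'M[R]_(p, q)) t
    (D : I -> 'M[R]_(p, q)) : (forall k, mx_derive (M k) t (D k)) ->
  mx_derive (fun s => \sum_(k <- r | P k) M k s) t (\sum_(k <- r | P k) D k).
Proof.
move=> dM i j; rewrite summxE (_ : (fun s => _) = fun s => \sum_(k <- r | P k) M k s i j).
  by apply: (@is_derive_bigsum _ R _ _ _ (fun k s => M k s i j) (fun k => D k i j)) => k; exact: dM.
by apply/funext => s; rewrite summxE.
Qed.

Lemma mx_derive_scale {p q} (a : R -> R) (M : R -> 'M[R]_(p, q)) (t a' : R) D :
  is_derive t 1 a a' -> mx_derive M t D ->
  mx_derive (fun s => a s *: M s) t (a' *: M t + a t *: D).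
Proof.
move=> da dM i j; rewrite !mxE (_ : (fun s => _) = fun s => a s * M s i j).
  exact: is_derive_mul.
by apply/funext => s; rewrite mxE.
Qed.

Definition fro {p q} (M : 'M[R]_(p, q)) : R := \sum_i \sum_j M i j ^+ 2.

Lemma fro_ge0 {p q} (M : 'M[R]_(p, q)) : 0 <= fro M.
Proof. by do 2!apply: sumr_ge0 => ? _; exact: sqr_ge0. Qed.

Lemma fro_entry {p q} (M : 'M[R]_(p, q)) i j : M i j ^+ 2 <= fro M.
Proof.
rewrite /fro (bigD1 i) //= (bigD1 j) //= -addrA lerDl.
by rewrite addr_ge0 //; do ?[apply: sumr_ge0 => ? _]; rewrite sqr_ge0.
Qed.

Lemma fro_tr {p q} (M : 'M[R]_(p, q)) : fro M^T = fro M.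
Proof. by rewrite /fro exchange_big; do 2!apply: eq_bigr => ? _; rewrite mxE. Qed.

Lemma fro_derive {p q} (M : R -> 'M[R]_(p, q)) t D : mx_derive M t D ->
  is_derive t 1 (fun s => fro (M s)) (\sum_i \sum_j 2 * M t i j * D i j).
Proof.
move=> dM; apply: (@is_derive_bigsum _ R _ _ _ (fun i s => \sum_j M s i j ^+ 2)
  (fun i => \sum_j 2 * M t i j * D i j)) => i.
apply: (@is_derive_bigsum _ R _ _ _ (fun j s => M s i j ^+ 2)
  (fun j => 2 * M t i j * D i j)) => j.
have := is_derive_mul (dM i j) (dM i j).
have -> : D i j * M t i j + M t i j * D i j = 2 * M t i j * D i j by ring.
by under eq_fun do rewrite -expr2.
Qed.

(** The left side is the derivative of the squared norm when M' = - M A; each product of two entries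
    is split by 2 |x y| <= x^2 + y^2. *)
Lemma fro_mulr_le {p n} (M : 'M[R]_(p, n)) (A : 'M[R]_n) k : (forall i j, `|A i j| <= k) ->
  \sum_i \sum_j 2 * M i j * (- (M *m A)) i j <= 2 * n%:R * k * fro M.
Proof.
move=> Ak; rewrite /fro mulr_sumr; apply: ler_sum => i _.
have E : 2 * n%:R * k * \sum_j M i j ^+ 2 = \sum_(j < n) \sum_(l < n) (M i j ^+ 2 + M i l ^+ 2) * k.
  have c (x : R) : \sum_(l < n) x = n%:R * x by rewrite sumr_const card_ord mulr_natl.
  under [RHS]eq_bigr do rewrite -mulr_suml big_split c.
  by rewrite -mulr_suml big_split /= c -mulr_sumr; ring.
rewrite E; apply: ler_sum => j _; rewrite mxE mxE mulrN mulr_sumr -sumrN.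
apply: ler_sum => l _; apply: le_trans (ler_norm _) _; rewrite normrN.
rewrite (_ : 2 * _ * _ = (2 * (M i j * M i l)) * A l j); last by ring.
rewrite normrM ler_pM // ler_norml.
have := sqr_ge0 (M i j - M i l); have := sqr_ge0 (M i j + M i l).
by rewrite sqrrB sqrrD => h1 h2; apply/andP; split; lra.
Qed.

Lemma fro_mull_le {n p} (M : 'M[R]_(n, p)) (A : 'M[R]_n) k : (forall i j, `|A i j| <= k) ->
  \sum_i \sum_j 2 * M i j * (A *m M) i j <= 2 * n%:R * k * fro M.
Proof.
move=> Ak; have Ak' i j : `|(- A)^T i j| <= k by rewrite !mxE normrN.
have := fro_mulr_le M^T Ak'; rewrite fro_tr; apply: le_trans; rewrite exchange_big le_eqVlt; apply/orP; left; apply/eqP.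
by do 2!apply: eq_bigr => ? _; rewrite -trmx_mul -raddfN -mulNmx opprK !mxE.
Qed.

End MatrixCurves.

Section LipschitzMatrices.
Context {R : realType} {I : finType}.

Definition loc_lip_mx {p q} (M : (I -> R) -> 'M[R]_(p, q)) := forall i j, loc_lip (fun y => M y i j).

Lemma loc_lip_eq (F G : (I -> R) -> R) : (forall y, F y = G y) -> loc_lip G -> loc_lip F.
Proof. by move=> /funext ->. Qed.

Lemma loc_lip_mx_cst {p q} (A : 'M[R]_(p, q)) : loc_lip_mx (fun=> A).
Proof. by move=> i j; exact: loc_lip_cst. Qed.

Lemma loc_lip_mx_mul {p q r} (M : (I -> R) -> 'M[R]_(p, q)) (N : (I -> R) -> 'M[R]_(q, r)) :
  loc_lip_mx M -> loc_lip_mx N -> loc_lip_mx (fun y => M y *m N y).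
Proof.
move=> lM lN i j; apply: (@loc_lip_eq _ (fun y => \sum_k M y i k * N y k j)).
  by move=> y; rewrite mxE.
by apply: loc_lip_sum => k; exact: loc_lip_mul.
Qed.

Lemma loc_lip_mx_add {p q} (M N : (I -> R) -> 'M[R]_(p, q)) :
  loc_lip_mx M -> loc_lip_mx N -> loc_lip_mx (fun y => M y + N y).
Proof.
move=> lM lN i j; apply: (@loc_lip_eq _ (fun y => M y i j + N y i j)).
  by move=> y; rewrite mxE.
exact: loc_lip_add.
Qed.

Lemma loc_lip_mx_scale {p q} (a : (I -> R) -> R) (M : (I -> R) -> 'M[R]_(p, q)) :
  loc_lip a -> loc_lip_mx M -> loc_lip_mx (fun y => a y *: M y).
Proof.
move=> la lM i j; apply: (@loc_lip_eq _ (fun y => a y * M y i j)).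
  by move=> y; rewrite mxE.
exact: loc_lip_mul.
Qed.

Lemma loc_lip_mx_opp {p q} (M : (I -> R) -> 'M[R]_(p, q)) :
  loc_lip_mx M -> loc_lip_mx (fun y => - M y).
Proof.
move=> lM i j; apply: (@loc_lip_eq _ (fun y => - M y i j)); last exact: loc_lip_opp.
by move=> y; rewrite mxE.
Qed.

Lemma loc_lip_mx_sum {p q} (J : Type) (r : seq J) (M : J -> (I -> R) -> 'M[R]_(p, q)) :
  (forall k, loc_lip_mx (M k)) -> loc_lip_mx (fun y => \sum_(k <- r) M k y).
Proof.
move=> lM i j; apply: (@loc_lip_eq _ (fun y => \sum_(k <- r) M k y i j)).
  by move=> y; rewrite summxE.
by apply: loc_lip_sum => k; exact: lM.
Qed.

Lemma loc_lip_trace {p} (M : (I -> R) -> 'M[R]_p) : loc_lip_mx M -> loc_lip (fun y => \tr (M y)).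
Proof. by move=> lM; apply: loc_lip_sum => i; exact: lM. Qed.

Lemma loc_lip_ricci_form {n} (c : (I -> R) -> 'I_n -> 'M[R]_n) :
  (forall a, loc_lip_mx (fun y => c y a)) -> loc_lip_mx (fun y => ricci_form (c y)).
Proof.
move=> lc e f; apply: (@loc_lip_eq _ (fun y => - 2^-1 * (\sum_i \sum_j c y e i j * c y f i j)
   + 4^-1 * (\sum_i \sum_j c y i j e * c y i j f))); first by move=> y; rewrite mxE.
apply: loc_lip_add; apply: loc_lip_mul; try exact: loc_lip_cst;
  by do 2!apply: loc_lip_sum => ?; apply: loc_lip_mul; exact: lc.
Qed.

End LipschitzMatrices.

(** Along the inequality, t / k - 1 / u does not increase. Arguing by contradiction also justifies
    dividing: if u T exceeds k / T then it is positive, and so is u on all of [0, T], since u does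
    not increase. *)
Lemma decay {R : realType} (u du : R -> R) (k T : R) : 0 < k -> 0 < T ->
  (forall t : R, 0 <= t <= T -> 0 <= u t) ->
  (forall t : R, 0 < t < T -> is_derive t 1 u (du t) /\ du t <= - (u t ^+ 2 / k)) ->
  (forall t : R, 0 <= t <= T -> {for t, continuous u}) -> u T <= k / T.
Proof.
move=> k0 T0 u0 D cu; rewrite leNgt; apply/negP => h.
have uT0 : 0 < u T by rewrite (lt_trans _ h) // divr_gt0.
have mono t : 0 <= t <= T -> u T <= u t.
  move=> /andP[t0 tT]; apply: (@derive_le0_le _ u du) => //.
    move=> s /andP[ts sT]; have [|Ds le] := D s; first by rewrite (le_lt_trans t0 ts).
    by split => //; apply: le_trans le _; rewrite oppr_le0 divr_ge0 ?sqr_ge0 // ltW.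
  by move=> s /andP[ts sT]; apply: cu; rewrite sT (le_trans t0).
have up t : 0 <= t <= T -> 0 < u t by move=> tT; exact: lt_le_trans uT0 (mono t tT).
have : T / k - (u T)^-1 <= 0 / k - (u 0)^-1.
  apply: (@derive_le0_le _ (fun t => t / k - (u t)^-1)
     (fun t => k^-1 - (- (u t) ^- 2 * du t)) 0 T (ltW T0)).
    move=> t tT; have tT' : 0 <= t <= T by case/andP: tT => a b; rewrite !ltW.
    have [Dt le] := D t tT; have ut := up t tT'; split.
      apply: is_derive_sub; last exact: (is_deriveV (lt0r_neq0 ut) Dt).
      have := is_derive_mul (is_derive_id t (1 : R)) (is_derive_cst k^-1 t 1).
      by rewrite mul1r mulr0 addr0.
    have : (u t) ^- 2 * du t <= (u t) ^- 2 * - (u t ^+ 2 / k).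
      by rewrite ler_wpM2l // invr_ge0 sqr_ge0.
    rewrite mulrN mulrA mulVf ?mul1r ?expf_neq0 ?gt_eqF //; rewrite mulNr; lra.
  move=> t tT; apply: cvgB; first by apply: cvgM; [exact: cvg_id|exact: cvg_cst].
  by apply: cvgV; [rewrite gt_eqF ?up|exact: cu].
have i0 : 0 < (u 0)^-1 by rewrite invr_gt0 up // lexx ltW.
have : (u T)^-1 < T / k by rewrite -invf_div ltf_pV2 ?posrE // divr_gt0.
rewrite mul0r; lra.
Qed.

Section FrameFlow.
Context {R : realType} {n : nat}.
Variable (c : 'I_n -> 'M[R]_n).
Hypothesis anti : bracket_anti c.

Local Notation br S Q := (frame_bracket S Q c).
Local Notation ric S Q := (ricci_form (br S Q)).

(** The product rule, one term per slot: [S] moves the two lower indices, [Q] the upper one. *)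
Lemma frame_bracket_derive (S Q : R -> 'M[R]_n) t (r := ric (S t) (Q t)) a :
  mx_derive Q t (- (Q t *m r)) -> mx_derive S t (r *m S t) ->
  mx_derive (fun s => br (S s) (Q s) a) t
    (\sum_d r a d *: br (S t) (Q t) d + r *m br (S t) (Q t) a - br (S t) (Q t) a *m r).
Proof.
move=> dQ dS; rewrite /frame_bracket.
have H d : mx_derive (fun s => S s a d *: (S s *m c d *m Q s)) t
  ((r *m S t) a d *: (S t *m c d *m Q t) + S t a d *:
    ((r *m S t *m c d + S t *m 0) *m Q t + S t *m c d *m - (Q t *m r))).
  apply: mx_derive_scale; first exact: dS.
  by apply: mx_derive_mul => //; apply: mx_derive_mul => //; exact: mx_derive_cst.
apply: (mx_derive_eq (mx_derive_sum _ _ H)).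
rewrite mulmx_sumr mulmx_suml big_split /= -addrA; congr (_ + _).
  under [RHS]eq_bigr do rewrite scaler_sumr.
  rewrite exchange_big; apply: eq_bigr => d _ /=.
  rewrite mxE scaler_suml; apply: eq_bigr => e _; by rewrite scalerA.
rewrite -sumrB; apply: eq_bigr => d _.
by rewrite mulmx0 addr0 mulmxN scalerBr -scalemxAr -scalemxAl !mulmxA.
Qed.

(** Continuity up to the endpoints but derivatives only inside, which is what the hypothesis of the
    a priori bound provides. *)
Definition frame_flow_on (T : R) (Q S : R -> 'M[R]_n) :=
  (forall t i j, 0 <= t <= T -> {for t, continuous (fun s => Q s i j)}) /\
  (forall t i j, 0 <= t <= T -> {for t, continuous (fun s => S s i j)}) /\
  (forall t, 0 < t < T -> mx_derive Q t (- (Q t *m ric (S t) (Q t))) /\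
     mx_derive S t (ric (S t) (Q t) *m S t)).

Lemma continuous_mx_mul {p q r} (M : R -> 'M[R]_(p, q)) (N : R -> 'M[R]_(q, r)) t :
  (forall i j, {for t, continuous (fun s => M s i j)}) ->
  (forall i j, {for t, continuous (fun s => N s i j)}) ->
  forall i j, {for t, continuous (fun s => (M s *m N s) i j)}.
Proof.
move=> cM cN i j; rewrite (_ : (fun s => _) = fun s => \sum_k M s i k * N s k j).
  by apply: continuous_at_sum => k; exact: (cvgM (cM i k) (cN k j)).
by apply/funext => s; rewrite mxE.
Qed.

Lemma continuous_sqr (g : R -> R) t : {for t, continuous g} -> {for t, continuous (fun s => g s ^+ 2)}.
Proof. by move=> cg; exact: (cvgM cg cg). Qed.

Lemma fro_continuous {p q} (M : R -> 'M[R]_(p, q)) t :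
  (forall i j, {for t, continuous (fun s => M s i j)}) -> {for t, continuous (fun s => fro (M s))}.
Proof. by move=> cM; do 2!apply: continuous_at_sum => ?; exact: continuous_sqr. Qed.

Lemma frame_norm_continuous (S Q : R -> 'M[R]_n) t :
  (forall i j, {for t, continuous (fun s => Q s i j)}) ->
  (forall i j, {for t, continuous (fun s => S s i j)}) ->
  {for t, continuous (fun s => bracket_norm (br (S s) (Q s)))}.
Proof.
move=> cQ cS; apply: continuous_at_sum => a; apply: fro_continuous => b e.
rewrite (_ : (fun s => _) = fun s => \sum_d S s a d * (S s *m c d *m Q s) b e).
  apply: continuous_at_sum => d; apply: cvgM; first exact: cS.
  apply: continuous_mx_mul => //; apply: continuous_mx_mul => // i j; exact: cvg_cst.
by apply/funext => s; rewrite frame_bracketE.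
Qed.

Lemma frame_norm_derive (S Q : R -> 'M[R]_n) t (r := ric (S t) (Q t)) :
  mx_derive Q t (- (Q t *m r)) -> mx_derive S t (r *m S t) ->
  is_derive t 1 (fun s => bracket_norm (br (S s) (Q s))) (- 8 * fro r).
Proof.
move=> dQ dS; rewrite -(bracket_evolution_pairing (frame_bracket_anti _ _ anti)).
pose D a := \sum_d r a d *: br (S t) (Q t) d + r *m br (S t) (Q t) a - br (S t) (Q t) a *m r.
apply: (@is_derive_bigsum _ R _ _ _ (fun a s => fro (br (S s) (Q s) a))
  (fun a => \sum_b \sum_e 2 * br (S t) (Q t) a b e * D a b e)) => a.
exact/fro_derive/frame_bracket_derive.
Qed.

Lemma frame_norm_nonincreasing (T : R) Q S : 0 <= T -> frame_flow_on T Q S ->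
  forall t, 0 <= t <= T -> bracket_norm (br (S t) (Q t)) <= bracket_norm (br (S 0) (Q 0)).
Proof.
move=> T0 [cQ [cS D]] t /andP[t0 tT].
apply: (@derive_le0_le _ (fun t => bracket_norm (br (S t) (Q t)))
  (fun t => - 8 * fro (ric (S t) (Q t)))) => //.
  move=> s /andP[s0 st]; have [|dQ dS] := D s; first by rewrite s0 (lt_le_trans st).
  split; first exact: frame_norm_derive.
  by rewrite mulNr oppr_le0 mulr_ge0 // fro_ge0.
by move=> s /andP[s0 st]; apply: frame_norm_continuous => i j; [apply: cQ|apply: cS];
  rewrite s0 (le_trans st).
Qed.

Lemma frame_norm_decay (T : R) Q S : 0 < T -> frame_flow_on T Q S ->
  bracket_norm (br (S T) (Q T)) <= 2 * n.+1%:R / T.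
Proof.
move=> T0 [cQ [cS D]].
apply: (@decay _ (fun t => bracket_norm (br (S t) (Q t)))
  (fun t => - 8 * fro (ric (S t) (Q t)))) => //.
- by move=> t _; exact: bracket_norm_ge0.
- move=> t tT; have [dQ dS] := D t tT; split; first exact: frame_norm_derive.
  have H : bracket_norm (br (S t) (Q t)) ^+ 2 / (16 * n.+1%:R) <= fro (ric (S t) (Q t)).
    exact: ricci_form_sqr_ge.
  have -> : bracket_norm (br (S t) (Q t)) ^+ 2 / (2 * n.+1%:R) =
    8 * (bracket_norm (br (S t) (Q t)) ^+ 2 / (16 * n.+1%:R)).
    have : n.+1%:R != 0 :> R by rewrite pnatr_eq0.
    by move: n.+1%:R => N N0; field.
  by rewrite mulNr lerN2 ler_wpM2l.
- by move=> s sT; apply: frame_norm_continuous => i j; [apply: cQ|apply: cS].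
Qed.

(** The Ricci form stays below the initial squared norm of the bracket, so both linear-looking
    equations have coefficients bounded by one constant. [S] needs its own estimate, being an
    unknown of the system. *)
Lemma frame_flow_growth (T : R) Q S : 0 <= T -> frame_flow_on T Q S ->
  let K := 2 * n%:R * bracket_norm (br (S 0) (Q 0)) in
  fro (Q T) <= expR (K * T) * fro (Q 0) /\ fro (S T) <= expR (K * T) * fro (S 0).
Proof.
move=> T0 fl K; have [cQ [cS D]] := fl.
have rK t i j : 0 <= t <= T -> `|ric (S t) (Q t) i j| <= bracket_norm (br (S 0) (Q 0)).
  move=> tT; apply: le_trans (ricci_form_le _ _ _) _.
  exact: (frame_norm_nonincreasing T0 fl).
have W t : 0 < t < T -> 0 <= t <= T by case/andP => a b; rewrite !ltW.
split.
- apply: (@gronwall _ (fun t => fro (Q t))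
   (fun t => \sum_i \sum_j 2 * Q t i j * (- (Q t *m ric (S t) (Q t))) i j)) => //.
    move=> t tT; have [dQ _] := D t tT; split; first exact: fro_derive.
    by apply: fro_mulr_le => i j; apply: rK; exact: W.
  by move=> t tT; apply: fro_continuous => i j; exact: cQ.
- apply: (@gronwall _ (fun t => fro (S t))
   (fun t => \sum_i \sum_j 2 * S t i j * (ric (S t) (Q t) *m S t) i j)) => //.
    move=> t tT; have [_ dS] := D t tT; split; first exact: fro_derive.
    by apply: fro_mull_le => i j; apply: rK; exact: W.
  by move=> t tT; apply: fro_continuous => i j; exact: cS.
Qed.

Lemma frame_flow_exists (Q0 S0 : 'M[R]_n) : Q0 *m S0 = 1%:M -> exists Q S : R -> 'M[R]_n,
  [/\ Q 0 = Q0, S 0 = S0, forall t, 0 <= t -> Q t *m S t = 1%:M &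
   forall t, 0 <= t -> mx_derive Q t (- (Q t *m ric (S t) (Q t))) /\
     mx_derive S t (ric (S t) (Q t) *m S t)].
Proof.
move=> QS0; pose I := (bool * ('I_n * 'I_n))%type.
pose Qy (y : I -> R) : 'M[R]_n := \matrix_(i, j) y (true, (i, j)).
pose Sy (y : I -> R) : 'M[R]_n := \matrix_(i, j) y (false, (i, j)).
pose F (y : I -> R) (k : I) : R := if k.1 then (- (Qy y *m ric (Sy y) (Qy y))) k.2.1 k.2.2
  else (ric (Sy y) (Qy y) *m Sy y) k.2.1 k.2.2.
pose y0 (k : I) : R := if k.1 then Q0 k.2.1 k.2.2 else S0 k.2.1 k.2.2.
pose K := 2 * n%:R * bracket_norm (br S0 Q0).
have K0 : 0 <= K by rewrite !mulr_ge0 // bracket_norm_ge0.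
(* The growth estimate bounds squares of entries; |x| < 1 + x^2 converts it into the strict bound on
   entries that continuation requires. *)
pose beta (t : R) := 1 + expR (K * t) * (fro Q0 + fro S0).
have f0 : 0 <= fro Q0 + fro S0 by rewrite addr_ge0 ?fro_ge0.
have lQ : loc_lip_mx Qy.
  by move=> i j; apply: (@loc_lip_eq _ _ _ (fun y => y (true, (i, j)))) => [y|]; [rewrite mxE|exact: loc_lip_proj].
have lS : loc_lip_mx Sy.
  by move=> i j; apply: (@loc_lip_eq _ _ _ (fun y => y (false, (i, j)))) => [y|]; [rewrite mxE|exact: loc_lip_proj].
have lR : loc_lip_mx (fun y => ric (Sy y) (Qy y)).
  apply: loc_lip_ricci_form => a; apply: loc_lip_mx_sum => d.
  apply: loc_lip_mx_scale; first exact: lS.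
  by apply: loc_lip_mx_mul => //; apply: loc_lip_mx_mul => //; exact: loc_lip_mx_cst.
have lF k : loc_lip (fun y => F y k).
  case: k => [[] [i j]]; rewrite /F /=; last exact: (loc_lip_mx_mul lR lS).
  by apply: loc_lip_mx_opp; exact: loc_lip_mx_mul.
have cb : continuous beta.
  move=> t; apply: cvgD; first exact: cvg_cst.
  by apply: cvgM; [exact: is_derive_continuous (is_derive_expR_scale K t)|exact: cvg_cst].
have bm (s t : R) : 0 <= s -> s <= t -> beta s <= beta t.
  by move=> _ st; rewrite lerD2l ler_wpM2r // ler_expR ler_wpM2l.
have b0 (t : R) : 0 <= t -> 0 <= beta t by move=> _; rewrite addr_ge0 // mulr_ge0 // expR_ge0.
have QyE y i j : Qy y i j = y (true, (i, j)) by rewrite mxE.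
have SyE y i j : Sy y i j = y (false, (i, j)) by rewrite mxE.
have curves (y : R -> I -> R) (t : R) : (forall i, is_derive t 1 (fun s => y s i) (F (y t) i)) ->
    mx_derive (fun s => Qy (y s)) t (- (Qy (y t) *m ric (Sy (y t)) (Qy (y t)))) /\
    mx_derive (fun s => Sy (y s)) t (ric (Sy (y t)) (Qy (y t)) *m Sy (y t)).
  move=> D; split=> i j.
    by have := D (true, (i, j)); under eq_fun do rewrite -QyE.
  by have := D (false, (i, j)); under eq_fun do rewrite -SyE.
have init (y : R -> I -> R) : (forall i, y 0 i = y0 i) -> Qy (y 0) = Q0 /\ Sy (y 0) = S0.
  by move=> yi; split; apply/matrixP => i j; rewrite mxE yi.
have ap (T : R) (y : R -> I -> R) : 0 <= T -> (forall i, y 0 i = y0 i) ->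
  (forall i (t : R), 0 <= t <= T -> {for t, continuous (fun s => y s i)}) ->
  (forall i (t : R), 0 < t < T -> is_derive t 1 (fun s => y s i) (F (y t) i)) ->
  forall i, `|y T i| < beta T.
  move=> T0 yi cy dy.
  have fl : frame_flow_on T (fun s => Qy (y s)) (fun s => Sy (y s)).
    split; first by move=> t i j tT; rewrite (_ : (fun s => _) = fun s => y s (true, (i, j))); [exact: cy|apply/funext => s; exact: QyE].
    split; first by move=> t i j tT; rewrite (_ : (fun s => _) = fun s => y s (false, (i, j))); [exact: cy|apply/funext => s; exact: SyE].
    by move=> t tT; apply: curves => i; exact: dy.
  have := frame_flow_growth T0 fl; have [-> ->] := init y yi; rewrite -/K => -[gQ gS].
  have small x : x ^+ 2 <= expR (K * T) * (fro Q0 + fro S0) -> `|x| < beta T.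
    move=> h; apply: (@lt_le_trans _ _ (1 + x ^+ 2)); last by rewrite lerD2l.
    by have := sqr_ge0 (`|x| - 2^-1); rewrite sqrrB real_normK ?num_real //; lra.
  have e0 := expR_ge0 (K * T); have q0 := fro_ge0 Q0; have s0 := fro_ge0 S0.
  case=> [[] [i j]]; rewrite -?QyE -?SyE; apply: small.
    apply: le_trans (fro_entry _ _ _) _; apply: le_trans gQ _.
    by rewrite ler_wpM2l // lerDl.
  apply: le_trans (fro_entry _ _ _) _; apply: le_trans gS _.
  by rewrite ler_wpM2l // lerDr.
have [y [yi yd]] := ode_global lF cb bm b0 ap.
exists (fun t => Qy (y t)), (fun t => Sy (y t)).
have [Qi Si] := init y yi.
have DD (t : R) : 0 <= t -> mx_derive (fun s => Qy (y s)) t (- (Qy (y t) *m ric (Sy (y t)) (Qy (y t)))) /\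
    mx_derive (fun s => Sy (y s)) t (ric (Sy (y t)) (Qy (y t)) *m Sy (y t)).
  by move=> t0; apply: curves => i; exact: yd.
split => // t t0.
(* The two equations are dual, so the derivative of Q S is - Q r S + Q r S = 0 and the product keeps
   its initial value. *)
have prodD (s : R) : 0 <= s -> mx_derive (fun s => Qy (y s) *m Sy (y s)) s 0.
  move=> s0; have [dQ dS] := DD s s0.
  by apply: mx_derive_eq (mx_derive_mul dQ dS) _; rewrite mulNmx mulmxA addNr.
apply/matrixP => i j; rewrite -QS0 -Qi -Si.
have cP s : 0 <= s -> {for s, continuous (fun s => (Qy (y s) *m Sy (y s)) i j)}.
  by move=> s0; exact: is_derive_continuous (prodD s s0 i j).
apply/le_anti/andP; split.
  apply: (@derive_le0_le _ (fun s => (Qy (y s) *m Sy (y s)) i j) (fun=> 0)) => //.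
    move=> s /andP[/ltW s0 _]; split => //; have := prodD s s0 i j; by rewrite mxE.
  by move=> s /andP[s0 _]; exact: cP.
rewrite -lerN2; apply: (@derive_le0_le _ (fun s => - (Qy (y s) *m Sy (y s)) i j) (fun=> - 0)) => //.
  move=> s /andP[/ltW s0 _]; split; last by rewrite oppr0.
  by have := prodD s s0 i j; rewrite mxE => D; exact: is_deriveN D.
by move=> s /andP[s0 _]; exact: (cvgN (cP s s0)).
Qed.

End FrameFlow.

Section InverseContinuity.
Context {R : realType} {T : topologicalType}.

Lemma continuous_at_prod (I : Type) (r : seq I) (P : pred I) (f : I -> T -> R) (x : T) :
  (forall i, {for x, continuous (f i)}) ->
  {for x, continuous (fun y => \prod_(i <- r | P i) f i y)}.
Proof.
move=> cf; elim: r => [|i r IH].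
  rewrite (_ : (fun _ => _) = cst 1); first exact: cvg_cst.
  by apply/funext => y; rewrite big_nil.
rewrite (_ : (fun _ => _) = fun y => if P i then f i y * \prod_(j <- r | P j) f j y
   else \prod_(j <- r | P j) f j y); last by apply/funext => y; rewrite big_cons.
case: (P i) => //.
exact: (cvgM (cf i) IH).
Qed.

Lemma continuous_det {n} (M : T -> 'M[R]_n) (x : T) :
  (forall i j, {for x, continuous (fun y => M y i j)}) ->
  {for x, continuous (fun y => \det (M y))}.
Proof.
move=> cM; apply: continuous_at_sum => s.
apply: cvgM; first exact: cvg_cst.
by apply: continuous_at_prod => i; exact: cM.
Qed.

Lemma invmxE {n} (A : 'M[R]_n) i j : \det A != 0 -> invmx A i j = (\det A)^-1 * \adj A i j.
Proof. by move=> d0; rewrite /invmx unitmxE unitfE d0 mxE. Qed.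

(** [invmx] follows the cofactor formula only at invertible matrices; the determinant, being
    continuous, stays nonzero near [x]. *)
Lemma continuous_invmx {n} (M : T -> 'M[R]_n) (x : T) : M x \in unitmx ->
  (forall i j, {for x, continuous (fun y => M y i j)}) ->
  forall i j, {for x, continuous (fun y => invmx (M y) i j)}.
Proof.
move=> uM cM i j; have cd := continuous_det cM.
have d0 : \det (M x) != 0 by rewrite -unitfE -unitmxE.
have cd' : {for x, continuous (fun y => \det (row' j (col' i (M y))))}.
  apply: continuous_det => k l; rewrite (_ : (fun y => _) = fun y => M y (lift j k) (lift i l)) //.
  by apply/funext => y; rewrite !mxE.
have ca : {for x, continuous (fun y => \adj (M y) i j)}.
  rewrite (_ : (fun y => _) = fun y => (-1) ^+ (j + i) * \det (row' j (col' i (M y)))).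
    exact: (cvgM (cvg_cst ((-1) ^+ (j + i) : R)) cd').
  by apply/funext => y; rewrite mxE /cofactor.
have c : {for x, continuous (fun y => (\det (M y))^-1 * \adj (M y) i j)}.
  by exact: (cvgM (cvgV d0 cd) ca).
have nd : \forall y \near x, \det (M y) != 0.
  have p : 0 < `|\det (M x)| by rewrite normr_gt0.
  have /cvgrPdist_lt /(_ _ p) := cd; apply: filterS => y h.
  by apply/eqP => e; move: h; rewrite e subr0 ltxx.
rewrite /prop_for /continuous_at (invmxE _ _ d0).
apply: cvg_trans c; apply: (near_eq_cvg (FF := nbhs_filter x)).
by apply: filterS nd => y dy; rewrite invmxE.
Qed.

End InverseContinuity.

(** * Uniqueness for the equation of the Gram matrix *)

Section GramFlow.
Context {R : realType} {n : nat}.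
Variable (c : 'I_n -> 'M[R]_n).

(** As a polynomial in the pair (P, W), [gram_ricci] is Lipschitz on the box containing both
    solutions. The W carry no equation of their own: as inverses they satisfy W1 - W2 = W1 (P2 - P1)
    W2, so the estimate closes on the difference of the P, and [gronwall_zero] applies. *)
Lemma gram_flow_unique (T : R) (P1 P2 W1 W2 : R -> 'M[R]_n) : 0 <= T ->
  (forall t, 0 <= t <= T -> P1 t *m W1 t = 1%:M /\ P2 t *m W2 t = 1%:M) ->
  (forall t i j, 0 <= t <= T -> {for t, continuous (fun s => P1 s i j)} /\
      {for t, continuous (fun s => P2 s i j)}) ->
  (forall t i j, 0 <= t <= T -> {for t, continuous (fun s => W1 s i j)} /\
      {for t, continuous (fun s => W2 s i j)}) ->
  (forall t, 0 < t < T -> mx_derive P1 t (- 2 *: gram_ricci c (P1 t) (W1 t)) /\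
      mx_derive P2 t (- 2 *: gram_ricci c (P2 t) (W2 t))) ->
  P1 0 = P2 0 -> P1 T = P2 T.
Proof.
move=> T0 PW cP cW dP P0; pose I := (bool * ('I_n * 'I_n))%type.
pose st (P W : 'M[R]_n) (k : I) : R := if k.1 then P k.2.1 k.2.2 else W k.2.1 k.2.2.
pose Py (y : I -> R) : 'M[R]_n := \matrix_(i, j) y (true, (i, j)).
pose Wy (y : I -> R) : 'M[R]_n := \matrix_(i, j) y (false, (i, j)).
have PyE P W : Py (st P W) = P by apply/matrixP => i j; rewrite mxE.
have WyE P W : Wy (st P W) = W by apply/matrixP => i j; rewrite mxE.
pose J := ('I_n * 'I_n)%type.
have lP : loc_lip_mx Py.
  by move=> i j; apply: (@loc_lip_eq _ _ _ (fun y => y (true, (i, j)))) => [y|]; [rewrite mxE|exact: loc_lip_proj].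
have lW : loc_lip_mx Wy.
  by move=> i j; apply: (@loc_lip_eq _ _ _ (fun y => y (false, (i, j)))) => [y|]; [rewrite mxE|exact: loc_lip_proj].
have lG : loc_lip_mx (fun y => gram_ricci c (Py y) (Wy y)).
  apply: loc_lip_mx_add; apply: loc_lip_mx_scale; try exact: loc_lip_cst.
    move=> i j; apply: (@loc_lip_eq _ _ _ (fun y => \tr (Wy y *m c i *m Py y *m (c j)^T))) => [y|].
      by rewrite mxE.
    by apply: loc_lip_trace; do ?[apply: loc_lip_mx_mul => //]; exact: loc_lip_mx_cst.
  apply: loc_lip_mx_mul => //; apply: loc_lip_mx_mul => //.
  apply: loc_lip_mx_sum => a; apply: loc_lip_mx_sum => d; apply: loc_lip_mx_scale; first exact: lW.
  by do ?[apply: loc_lip_mx_mul => //]; exact: loc_lip_mx_cst.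
have bd (P W : R -> 'M[R]_n) : (forall t i j, 0 <= t <= T -> {for t, continuous (fun s => P s i j)}) ->
   (forall t i j, 0 <= t <= T -> {for t, continuous (fun s => W s i j)}) ->
   exists2 B : R, 0 <= B & forall i t, 0 <= t <= T -> `|st (P t) (W t) i| <= B.
  move=> cP' cW'; apply: continuous_family_bounded => // -[[] [i j]] t tT.
    exact: cP'.
  exact: cW'.
have [B1 B10 hB1] := bd _ _ (fun t i j tT => (cP t i j tT).1) (fun t i j tT => (cW t i j tT).1).
have [B2 B20 hB2] := bd _ _ (fun t i j tT => (cP t i j tT).2) (fun t i j tT => (cW t i j tT).2).
pose B := B1 + B2; have B0 : 0 <= B by rewrite addr_ge0.
have {hB1} hB1 k t : 0 <= t <= T -> `|st (P1 t) (W1 t) k| <= B.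
  by move=> tT; apply: le_trans (hB1 k t tT) _; rewrite lerDl.
have {hB2} hB2 k t : 0 <= t <= T -> `|st (P2 t) (W2 t) k| <= B.
  by move=> tT; apply: le_trans (hB2 k t tT) _; rewrite lerDr.
have HL i j := lG i j B B0; pose L i j := sval (cid2 (HL i j)).
have L0 i j : 0 <= L i j by rewrite /L; case: cid2.
pose LL := \sum_i \sum_j L i j.
have LL0 : 0 <= LL by do 2!apply: sumr_ge0 => ? _.
have LLle i j : L i j <= LL.
  rewrite /LL (bigD1 i) //= (bigD1 j) //= -addrA lerDl.
  by rewrite addr_ge0 //; do ?[apply: sumr_ge0 => ? _].
have diffW t i j : 0 <= t <= T ->
   `|W1 t i j - W2 t i j| <= B * B * \sum_(k : J) `|P1 t k.1 k.2 - P2 t k.1 k.2|.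
  move=> tT; have [e1 e2] := PW t tT.
  have -> : W1 t i j - W2 t i j = \sum_k \sum_l W1 t i l * (P2 t l k - P1 t l k) * W2 t k j.
    have -> : W1 t i j - W2 t i j = (W1 t *m (P2 t - P1 t) *m W2 t) i j.
      rewrite mulmxBr mulmxBl -mulmxA e2 mulmx1 (mulmx1C e1) mul1mx.
      by rewrite !mxE.
    rewrite mxE; apply: eq_bigr => k _; rewrite mxE mulr_suml.
    by apply: eq_bigr => l _; rewrite !mxE.
  rewrite -(pair_bigA _ (fun l k => `|P1 t l k - P2 t l k|)) /= exchange_big /=.
  apply: le_trans (ler_norm_sum _ _ _) _; rewrite mulr_sumr; apply: ler_sum => k _.
  apply: le_trans (ler_norm_sum _ _ _) _; rewrite mulr_sumr; apply: ler_sum => l _.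
  rewrite !normrM mulrAC [X in _ * X]distrC ler_wpM2r // ler_pM //.
    exact: (hB1 (false, (i, k)) t tT).
  exact: (hB2 (false, (l, j)) t tT).
apply/matrixP => i0 j0; apply/eqP; rewrite -subr_eq0; apply/eqP.
pose N : R := #|{: J}|%:R.
apply: (@gronwall_zero _ J (fun t k => P1 t k.1 k.2 - P2 t k.1 k.2)
  (fun t k => - 2 * gram_ricci c (P1 t) (W1 t) k.1 k.2 - - 2 * gram_ricci c (P2 t) (W2 t) k.1 k.2)
  (* The factor 2 is that of the Ricci flow; in the bracket, 1 accounts for the difference of the P
     and N B^2 for that of the W, through [diffW]. *)
  (2 * LL * (1 + N * (B * B))) T T0 _ _ _ _ (i0, j0)).
- by rewrite !mulr_ge0 // addr_ge0 // !mulr_ge0.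
- move=> [i j] t tT /=; have [d1 d2] := dP t tT; split.
    have := is_derive_sub (d1 i j) (d2 i j).
    by rewrite [(_ *: gram_ricci c (P1 t) _) i j]mxE [(_ *: gram_ricci c (P2 t) _) i j]mxE.
  have tT' : 0 <= t <= T by case/andP: tT => a b; rewrite !ltW.
  rewrite -mulrBr normrM normrN (ger0_norm (ler0n R 2)) -!mulrA ler_wpM2l //.
  have H : `|gram_ricci c (P1 t) (W1 t) i j - gram_ricci c (P2 t) (W2 t) i j|
     <= L i j * \sum_k `|st (P1 t) (W1 t) k - st (P2 t) (W2 t) k|.
    rewrite /L; case: cid2 => l /= l0 /(_ (st (P1 t) (W1 t)) (st (P2 t) (W2 t))).
    by rewrite !PyE !WyE; apply => k; [exact: hB1|exact: hB2].
  apply: le_trans H _; apply: ler_pM => //; first exact: sumr_ge0.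
  rewrite -(pair_bigA _ (fun b k => `|st (P1 t) (W1 t) (b, k) - st (P2 t) (W2 t) (b, k)|)) /=.
  rewrite big_bool /= /st /= mulrDl mul1r lerD2l -mulrA.
  apply: le_trans (ler_sum _ (fun k _ => diffW t k.1 k.2 tT')) _.
  by rewrite sumr_const mulr_natl.
- move=> [i j] t tT /=; have [c1 c2] := cP t i j tT; exact: (cvgB c1 c2).
- by move=> [i j] /=; rewrite P0 subrr.
Qed.

End GramFlow.

(** * Left-invariant frames on a Lie group *)

Section Jacobians.
Context {R : realType}.

Lemma differentiable_rV {m n} (f : 'rV[R]_m -> 'rV[R]_n) x :
  (forall j, differentiable (fun y => f y 0 j) x) -> differentiable f x.
Proof.
move=> df; have -> : f = \sum_(j < n) (fun y => f y 0 j *: (delta_mx 0 j : 'rV[R]_n)).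
  apply/funext => y; rewrite fct_sumE {1}[f y]row_sum_delta.
  by apply: eq_bigr.
apply: differentiable_sum => j; exact: differentiableZl.
Qed.

Lemma jacobian_partial {m n} (f : 'rV[R]_m -> 'rV[R]_n) x i j : differentiable f x ->
  'J f x i j = partial i (fun y => f y 0 j) x.
Proof.
move=> df; rewrite /jacobian mxE -deriveE //.
by rewrite derive_mx ?mxE //; exact: diff_derivable.
Qed.

Lemma jacobian_comp {m n p} (f : 'rV[R]_m -> 'rV[R]_n) (g : 'rV[R]_n -> 'rV[R]_p) x :
  differentiable f x -> differentiable g (f x) ->
  'J (g \o f) x = 'J f x *m 'J g (f x).
Proof.
move=> df dg; apply/row_matrixP => i; rewrite !rowE mulmxA /jacobian.
by rewrite !mul_rV_lin1 diff_comp.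
Qed.

Lemma jacobian_eq_near {m n} (f g : 'rV[R]_m -> 'rV[R]_n) x :
  differentiable f x -> differentiable g x -> (\forall y \near x, f y = g y) ->
  'J f x = 'J g x.
Proof.
move=> df dg fg; apply/matrixP => i j.
apply: etrans (jacobian_partial i j df) (etrans _ (esym (jacobian_partial i j dg))).
apply: near_eq_derive; apply: (@filterS _ _ (nbhs_filter x) _ _ _ fg) => y fgy.
by rewrite fgy.
Qed.

Lemma differentiable_eq_near {m n} (f g : 'rV[R]_m -> 'rV[R]_n) x :
  differentiable f x -> (\forall y \near x, f y = g y) -> differentiable g x.
Proof.
move=> df fg; apply: (@differentiable_intro _ _ _ g ('d f x) x).
  exact: diff_continuous.
have gx : f x = g x by exact: nbhs_singleton fg.
move=> e e0; have /diff_locally /eqaddoP /(_ e e0) := df.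
have fg' : \forall h \near (0 : 'rV[R]_m), f (x + h) = g (x + h).
  have [r /= r0 hr] := (nbhs_ballP _ _).1 fg.
  apply/nbhs_ballP; exists r => //= h; rewrite -ball_normE /= sub0r normrN => hh.
  by apply: hr; rewrite -ball_normE /= opprD addNKr normrN.
move=> H; near=> h; have <- : f (x + h) = g (x + h) by near: h.
rewrite -gx; have : `|(f \o shift x - (cst (f x) + 'd f x)) h| <= e * `|h| by near: h.
by rewrite -[(_ - _) h]/(f (h + x) - (f x + 'd f x h)) opprD addrA [h + x]addrC.
Unshelve. all: by end_near. Qed.

Lemma partial_comp {m n} (f : 'rV[R]_m -> 'rV[R]_n) (g : 'rV[R]_n -> R) x i :
  differentiable f x -> differentiable g (f x) ->
  partial i (g \o f) x = \sum_l 'J f x i l * partial l g (f x).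
Proof.
move=> df dg; rewrite /partial deriveE; last exact: differentiable_comp.
rewrite (diff_comp df dg) /=.
have -> : 'd f x (delta_mx 0 i) = \sum_l 'J f x i l *: delta_mx 0 l.
  by rewrite [LHS]row_sum_delta; apply: eq_bigr => l _; rewrite /jacobian mxE.
rewrite linear_sum; apply: eq_bigr => l _.
by rewrite linearZ /= -[_ *: _]/(_ * _) (deriveE _ dg).
Qed.

Lemma jacobian_id {m} (x : 'rV[R]_m) : 'J id x = 1%:M.
Proof.
apply/row_matrixP => i; rewrite !rowE mulmx1.
by rewrite -deriveEjacobian ?derive_id //; exact: ex_diff.
Qed.

Lemma jacobian_cst {m n} (a : 'rV[R]_n) (x : 'rV[R]_m) : 'J (fun=> a) x = 0.
Proof. by apply/matrixP => i j; rewrite jacobian_partial // /partial derive_cst mxE. Qed.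

Definition smooth_vec {m n} (k : nat) (U : set 'rV[R]_m) (f : 'rV[R]_m -> 'rV[R]_n) :=
  forall j, Ck_on k U (fun x => f x 0 j).

Lemma smooth_vec_diff {m n} k (U : set 'rV[R]_m) (f : 'rV[R]_m -> 'rV[R]_n) x :
  open U -> smooth_vec k.+1 U f -> U x -> differentiable f x.
Proof. by move=> oU sf Ux; apply: differentiable_rV => j; exact: differentiable_Ck oU (sf j) Ux. Qed.

Lemma partial_affine {m n : nat} (iota : 'rV[R]_n -> 'rV[R]_m)
    (s : 'I_n -> 'I_m) (f : 'rV[R]_m -> R) i x :
  (forall (h : R) x i, iota (h *: delta_mx 0 i + x) = h *: delta_mx 0 (s i) + iota x) ->
  partial i (f \o iota) x = partial (s i) f (iota x).
Proof.
move=> si; rewrite /partial /derive.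
have -> // : (fun h : R => h^-1 *: (((f \o iota) \o shift x) (h *: delta_mx 0 i) - (f \o iota) x))
   = (fun h : R => h^-1 *: ((f \o shift (iota x)) (h *: delta_mx 0 (s i)) - f (iota x))).
by apply/funext => h; rewrite /= si.
Qed.

Lemma row_mx_continuousr {m n} (u : 'rV[R]_m) : continuous (fun x : 'rV[R]_n => row_mx u x).
Proof.
move=> x; apply: (cvgrPdist_lt (FF := nbhs_filter x) _ _).2 => e e0.
apply/nbhs_ballP; exists e => //= y; rewrite -ball_normE /=; apply: le_lt_trans.
apply: rV_norm_le => // i; rewrite opp_row_mx add_row_mx subrr.
by case: (split_ordP i) => j ->; rewrite ?row_mxEl ?row_mxEr ?norm_coord // mxE normr0.
Qed.

Lemma row_mx_continuousl {m n} (u : 'rV[R]_n) : continuous (fun x : 'rV[R]_m => row_mx x u).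
Proof.
move=> x; apply: (cvgrPdist_lt (FF := nbhs_filter x) _ _).2 => e e0.
apply/nbhs_ballP; exists e => //= y; rewrite -ball_normE /=; apply: le_lt_trans.
apply: rV_norm_le => // i; rewrite opp_row_mx add_row_mx subrr.
by case: (split_ordP i) => j ->; rewrite ?row_mxEl ?row_mxEr ?norm_coord // mxE normr0.
Qed.

Lemma row_mx_affiner {m n} (u : 'rV[R]_m) (h : R) (x : 'rV[R]_n) i :
  row_mx u (h *: delta_mx 0 i + x) = h *: delta_mx 0 (rshift m i) + row_mx u x.
Proof. by rewrite delta_mx_rshift scale_row_mx add_row_mx scaler0 add0r. Qed.

Lemma row_mx_affinel {m n} (u : 'rV[R]_n) (h : R) (x : 'rV[R]_m) i :
  row_mx (h *: delta_mx 0 i + x) u = h *: delta_mx 0 (lshift n i) + row_mx x u.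
Proof. by rewrite delta_mx_lshift scale_row_mx add_row_mx scaler0 add0r. Qed.

End Jacobians.

Section SmoothMatrices.
Context {R : realType} {m : nat}.

Lemma Ck_on_det {n} k (U : set 'rV[R]_m) (M : 'rV[R]_m -> 'M[R]_n) : open U ->
  (forall i j, Ck_on k U (fun x => M x i j)) -> Ck_on k U (fun x => \det (M x)).
Proof.
move=> oU sM; apply: Ck_on_sum => // s; apply: Ck_on_mul => //; first exact: Ck_on_cst.
by apply: Ck_on_prod => // i; exact: sM.
Qed.

Lemma Ck_on_invmx {n} k (U : set 'rV[R]_m) (M : 'rV[R]_m -> 'M[R]_n) : open U ->
  (forall x, U x -> M x \in unitmx) ->
  (forall i j, Ck_on k U (fun x => M x i j)) -> forall i j, Ck_on k U (fun x => invmx (M x) i j).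
Proof.
move=> oU uM sM i j.
have d0 x : U x -> \det (M x) != 0 by move=> /uM; rewrite unitmxE unitfE.
apply: (@Ck_on_eq _ _ _ _ (fun x => (\det (M x))^-1 * ((-1) ^+ (j + i) * \det (row' j (col' i (M x)))))) => //.
  by move=> x /d0 dx; rewrite invmxE // mxE /cofactor.
apply: Ck_on_mul => //; first by apply: Ck_on_inv => //; exact: Ck_on_det.
apply: Ck_on_mul => //; first exact: Ck_on_cst.
apply: Ck_on_det => // p q; apply: (@Ck_on_eq _ _ _ _ (fun x => M x (lift j p) (lift i q))) => //.
by move=> x _; rewrite !mxE.
Qed.

End SmoothMatrices.

Section Charts.
Context {R : realType} {n : nat} {T : topologicalType} (c : chart R n T).

Lemma chart_invK x : chart_cod c x -> chart_dom c (chart_inv c x) /\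
  chart_map c (chart_inv c x) = x.
Proof. by case=> p dp <-; rewrite chart_mapK. Qed.

Lemma chart_mapP p : chart_dom c p -> chart_cod c (chart_map c p).
Proof. by move=> dp; exists p. Qed.

Lemma chart_inv_continuous_at x : chart_cod c x -> {for x, continuous (chart_inv c)}.
Proof.
move=> dx; have := @chart_inv_continuous _ _ _ c.
by rewrite (continuous_open_subspace _ (@chart_cod_open _ _ _ c)); apply; rewrite inE.
Qed.

End Charts.

(** * Multiplication and translations in charts *)

Section LieGroupCharts.
Context {R : realType} {n : nat} (N : lie_group R n).

Local Notation idx := (chart_index (lg_atlas N)).
Local Notation dom c := (chart_dom (lg_atlas N c)).
Local Notation phi c := (chart_map (lg_atlas N c)).
Local Notation psi c := (chart_inv (lg_atlas N c)).
Local Notation cod c := (chart_cod (lg_atlas N c)).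
Implicit Types (c d e : idx) (a b p q : N) (x y : 'rV[R]_n).

Definition mul_chart c d e (z : 'rV[R]_(n + n)) : 'rV[R]_n :=
  phi e (psi c (lsubmx z) * psi d (rsubmx z))%g.

Definition mul_chart_dom c d e : set 'rV[R]_(n + n) :=
  [set z : 'rV[R]_(n + n) | exists p q,
         [/\ dom c p, dom d q, dom e (p * q)%g & z = row_mx (phi c p) (phi d q)]].

Lemma mul_chart_smooth c d e k : smooth_vec k (mul_chart_dom c d e) (mul_chart c d e).
Proof. by move=> j; exact: (lg_mul_smooth c d e j k). Qed.

Lemma mul_chart_domP c d e x y : cod c x -> cod d y -> dom e (psi c x * psi d y)%g ->
  mul_chart_dom c d e (row_mx x y).
Proof.
move=> cx dy exy; have [dx ex] := chart_invK cx; have [dy' ey] := chart_invK dy.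
by exists (psi c x), (psi d y); split => //; rewrite ex ey.
Qed.

Lemma group_mul_continuous_at (X : topologicalType) (f g : X -> N) (u : X) :
  {for u, continuous f} -> {for u, continuous g} -> {for u, continuous (fun w => (f w * g w)%g)}.
Proof.
move=> cf cg; apply: (@continuous_comp _ _ _ (fun w => (f w, g w)) (fun z : N * N => (z.1 * z.2)%g)).
  exact: cvg_pair.
exact: lg_mul_continuous.
Qed.

Lemma mul_chart_dom_open c d e : open (mul_chart_dom c d e).
Proof.
rewrite openE => _ [p [q [dp dq dpq ->]]].
have cl : {for row_mx (phi c p) (phi d q), continuous (@lsubmx R 1 n n)}.
  by apply/differentiable_continuous/differentiable_lsubmx.
have cr : {for row_mx (phi c p) (phi d q), continuous (@rsubmx R 1 n n)}.
  by apply/differentiable_continuous/differentiable_rsubmx.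
have n1 : \forall z \near row_mx (phi c p) (phi d q), cod c (lsubmx z).
  apply: cl; rewrite row_mxKl; apply: open_nbhs_nbhs; split; first exact: chart_cod_open.
  exact: chart_mapP.
have n2 : \forall z \near row_mx (phi c p) (phi d q), cod d (rsubmx z).
  apply: cr; rewrite row_mxKr; apply: open_nbhs_nbhs; split; first exact: chart_cod_open.
  exact: chart_mapP.
have n3 : \forall z \near row_mx (phi c p) (phi d q), dom e (psi c (lsubmx z) * psi d (rsubmx z))%g.
  have cm : {for row_mx (phi c p) (phi d q), continuous (fun z => (psi c (lsubmx z) * psi d (rsubmx z))%g)}.
    apply: group_mul_continuous_at.
      apply: continuous_comp => //; rewrite row_mxKl; exact: (chart_inv_continuous_at (chart_mapP dp)).
    apply: continuous_comp => //; rewrite row_mxKr; exact: (chart_inv_continuous_at (chart_mapP dq)).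
  apply: cm; rewrite row_mxKl row_mxKr !chart_mapK //.
  by apply: open_nbhs_nbhs; split; first exact: chart_dom_open.
apply: (@filterS _ _ (nbhs_filter _) _ _ _ (filterI n1 (filterI n2 n3))) => z [z1 [z2 z3]].
by rewrite -(hsubmxK z); apply: mul_chart_domP.
Qed.

Definition left_chart c d a : 'rV[R]_n -> 'rV[R]_n := phi d \o (fun p => (a * p)%g) \o psi c.

Definition right_chart c d a : 'rV[R]_n -> 'rV[R]_n := phi d \o (fun p => (p * a)%g) \o psi c.

Definition left_dom c d a : set 'rV[R]_n := [set x | cod c x /\ dom d (a * psi c x)%g].

Definition right_dom c d a : set 'rV[R]_n := [set x | cod c x /\ dom d (psi c x * a)%g].

Lemma open_cod_preimage c (f : N -> N) d : continuous f ->
  open [set x | cod c x /\ dom d (f (psi c x))].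
Proof.
move=> cf; rewrite openE => x [cx dx].
have n1 : \forall y \near x, cod c y.
  by apply: open_nbhs_nbhs; split => //; exact: chart_cod_open.
have n2 : \forall y \near x, dom d (f (psi c y)).
  have cm : {for x, continuous (fun y => f (psi c y))}.
    by apply: continuous_comp; [exact: (chart_inv_continuous_at cx)|exact: cf].
  by apply: cm; apply: open_nbhs_nbhs; split => //; exact: chart_dom_open.
exact: filterI n1 n2.
Qed.

Lemma group_mull_continuous a : continuous (fun p : N => (a * p)%g).
Proof. by move=> p; apply: group_mul_continuous_at; [exact: cvg_cst|exact: cvg_id]. Qed.

Lemma group_mulr_continuous a : continuous (fun p : N => (p * a)%g).
Proof. by move=> p; apply: group_mul_continuous_at; [exact: cvg_id|exact: cvg_cst]. Qed.

Lemma left_dom_open c d a : open (left_dom c d a).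
Proof. exact: open_cod_preimage (@group_mull_continuous a). Qed.

Lemma right_dom_open c d a : open (right_dom c d a).
Proof. exact: open_cod_preimage (@group_mulr_continuous a). Qed.

Lemma left_chart_mul_chart c' c d a x : dom c' a ->
  left_chart c d a x = mul_chart c' c d (row_mx (phi c' a) x).
Proof. by move=> da; rewrite /mul_chart row_mxKl row_mxKr chart_mapK. Qed.

Lemma right_chart_mul_chart c' c d a x : dom c' a ->
  right_chart c d a x = mul_chart c c' d (row_mx x (phi c' a)).
Proof. by move=> da; rewrite /mul_chart row_mxKl row_mxKr chart_mapK. Qed.

(** A left translation is a slice of the product chart with its first factor frozen at a chart value
    of [a]. *)
Lemma left_chart_smooth c d a k : smooth_vec k (left_dom c d a) (left_chart c d a).
Proof.
move=> j; have [c' da] := atlas_cover (lg_atlas N) a.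
have -> : (fun x => left_chart c d a x 0 j) =
    (fun z => mul_chart c' c d z 0 j) \o (row_mx (phi c' a)).
  by apply/funext => x; rewrite (left_chart_mul_chart _ _ _ da).
apply: (@Ck_on_sub _ _ _ _ (row_mx (phi c' a) @^-1` mul_chart_dom c' c d)).
  move=> x [cx dx]; apply: mul_chart_domP => //; first exact: chart_mapP.
  by rewrite chart_mapK.
apply: (@Ck_on_affine _ _ _ _ (@rshift n n)).
- exact: row_mx_continuousr.
- by move=> h x i; exact: row_mx_affiner.
- exact: mul_chart_smooth.
Qed.

Lemma right_chart_smooth c d a k : smooth_vec k (right_dom c d a) (right_chart c d a).
Proof.
move=> j; have [c' da] := atlas_cover (lg_atlas N) a.
have -> : (fun x => right_chart c d a x 0 j) =
    (fun z => mul_chart c c' d z 0 j) \o (fun x => row_mx x (phi c' a)).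
  by apply/funext => x; rewrite (right_chart_mul_chart _ _ _ da).
apply: (@Ck_on_sub _ _ _ _ ((fun x => row_mx x (phi c' a)) @^-1` mul_chart_dom c c' d)).
  move=> x [cx dx]; apply: mul_chart_domP => //; first exact: chart_mapP.
  by rewrite chart_mapK.
apply: (@Ck_on_affine _ _ _ _ (@lshift n n)).
- exact: row_mx_continuousl.
- by move=> h x i; exact: row_mx_affinel.
- exact: mul_chart_smooth.
Qed.

Lemma left_chart_diff c d a x : left_dom c d a x -> differentiable (left_chart c d a) x.
Proof.
move=> dx; apply: (@smooth_vec_diff _ _ _ 0%N (left_dom c d a)) => //.
  exact: left_dom_open.
exact: left_chart_smooth.
Qed.

Lemma right_chart_diff c d a x : right_dom c d a x -> differentiable (right_chart c d a) x.
Proof.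
move=> dx; apply: (@smooth_vec_diff _ _ _ 0%N (right_dom c d a)) => //.
  exact: right_dom_open.
exact: right_chart_smooth.
Qed.

Lemma left_chart_comp c d e a b x : left_dom c d a x ->
  left_chart c e (b * a)%g x = left_chart d e b (left_chart c d a x).
Proof. by move=> [cx dx]; rewrite /left_chart /= chart_mapK // mulgA. Qed.

Lemma left_chart_dom c d e a b x : left_dom c d a x -> dom e (b * a * psi c x)%g ->
  left_dom d e b (left_chart c d a x).
Proof.
move=> [cx dx] ex; split; first exact: chart_mapP.
by rewrite /left_chart /= chart_mapK // mulgA.
Qed.

Lemma jacobian_left_chart_comp c d e a b x : left_dom c d a x -> dom e (b * a * psi c x)%g ->
  'J (left_chart c e (b * a)%g) x =
  'J (left_chart c d a) x *m 'J (left_chart d e b) (left_chart c d a x).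
Proof.
move=> dx ex; have dy := left_chart_dom dx ex.
rewrite -jacobian_comp; [|exact: left_chart_diff|exact: left_chart_diff].
apply: jacobian_eq_near.
- by apply: left_chart_diff; split => //; case: dx.
- by apply: differentiable_comp; exact: left_chart_diff.
- apply: (open_near (@left_dom_open c d a) dx) => y dy'.
  exact: left_chart_comp.
Qed.

Lemma left_chart1 c x : cod c x -> left_chart c c 1%g x = x.
Proof. by move=> cx; rewrite /left_chart /= mul1g; have [] := chart_invK cx. Qed.

Lemma left_dom1 c x : cod c x -> left_dom c c 1%g x.
Proof. by move=> cx; split => //; rewrite mul1g; have [] := chart_invK cx. Qed.

Lemma jacobian_left_chart1 c x : cod c x -> 'J (left_chart c c 1%g) x = 1%:M.
Proof.
move=> cx; rewrite -(jacobian_id x); apply: jacobian_eq_near.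
- exact/left_chart_diff/left_dom1.
- exact: ex_diff.
- apply: (open_near (chart_cod_open (c := lg_atlas N c)) cx) => y cy.
  exact: left_chart1.
Qed.

End LieGroupCharts.

(* Otherwise a failing unification of two derivatives unfolds them down to limits. *)
Opaque partial jacobian.

(** Pure algebra at one point: the brackets of the frame [E] with derivatives [dE] determine the
    exterior derivative of the dual coframe [F]. [G d] is the derivative of the whole frame along
    its d-th vector, and differentiating F E = 1 expresses [dF] through the [G d]. *)
Lemma dual_structure {R : comPzRingType} {n} (E F : 'M[R]_n) (dE dF C : 'I_n -> 'M[R]_n) :
  F *m E = 1%:M -> (forall l, dF l *m E + F *m dE l = 0) ->
  (forall d b j, \sum_l E d l * dE l b j - \sum_l E b l * dE l d j = \sum_e C d b e * E e j) ->
  forall k i a, dF k i a - dF i k a = - \sum_b \sum_d F k b * F i d * C b d a.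
Proof.
move=> FE dFE st k i a; have EF : E *m F = 1%:M := mulmx1C FE.
pose G d := \sum_l E d l *: dE l.
have dEG l : dE l = \sum_d F l d *: G d.
  under eq_bigr do rewrite scaler_sumr; rewrite exchange_big /=.
  rewrite (bigD1 l) //= [X in _ + X]big1 => [|m /negPf ml];
    under eq_bigr do rewrite scalerA.
    rewrite -scaler_suml (_ : \sum_d _ = (F *m E) l l); last by rewrite mxE.
    by rewrite FE mxE eqxx scale1r addr0.
  rewrite -scaler_suml (_ : \sum_d _ = (F *m E) l m); last by rewrite mxE.
  by rewrite FE mxE eq_sym ml scale0r.
have dFG l : dF l = - \sum_d F l d *: (F *m (G d *m F)).
  have /eqP := dFE l; rewrite addr_eq0 => /eqP /(congr1 (mulmx^~ F)).
  rewrite /= -mulmxA EF mulmx1 => ->; rewrite mulNmx; congr (- _).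
  rewrite dEG mulmx_sumr mulmx_suml; apply: eq_bigr => d _.
  by rewrite -scalemxAr -scalemxAl mulmxA.
have dFe l j : dF l j a = - \sum_b \sum_d F l b * F j d * (G b *m F) d a.
  rewrite dFG mxE summxE; congr (- _); apply: eq_bigr => b _.
  rewrite !mxE mulr_sumr; apply: eq_bigr => d _; by rewrite mulrA mxE.
rewrite !dFe opprK addrC; rewrite [X in X - _]exchange_big /= -sumrB -sumrN.
apply: eq_bigr => b _; rewrite -sumrB -sumrN; apply: eq_bigr => d _.
rewrite [F i d * _]mulrC -mulrBr -mulrN; congr (_ * _).
have -> : C b d a = (C b *m (E *m F)) d a by rewrite EF mulmx1.
rewrite mulmxA !mxE -sumrB -sumrN; apply: eq_bigr => j _.
rewrite -mulrBl -mulNr; congr (_ * _).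
rewrite [in RHS]mxE -st opprB /G !summxE.
by congr (_ - _); apply: eq_bigr => l _; rewrite mxE.
Qed.

Section LeftInvariantFrame.
Context {R : realType} {n : nat} (N : lie_group R n).

Local Notation idx := (chart_index (lg_atlas N)).
Local Notation dom c := (chart_dom (lg_atlas N c)).
Local Notation phi c := (chart_map (lg_atlas N c)).
Local Notation psi c := (chart_inv (lg_atlas N c)).
Local Notation cod c := (chart_cod (lg_atlas N c)).
Implicit Types (c d e : idx) (a b p q : N) (x y : 'rV[R]_n).

Variable c0 : idx.
Hypothesis dom1 : dom c0 1%g.

Local Notation x0 := (phi c0 1%g).

Lemma cod_open c : open (cod c).
Proof. exact: chart_cod_open. Qed.

(** Row a is the left-invariant field extending the a-th coordinate vector at the identity, namely
    its image under the differential of the translation carrying the identity to the point with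
    coordinates [x]. *)
Definition frame_mx c x : 'M[R]_n := 'J (left_chart c0 c (psi c x)) x0.

Lemma psi_x0 : psi c0 x0 = 1%g.
Proof. by rewrite chart_mapK. Qed.

Lemma cod_x0 : cod c0 x0.
Proof. exact: chart_mapP. Qed.

Lemma left_dom_x0 c x : cod c x -> left_dom c0 c (psi c x) x0.
Proof. by move=> cx; split; [exact: cod_x0|rewrite psi_x0 mulg1; have [] := chart_invK cx]. Qed.

Lemma left_chart_x0 c x : cod c x -> left_chart c0 c (psi c x) x0 = x.
Proof. by move=> cx; rewrite /left_chart /= psi_x0 mulg1; have [] := chart_invK cx. Qed.

(** The translation in [frame_mx] itself varies with [x]. Rewriting its Jacobian as a partial
    derivative of the one map [mul_chart], taken in the second factor, makes smoothness in [x]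
    visible. *)
Lemma frame_mx_entry c x (a j : 'I_n) : cod c x -> frame_mx c x a j =
  partial (rshift n a) (fun z => mul_chart c c0 c z 0 j) (row_mx x x0).
Proof.
move=> cx; have [dx ex] := chart_invK cx.
rewrite /frame_mx (jacobian_partial a j (left_chart_diff (left_dom_x0 cx))).
rewrite -(partial_affine (iota := row_mx x) (s := @rshift n n)); last first.
  by move=> h y i; exact: row_mx_affiner.
congr (partial a _ x0); apply/funext => y.
by rewrite (left_chart_mul_chart _ _ _ dx) ex.
Qed.

Lemma frame_mx_smooth c k (a j : 'I_n) : Ck_on k (cod c) (fun x => frame_mx c x a j).
Proof.
apply: (@Ck_on_eq _ _ _ _
  (partial (rshift n a) (fun z => mul_chart c c0 c z 0 j) \o (fun x => row_mx x x0))).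
- exact: cod_open.
- by move=> x cx; rewrite frame_mx_entry.
apply: (@Ck_on_sub _ _ _ _ ((fun x => row_mx x x0) @^-1` mul_chart_dom c c0 c)).
  move=> x cx; apply: mul_chart_domP => //; first exact: cod_x0.
  by rewrite psi_x0 mulg1; have [] := chart_invK cx.
apply: (@Ck_on_affine _ _ _ _ (@lshift n n)).
- exact: row_mx_continuousl.
- by move=> h x i; exact: row_mx_affinel.
- apply: Ck_on_partial; exact: mul_chart_smooth.
Qed.

Lemma frame_mx_equivariant c d a x : left_dom c d a x ->
  frame_mx d (left_chart c d a x) = frame_mx c x *m 'J (left_chart c d a) x.
Proof.
move=> [cx dx]; rewrite /frame_mx.
have -> : psi d (left_chart c d a x) = (a * psi c x)%g by rewrite /left_chart /= chart_mapK.
rewrite (jacobian_left_chart_comp (left_dom_x0 cx)) ?left_chart_x0 //.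
by rewrite psi_x0 mulg1.
Qed.

Lemma frame_mx0 : frame_mx c0 x0 = 1%:M.
Proof. by rewrite /frame_mx psi_x0 jacobian_left_chart1 //; exact: cod_x0. Qed.

Lemma frame_mx_inverse c x : cod c x ->
  frame_mx c x *m 'J (left_chart c c0 (psi c x)^-1%g) x = 1%:M.
Proof.
move=> cx; have dx := left_dom_x0 cx.
have H := jacobian_left_chart_comp (e := c0) (b := (psi c x)^-1%g) dx.
have {H} := H _; rewrite mulVg mul1g psi_x0 left_chart_x0 // => /(_ dom1) H.
apply: etrans (esym H) _; exact: jacobian_left_chart1 cod_x0.
Qed.

Lemma frame_mx_unit c x : cod c x -> frame_mx c x \in unitmx.
Proof. by move=> cx; have [u _] := mulmx1_unit (frame_mx_inverse cx). Qed.

Definition coframe c x : 'M[R]_n := invmx (frame_mx c x).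

Lemma coframeV c x : cod c x -> coframe c x *m frame_mx c x = 1%:M.
Proof. by move=> cx; rewrite mulVmx // frame_mx_unit. Qed.

Lemma frameV c x : cod c x -> frame_mx c x *m coframe c x = 1%:M.
Proof. by move=> cx; rewrite mulmxV // frame_mx_unit. Qed.

Lemma coframe_smooth c k (a j : 'I_n) : Ck_on k (cod c) (fun x => coframe c x a j).
Proof.
apply: Ck_on_invmx; first exact: cod_open.
  by move=> x; exact: frame_mx_unit.
by move=> i l; exact: frame_mx_smooth.
Qed.

Lemma coframe0 : coframe c0 x0 = 1%:M.
Proof. by rewrite /coframe frame_mx0 invmx1. Qed.

(** The coordinate formula for the bracket of two left-invariant fields at the identity, where the
    frame coincides with the coordinate frame by [frame_mx0]. *)
Definition lie_bracket (k : 'I_n) : 'M[R]_n :=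
  \matrix_(b, i) (pmx k (frame_mx c0) x0 b i - pmx b (frame_mx c0) x0 k i).

Lemma lie_bracket_anti : bracket_anti lie_bracket.
Proof. by move=> a b e; rewrite [LHS]mxE [X in _ = - X]mxE opprB. Qed.

Lemma frame_dmx c x i : cod c x -> dmx i (frame_mx c) x.
Proof.
move=> cx a b.
exact: (Ck_on_derivable (frame_mx_smooth c 1%N a b) cx).
Qed.

Lemma coframe_dmx c x i : cod c x -> dmx i (coframe c) x.
Proof.
move=> cx a b.
exact: (Ck_on_derivable (coframe_smooth c 1%N a b) cx).
Qed.

(* Differentiating the equivariance of the frame under the left translation
   carrying the identity to the point [x]. *)
Lemma frame_mx_derivative c x (k b j : 'I_n) : cod c x ->
  \sum_l frame_mx c x k l * pmx l (frame_mx c) x b j =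
  \sum_i pmx k (frame_mx c0) x0 b i * frame_mx c x i j
  + partial k (partial b (fun u => left_chart c0 c (psi c x) u 0 j)) x0.
Proof.
move=> cx; set m := left_chart c0 c (psi c x).
have mx : m x0 = x := left_chart_x0 cx.
have oU := @left_dom_open _ _ N c0 c (psi c x).
have U0 := left_dom_x0 cx.
pose U := left_dom c0 c (psi c x).
have dm : differentiable m x0 := left_chart_diff U0.
transitivity (pmx k (fun u => frame_mx c (m u)) x0 b j).
  have dE : differentiable (fun y => frame_mx c y b j) (m x0).
    rewrite mx; apply: (differentiable_Ck (k := 0%N) (@cod_open c) _ cx).
    exact: frame_mx_smooth.
  apply/esym; apply: etrans (pmxE _ _ _ _ _) _.
  apply: etrans (partial_comp k dm dE) _.
  by rewrite mx; apply: eq_bigr => l _; congr (_ * _); exact/esym/pmxE.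
have Jm u i l : U u -> 'J m u i l = partial i (fun v => m v 0 l) u.
  by move=> Uu; apply: jacobian_partial; exact: left_chart_diff.
have dJ : dmx k (fun u => 'J m u) x0.
  move=> i l; apply: (@near_eq_derivable _ _ _ (partial i (fun v => m v 0 l))).
    by apply: (open_near oU U0) => u Uu; rewrite Jm.
  exact: (Ck_on_derivable (Ck_on_partial i (@left_chart_smooth _ _ N c0 c (psi c x) 2%N l)) U0).
have eqv : pmx k (fun u => frame_mx c (m u)) x0 = pmx k (fun u => frame_mx c0 u *m 'J m u) x0.
  by apply: (pmx_eq_on k oU _ U0) => u Uu; exact: frame_mx_equivariant.
have [_ prd] := pmx_mul (frame_dmx (i := k) cod_x0) dJ.
have Jx : 'J m x0 = frame_mx c x by [].
apply: etrans (congr1 (fun M : 'M[R]_n => M b j) (etrans eqv prd)) _.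
rewrite frame_mx0 mul1mx Jx mxE; congr (_ + _); first by rewrite mxE.
apply: etrans (pmxE _ _ _ _ _) _; apply: (partial_eq_on _ oU _ U0) => u Uu.
exact: Jm.
Qed.

(** In the commutator of two frame fields the second derivatives of the left translation cancel by
    symmetry, which leaves the bracket at the identity transported by the frame. [dual_structure]
    passes to the coframe. *)
Lemma coframe_maurer_cartan c x : cod c x -> forall k i a : 'I_n,
  pmx k (coframe c) x i a - pmx i (coframe c) x k a =
  - \sum_b \sum_d coframe c x k b * coframe c x i d * lie_bracket b d a.
Proof.
move=> cx; apply: (dual_structure (E := frame_mx c x) (dE := fun l => pmx l (frame_mx c) x)
  (dF := fun l => pmx l (coframe c) x) (C := lie_bracket) (coframeV cx)).
- move=> l.
  have [_ e] := pmx_mul (coframe_dmx (i := l) cx) (frame_dmx (i := l) cx).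
  have z : pmx l (fun y => coframe c y *m frame_mx c y) x = 0.
    have [_ z] := pmx_cst l (1%:M : 'M[R]_n) x.
    exact: etrans (pmx_eq_on l (N := fun=> 1%:M) (@cod_open c) (@coframeV c) cx) z.
  exact: etrans (esym e) z.
- move=> d b j; rewrite (frame_mx_derivative d b j cx) (frame_mx_derivative b d j cx).
  rewrite (partialC_Ck d b (@left_dom_open _ _ N c0 c (psi c x))
     (@left_chart_smooth _ _ N c0 c (psi c x) 2%N j) (left_dom_x0 cx)).
  rewrite opprD addrACA subrr addr0 -sumrB.
  by apply: eq_bigr => e _; rewrite [lie_bracket d b e]mxE mulrBl.
Qed.

End LeftInvariantFrame.

(** * Brackets of nilpotent groups *)

Lemma row_mx_differentiable {R : realType} {m n1 n2} (f : 'rV[R]_m -> 'rV[R]_n1) (g : 'rV[R]_m -> 'rV[R]_n2) x :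
  differentiable f x -> differentiable g x ->
  differentiable (fun y => row_mx (f y) (g y)) x /\
  'J (fun y => row_mx (f y) (g y)) x = row_mx ('J f x) ('J g x).
Proof.
move=> df dg.
have el (j : 'I_n1) : (fun y => row_mx (f y) (g y) 0 (lshift n2 j)) = (fun y => f y 0 j).
  by apply/funext => y; rewrite row_mxEl.
have er (j : 'I_n2) : (fun y => row_mx (f y) (g y) 0 (rshift n1 j)) = (fun y => g y 0 j).
  by apply/funext => y; rewrite row_mxEr.
have d : differentiable (fun y => row_mx (f y) (g y)) x.
  apply: differentiable_rV => j; case: (split_ordP j) => k ->; rewrite ?el ?er.
    by apply: (@differentiable_comp _ _ _ _ f (fun u : 'rV[R]_n1 => u 0 k)) => //; exact: differentiable_coord.
  by apply: (@differentiable_comp _ _ _ _ g (fun u : 'rV[R]_n2 => u 0 k)) => //; exact: differentiable_coord.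
split => //; apply/matrixP => i j; apply: etrans (jacobian_partial i j d) _.
case: (split_ordP j) => k ->; rewrite ?row_mxEl ?row_mxEr ?el ?er; apply/esym; exact: jacobian_partial.
Qed.

Lemma mx_inverse_unique {R : comPzRingType} {n} (F E J : 'M[R]_n) :
  F *m E = 1%:M -> E *m J = 1%:M -> J = F.
Proof. by move=> FE EJ; rewrite -[J]mul1mx -FE -mulmxA EJ mulmx1. Qed.

(** When A^k = 0, X - A divides X^k. Taking determinants, the characteristic polynomial divides a
    power of X, so it is itself a power of X and its subleading coefficient, minus the trace,
    vanishes. *)
Lemma nilpotent_trace0 {F : fieldType} {n} (A : 'M[F]_n) k :
  iter k (mulmx A) 1%:M = 0 -> \tr A = 0.
Proof.
case: n A => [|n] A Ak; first by rewrite /mxtrace big_ord0.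
have {}Ak : A ^+ k = 0 by rewrite -Ak; elim: (k) => [|j IH] //=; rewrite exprS IH.
pose P : 'M[{poly F}]_n.+1 := map_mx polyC A.
have cXP : GRing.comm ('X%:M : 'M[{poly F}]_n.+1) P by exact: comm_scalar_mx.
have := subrXX_comm k cXP.
have -> : P ^+ k = 0 by rewrite -rmorphXn /= Ak map_mx0.
rewrite subr0 => /(congr1 determinant).
rewrite -[in RHS]mulmxE det_mulmx -/(char_poly_mx A) -/(char_poly A) -rmorphXn /= det_scalar -exprM => e.
have : char_poly A %| ('X - 0%:P) ^+ (k * n.+1) by rewrite subr0 e dvdp_mulr.
move=> /dvdp_exp_XsubCP[m _]; rewrite subr0 => h.
have hm : char_poly A = 'X^m.
  by apply/eqP; rewrite -eqp_monic ?monicXn ?char_poly_monic.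
have /eqP := size_char_poly A; rewrite hm size_polyXn eqSS => /eqP em.
have := char_poly_trace A (ltn0Sn n); rewrite hm em coefXn /= ltn_eqF // => /esym/eqP.
by rewrite oppr_eq0 => /eqP.
Qed.

Lemma mul_row_ones {R : comPzRingType} {n} (B C : 'M[R]_n) (A1 : 'M[R]_(n, n + n)) A2 :
  A1 = row_mx 1%:M B -> A2 = col_mx 1%:M 1%:M -> A1 *m A2 = C -> B = C - 1%:M.
Proof. by move=> -> -> <-; rewrite mul_row_col !mulmx1 addrC addKr. Qed.

Section NilpotentBracket.
Context {R : realType} {n : nat} (N : lie_group R n).

Local Notation idx := (chart_index (lg_atlas N)).
Local Notation dom c := (chart_dom (lg_atlas N c)).
Local Notation phi c := (chart_map (lg_atlas N c)).
Local Notation psi c := (chart_inv (lg_atlas N c)).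
Local Notation cod c := (chart_cod (lg_atlas N c)).
Implicit Types (a p q : N) (x y : 'rV[R]_n).

Variable c0 : idx.
Hypothesis dom1 : dom c0 1%g.

Local Notation x0 := (phi c0 1%g).
Local Notation E0 := (frame_mx c0 c0).
Local Notation F0 := (coframe c0 c0).
Local Notation mulc := (mul_chart c0 c0 c0).

Definition right_frame y : 'M[R]_n := 'J (right_chart c0 c0 (psi c0 y)) x0.

Lemma right_dom_x0 y : cod c0 y -> right_dom c0 c0 (psi c0 y) x0.
Proof. by move=> cy; split; [exact: cod_x0|rewrite psi_x0 // mul1g; have [] := chart_invK cy]. Qed.

Lemma right_chart_x0 y : cod c0 y -> right_chart c0 c0 (psi c0 y) x0 = y.
Proof. by move=> cy; rewrite /right_chart /= psi_x0 // mul1g; have [] := chart_invK cy. Qed.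

Lemma right_frame_entry y (b j : 'I_n) : cod c0 y -> right_frame y b j =
  partial (lshift n b) (fun z => mulc z 0 j) (row_mx x0 y).
Proof.
move=> cy; have [dy ey] := chart_invK cy.
apply: etrans (jacobian_partial b j (right_chart_diff (right_dom_x0 cy))) _.
apply: etrans (partial_affine (iota := fun x => row_mx x y) (s := @lshift n n) (fun z => mulc z 0 j) b x0 _).
  congr (partial b _ x0); apply/funext => x.
  by rewrite (right_chart_mul_chart _ _ _ dy) ey.
by move=> h x i; exact: row_mx_affinel.
Qed.

Lemma mul_chart_dom_x0 y : cod c0 y -> mul_chart_dom c0 c0 c0 (row_mx x0 y).
Proof.
move=> cy; apply: mul_chart_domP => //; first exact: cod_x0.
by rewrite psi_x0 // mul1g; have [] := chart_invK cy.
Qed.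

(** Both sides are mixed second derivatives of the multiplication at the identity pair, one
    derivative in each factor, taken in opposite orders. *)
Lemma right_frame_derive (k b j : 'I_n) :
  dmx k right_frame x0 /\ pmx k right_frame x0 b j = pmx b E0 x0 k j.
Proof.
have cx0 := cod_x0 dom1.
have sM l := mul_chart_smooth c0 c0 c0 2%N l.
have oD := @mul_chart_dom_open _ _ N c0 c0 c0.
have D0 := mul_chart_dom_x0 cx0.
have ar h x i := row_mx_affiner x0 h x i.
have al h x i := row_mx_affinel x0 h x i.
split.
  move=> b' j'; apply: (@near_eq_derivable _ _ _
      (partial (lshift n b') (fun z => mulc z 0 j') \o row_mx x0)).
    apply: (open_near (@cod_open _ _ N c0) cx0) => y cy.
    by rewrite right_frame_entry.
  apply: (@Ck_on_derivable _ _ 0%N (row_mx x0 @^-1` mul_chart_dom c0 c0 c0)) => //.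
  apply: (@Ck_on_affine _ _ _ _ (@rshift n n)) => //; first exact: row_mx_continuousr.
  exact: (Ck_on_partial _ (mul_chart_smooth c0 c0 c0 2%N j')).
have e1 : pmx k right_frame x0 b j = partial (rshift n k) (partial (lshift n b) (fun z => mulc z 0 j)) (row_mx x0 x0).
  apply: etrans (pmxE _ _ _ _ _) _.
  apply: etrans _ (partial_affine (iota := row_mx x0) (s := @rshift n n) _ k x0 ar).
  apply: (partial_eq_on _ (@cod_open _ _ N c0) _ cx0) => y cy.
  exact: right_frame_entry.
have e2 : pmx b E0 x0 k j = partial (lshift n b) (partial (rshift n k) (fun z => mulc z 0 j)) (row_mx x0 x0).
  apply: etrans (pmxE _ _ _ _ _) _.
  apply: etrans _ (partial_affine (iota := fun x => row_mx x x0) (s := @lshift n n) _ b x0 al).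
  apply: (partial_eq_on _ (@cod_open _ _ N c0) _ cx0) => y cy.
  exact: frame_mx_entry.
by apply: etrans e1 (etrans _ (esym e2)); exact: partialC_Ck oD (sM j) D0.
Qed.

Lemma right_frame0 : right_frame x0 = 1%:M.
Proof.
have cx0 := cod_x0 dom1.
rewrite -(jacobian_id x0); apply: jacobian_eq_near.
- exact/right_chart_diff/right_dom_x0.
- exact: ex_diff.
- apply: (open_near (@cod_open _ _ N c0) cx0) => y cy.
  by rewrite /right_chart /= psi_x0 // mulg1; have [] := chart_invK cy.
Qed.

Definition conj_chart a : 'rV[R]_n -> 'rV[R]_n := phi c0 \o (fun q => (q ^ a)%g) \o psi c0.

(* Its differential at the identity is [Ad - 1], so iterated commutators
   turn products of such operators into the lower central series. *)
Definition comm_chart a : 'rV[R]_n -> 'rV[R]_n := phi c0 \o (fun q => [~ q, a]%g) \o psi c0.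

(** Conjugation is the right translation by [a] followed by the left translation by its inverse; the
    Jacobian of the latter at [a] inverts the frame there, so it is the coframe. *)
Lemma conj_chart_jacobian y : cod c0 y -> differentiable (conj_chart (psi c0 y)) x0 /\
  'J (conj_chart (psi c0 y)) x0 = right_frame y *m F0 y.
Proof.
move=> cy; have [dy ey] := chart_invK cy; set a := psi c0 y.
have rx := right_dom_x0 cy; have ry := right_chart_x0 cy.
have ld : left_dom c0 c0 a^-1%g y by split => //; rewrite mulVg.
have near1 : \forall x \near x0, (left_chart c0 c0 a^-1%g \o right_chart c0 c0 a) x = conj_chart a x.
  apply: (open_near (@right_dom_open _ _ N c0 c0 a) rx) => x [cx dx].
  by rewrite /left_chart /right_chart /conj_chart /= chart_mapK // conjgE.
have dr := right_chart_diff rx.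
have dl : differentiable (left_chart c0 c0 a^-1%g) (right_chart c0 c0 a x0).
  by rewrite ry; exact: left_chart_diff.
have dc := differentiable_eq_near (differentiable_comp dr dl) near1.
split; first exact: dc.
apply: etrans (esym (jacobian_eq_near (differentiable_comp dr dl) dc near1)) _.
apply: etrans (jacobian_comp dr dl) _; rewrite ry; congr (_ *m _).
exact: mx_inverse_unique (coframeV dom1 cy) (frame_mx_inverse dom1 cy).
Qed.

Lemma conj_chart_x0 a : conj_chart a x0 = x0.
Proof. by rewrite /conj_chart /= psi_x0 // conj1g. Qed.

Lemma comm_chart_x0 a : comm_chart a x0 = x0.
Proof. by rewrite /comm_chart /= psi_x0 // comm1g. Qed.

Lemma group_conj_continuous a : continuous (fun q : N => (q ^ a)%g).
Proof.
move=> q; under eq_fun do rewrite conjgE.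
exact: (group_mul_continuous_at (cvg_cst a^-1%g) (@group_mulr_continuous _ _ N a q)).
Qed.

Lemma group_comm_continuous a : continuous (fun q : N => [~ q, a]%g).
Proof.
move=> q; apply: group_mul_continuous_at; first exact: lg_inv_continuous.
exact: group_conj_continuous.
Qed.

Definition inv_chart : 'rV[R]_n -> 'rV[R]_n := phi c0 \o (fun q => q^-1%g) \o psi c0.

(** Only differentiability of the inversion is wanted: it makes the commutator differentiable, and
    the Jacobian of the commutator comes from another identity. *)
Lemma inv_chart_diff : differentiable inv_chart x0.
Proof.
pose U := [set x | cod c0 x /\ dom c0 ((psi c0 x)^-1)%g].
have oU : open U := open_cod_preimage (@lg_inv_continuous _ _ N).
apply: (@smooth_vec_diff _ _ _ 0%N U) => //.
  move=> j; have := lg_inv_smooth c0 c0 j 1%N; apply: Ck_on_sub => x [cx dx].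
  by have [dp ep] := chart_invK cx; exists (psi c0 x).
by split; [exact: cod_x0|rewrite psi_x0 // invg1].
Qed.

Lemma mulc_jacobian : differentiable mulc (row_mx x0 x0) /\
  'J mulc (row_mx x0 x0) = col_mx 1%:M 1%:M.
Proof.
have cx0 := cod_x0 dom1; have D0 := mul_chart_dom_x0 cx0.
have d : differentiable mulc (row_mx x0 x0).
  apply: (@smooth_vec_diff _ _ _ 0%N (mul_chart_dom c0 c0 c0)) => //.
    exact: mul_chart_dom_open.
  exact: mul_chart_smooth.
split; first exact: d.
apply/matrixP => i j; apply: etrans (jacobian_partial i j d) _.
case: (split_ordP i) => k ->; rewrite ?col_mxEu ?col_mxEd.
  by apply: etrans (esym (right_frame_entry k j cx0)) _; rewrite right_frame0.
by apply: etrans (esym (frame_mx_entry dom1 k j cx0)) _; rewrite frame_mx0.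
Qed.

(** The factorisation [q, a] = q^-1 q^a gives differentiability. The Jacobian is read off from q
    [q, a] = q^a: the differential of multiplication at the identity pair is addition, so that of
    conjugation is 1 plus that of the commutator. *)
Lemma comm_chart_jacobian y : cod c0 y -> differentiable (comm_chart (psi c0 y)) x0 /\
  'J (comm_chart (psi c0 y)) x0 = right_frame y *m F0 y - 1%:M.
Proof.
move=> cy; set a := psi c0 y; have [dc Jc] := conj_chart_jacobian cy.
have cx0 := cod_x0 dom1; have [dm Jm] := mulc_jacobian; have di := inv_chart_diff.
have ix0 : inv_chart x0 = x0 by rewrite /inv_chart /= psi_x0 // invg1.
have near_dom (f : N -> N) : continuous f -> f 1%g = 1%g -> \forall x \near x0, dom c0 (f (psi c0 x)).
  move=> cf f1; apply: (open_near (open_cod_preimage (c := c0) (d := c0) cf)).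
    by split => //; rewrite psi_x0 // f1.
  by move=> x [].
have nc := near_dom _ (@group_conj_continuous a) (conj1g _).
have nk := near_dom _ (@group_comm_continuous a) (comm1g _).
have ni := near_dom _ (@lg_inv_continuous _ _ N) (@invg1 N).
have n0 : \forall x \near x0, cod c0 x by exact: (open_near (@cod_open _ _ N c0) cx0).
have near1 : \forall x \near x0,
    (mulc \o (fun x => row_mx (inv_chart x) (conj_chart a x))) x = comm_chart a x.
  apply: (@filterS _ _ (nbhs_filter x0) _ _ _ (filterI ni nc)) => x [dx1 dx2].
  by rewrite /mul_chart /= row_mxKl row_mxKr /inv_chart /conj_chart /= !chart_mapK.
have [dr _] := row_mx_differentiable di dc.
have dm' : differentiable mulc (row_mx (inv_chart x0) (conj_chart a x0)).
  by rewrite ix0 conj_chart_x0.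
have dk : differentiable (comm_chart a) x0.
  exact: differentiable_eq_near (differentiable_comp dr dm') near1.
split; first exact: dk.
have near2 : \forall x \near x0,
    (mulc \o (fun x => row_mx (id x) (comm_chart a x))) x = conj_chart a x.
  apply: (@filterS _ _ (nbhs_filter x0) _ _ _ nk) => x dx.
  by rewrite /mul_chart /= row_mxKl row_mxKr /comm_chart /conj_chart /= chart_mapK // commgEl mulgA mulgV mul1g.
have did : differentiable (id : 'rV[R]_n -> 'rV[R]_n) x0 by exact: ex_diff.
have [d2 J2] := row_mx_differentiable did dk.
have dm2 : differentiable mulc (row_mx (id x0) (comm_chart a x0)) by rewrite comm_chart_x0.
have H := jacobian_eq_near (differentiable_comp d2 dm2) dc near2.
have H2 := jacobian_comp d2 dm2.
have Jm2 : 'J mulc (row_mx (id x0) (comm_chart a x0)) = col_mx 1%:M 1%:M.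
  by rewrite comm_chart_x0; exact: Jm.
have J2' := etrans J2 (congr1 (fun A => row_mx A ('J (comm_chart a) x0)) (jacobian_id x0)).
exact: (mul_row_ones J2' Jm2 (etrans (etrans (esym H2) H) Jc)).
Qed.

Fixpoint comm_iter (s : seq N) x : 'rV[R]_n :=
  if s is a :: s' then comm_iter s' (comm_chart a x) else x.

Fixpoint group_comm_iter (s : seq N) (q : N) : N :=
  if s is a :: s' then group_comm_iter s' [~ q, a]%g else q.

Lemma group_comm_iter_lower_central s k q : @lower_central N k q ->
  @lower_central N (k + size s)%N (group_comm_iter s q).
Proof.
elim: s k q => [|a s IH] k q qk /=; first by rewrite addn0.
by rewrite addnS -addSn; apply: IH; apply: sub_gen_smallest; exists q, a.
Qed.

(** Chart expressions compose only while the intermediate commutators stay in the chart domain.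
    Every map involved fixes the identity, so this holds near [x0]. *)
Lemma comm_iter_near (l : seq 'rV[R]_n) : (forall y, y \in l -> cod c0 y) ->
  \forall x \near x0, comm_iter (map (psi c0) l) x = phi c0 (group_comm_iter (map (psi c0) l) (psi c0 x)).
Proof.
have cx0 := cod_x0 dom1.
elim: l => [|y l IH] ly /=.
  apply: (open_near (@cod_open _ _ N c0) cx0) => x cx; by have [] := chart_invK cx.
have cy : cod c0 y by apply: ly; rewrite mem_head.
have {}IH := IH (fun z zl => ly z (@mem_behead _ (y :: l) z zl)).
have [dk _] := comm_chart_jacobian cy.
have ck : {for x0, continuous (comm_chart (psi c0 y))} := differentiable_continuous dk.
have n1 : \forall x \near x0, comm_iter (map (psi c0) l) (comm_chart (psi c0 y) x) =
    phi c0 (group_comm_iter (map (psi c0) l) (psi c0 (comm_chart (psi c0 y) x))).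
  have := ck [set x | comm_iter (map (psi c0) l) x = phi c0 (group_comm_iter (map (psi c0) l) (psi c0 x))].
  by rewrite comm_chart_x0 => /(_ IH).
have n2 : \forall x \near x0, dom c0 [~ psi c0 x, psi c0 y]%g.
  apply: (open_near (open_cod_preimage (c := c0) (d := c0) (@group_comm_continuous (psi c0 y)))).
    by split => //; rewrite psi_x0 // comm1g.
  by move=> x [].
apply: (@filterS _ _ (nbhs_filter x0) _ _ _ (filterI n1 n2)) => x [-> dx].
by rewrite /comm_chart /= chart_mapK.
Qed.

Definition mx_prod (l : seq 'M[R]_n) : 'M[R]_n := foldr mulmx 1%:M l.

Definition ad_minus1 y : 'M[R]_n := right_frame y *m F0 y - 1%:M.

Lemma comm_iter_jacobian (l : seq 'rV[R]_n) : (forall y, y \in l -> cod c0 y) ->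
  differentiable (comm_iter (map (psi c0) l)) x0 /\
  'J (comm_iter (map (psi c0) l)) x0 = mx_prod (map ad_minus1 l).
Proof.
elim: l => [|y l IH] ly; first by split; [exact: ex_diff|exact: jacobian_id].
have cy : cod c0 y by apply: ly; rewrite mem_head.
have [dl Jl] := IH (fun z zl => ly z (@mem_behead _ (y :: l) z zl)).
have [dk Jk] := comm_chart_jacobian cy.
have dl' : differentiable (comm_iter (map (psi c0) l)) (comm_chart (psi c0 y) x0).
  by rewrite comm_chart_x0.
split; first exact: (differentiable_comp dk dl').
apply: etrans (jacobian_comp dk dl') _.
by rewrite comm_chart_x0 Jl Jk.
Qed.

(** By nilpotency the k-fold iterated commutator is constant, so its Jacobian, the product of these
    operators, vanishes. *)
Lemma ad_minus1_prod0 k (l : seq 'rV[R]_n) : @lower_central N k = [set 1%g] -> size l = k ->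
  (forall y, y \in l -> cod c0 y) -> mx_prod (map ad_minus1 l) = 0.
Proof.
move=> nil sl ly; have [d J] := comm_iter_jacobian ly.
have dc : differentiable (fun _ : 'rV[R]_n => x0) x0 := differentiable_cst x0 x0.
have nc : \forall x \near x0, comm_iter (map (psi c0) l) x = x0.
  apply: (@filterS _ _ (nbhs_filter x0) _ _ _ (comm_iter_near ly)) => x ->.
  have := @group_comm_iter_lower_central (map (psi c0) l) 0%N (psi c0 x) I.
  by rewrite size_map add0n sl nil => ->.
exact: etrans (esym J) (etrans (jacobian_eq_near d dc nc) (jacobian_cst x0 x0)).
Qed.

(** The sign comes from the convention q^a = a^-1 q a: the operator is the adjoint action of the
    inverse. *)
Lemma ad_minus1_derive (k : 'I_n) : dmx k ad_minus1 x0 /\ pmx k ad_minus1 x0 = - lie_bracket c0 k.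
Proof.
have cx0 := cod_x0 dom1.
have dR : dmx k right_frame x0 by have [] := right_frame_derive k k k.
have dE := frame_dmx dom1 (i := k) cx0.
have dF := coframe_dmx dom1 (i := k) cx0.
have [d1 e1] := pmx_mul dR dF.
have [d2 e2] := pmx_cst k (- 1%:M : 'M[R]_n) x0.
have [d3 e3] := pmx_add d1 d2.
split; first exact: d3.
apply: etrans e3 _; rewrite e1 e2 addr0 right_frame0 mul1mx coframe0 // mulmx1.
have z : pmx k F0 x0 = - pmx k E0 x0.
  have [_ e] := pmx_mul dF dE.
  have : pmx k (fun y => F0 y *m E0 y) x0 = 0.
    have [_ z] := pmx_cst k (1%:M : 'M[R]_n) x0.
    exact: etrans (pmx_eq_on k (N := fun=> 1%:M) (@cod_open _ _ N c0) (@coframeV _ _ N c0 dom1 c0) cx0) z.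
  by rewrite e frame_mx0 // coframe0 // mulmx1 mul1mx => /eqP; rewrite addr_eq0 => /eqP.
rewrite z; apply/matrixP => b i; have [_ e] := right_frame_derive k b i.
by rewrite [LHS]mxE e [X in _ + X]mxE [RHS]mxE [X in _ = - X]mxE opprB.
Qed.

(** A product vanishing for all [y] is differentiated at the identity in its single variable
    factor. *)
Lemma lie_bracket_prod_step (k : 'I_n) (X Y : 'M[R]_n) :
  (forall y, cod c0 y -> X *m ad_minus1 y *m Y = 0) -> X *m lie_bracket c0 k *m Y = 0.
Proof.
move=> H; have cx0 := cod_x0 dom1.
have [dB eB] := ad_minus1_derive k.
have [dX eX] := pmx_cst k X x0; have [dY eY] := pmx_cst k Y x0.
have [d1 e1] := pmx_mul dX dB; have [d2 e2] := pmx_mul d1 dY.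
have z : pmx k (fun y => X *m ad_minus1 y *m Y) x0 = 0.
  have [_ z] := pmx_cst k (0 : 'M[R]_n) x0.
  exact: etrans (pmx_eq_on k (N := fun=> 0) (@cod_open _ _ N c0) H cx0) z.
move: (etrans (esym e2) z).
rewrite e1 eX eY eB mul0mx add0r mulmx0 addr0 mulmxN mulNmx => /eqP.
by rewrite oppr_eq0 => /eqP.
Qed.

Lemma mx_prod_cat l1 l2 : mx_prod (l1 ++ l2) = mx_prod l1 *m mx_prod l2.
Proof. by elim: l1 => [|A l1 IH] /=; rewrite ?mul1mx // IH mulmxA. Qed.

Lemma lie_bracket_prod0 k (l : seq 'I_n) : @lower_central N k = [set 1%g] -> size l = k ->
  mx_prod (map (lie_bracket c0) l) = 0.
Proof.
move=> nil sl.
(* Mixed products, with brackets on the left and group operators on the right, allow the factors to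
   be converted one at a time from left to right. *)
suff H (l1 : seq 'I_n) (l2 : seq 'rV[R]_n) : (size l1 + size l2 = k)%N ->
    (forall y, y \in l2 -> cod c0 y) ->
    mx_prod (map (lie_bracket c0) l1) *m mx_prod (map ad_minus1 l2) = 0.
  by have := H l [::]; rewrite /= addn0 mulmx1; apply.
elim/last_ind: l1 l2 => [|l1 i IH] l2.
  by rewrite add0n mul1mx => sl2 l2c; exact: ad_minus1_prod0 nil sl2 l2c.
rewrite size_rcons => sz l2c.
rewrite map_rcons -cats1 mx_prod_cat /= mulmx1.
apply: lie_bracket_prod_step => y cy.
rewrite -mulmxA; apply: (IH (y :: l2)); first by rewrite /= -sz addSnnS.
by move=> z; rewrite inE => /predU1P[->//|]; exact: l2c.
Qed.

Lemma lie_bracket_unimodular : nilpotent_group N -> unimodular (lie_bracket c0).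
Proof.
move=> [k nil] a; apply: (@nilpotent_trace0 _ _ _ k).
have := @lie_bracket_prod0 k (nseq k a) nil (size_nseq k a).
suff -> : forall j, mx_prod (map (lie_bracket c0) (nseq j a)) = iter j (mulmx (lie_bracket c0 a)) 1%:M by [].
by elim=> [|j IH] //=; rewrite IH.
Qed.

(** The k-th power of ad_a ad_b is a product of 2 k brackets, whose first k factors already multiply
    to 0. *)
Lemma lie_bracket_killing : nilpotent_group N -> killing_null (lie_bracket c0).
Proof.
move=> [k nil] a b; apply: (@nilpotent_trace0 _ _ _ k).
pose l j : seq 'I_n := flatten (nseq j [:: a; b]).
have sl j : size (l j) = (j + j)%N by elim: j => //= j IH; rewrite IH addSn addnS.
have lE j : mx_prod (map (lie_bracket c0) (l j)) =
    iter j (mulmx (lie_bracket c0 a *m lie_bracket c0 b)) 1%:M.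
  by elim: j => [|j IH] //=; rewrite IH mulmxA.
rewrite -lE -(cat_take_drop k (l k)) map_cat mx_prod_cat.
rewrite (@lie_bracket_prod0 k (take k (l k)) nil) ?mul0mx //.
by rewrite size_take sl; case: ltnP => // h; apply/eqP; rewrite eqn_leq h leq_addr.
Qed.

End NilpotentBracket.

(** * Left-invariant metrics and their Ricci flow *)

Section Cholesky.
Context {R : rcfType}.

Definition pos_def {n} (P : 'M[R]_n) :=
  P^T = P /\ forall v : 'rV[R]_n, v != 0 -> 0 < (v *m P *m v^T) 0 0.

Lemma gram_ge0 {n} (v : 'rV[R]_n) : 0 <= (v *m v^T) 0 0.
Proof. by rewrite mxE; apply: sumr_ge0 => i _; rewrite mxE -expr2 sqr_ge0. Qed.

Lemma gram_gt0 {n} (v : 'rV[R]_n) : v != 0 -> 0 < (v *m v^T) 0 0.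
Proof.
rewrite lt_def gram_ge0 andbT; apply: contra => /eqP; rewrite mxE => h.
apply/eqP/rowP => i; rewrite mxE.
have /allP /(_ i) : all (fun j => true ==> ((fun j => v 0 j * v^T j 0) j == 0)) (index_enum 'I_n).
  by rewrite -psumr_eq0 ?h // => j _; rewrite mxE -expr2 sqr_ge0.
by rewrite mem_index_enum mxE mulf_eq0 orbb => /(_ isT)/eqP.
Qed.

(** Induction on the size: the top left entry [a] is positive, and the Schur complement D - a^-1 b^T
    b is again positive definite. *)
Lemma cholesky n (P : 'M[R]_n) : pos_def P -> exists Q : 'M[R]_n, P = Q *m Q^T.
Proof.
elim: n P => [|n IH] P [sP pP]; first by exists 0; apply/matrixP => -[].
pose A : 'M[R]_(1 + n) := P.
have sA : A^T = A := sP.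
pose b := ursubmx A; pose D := drsubmx A; pose a := A 0 0.
have ulE : ulsubmx A = a%:M.
  by apply/matrixP => i j; rewrite !ord1 !mxE eqxx mulr1n; congr (P _ _); apply/val_inj.
have dlE : dlsubmx A = b^T by rewrite /b trmx_ursub sA.
have sD : D^T = D by rewrite /D trmx_drsub sA.
have AE : A = block_mx a%:M b b^T D by rewrite -[A]submxK ulE dlE.
have form (t : 'rV[R]_1) (w : 'rV[R]_n) : (row_mx t w *m A *m (row_mx t w)^T) 0 0 =
    t 0 0 * a * t 0 0 + 2 * t 0 0 * (w *m b^T) 0 0 + (w *m D *m w^T) 0 0.
  rewrite AE mul_row_block tr_row_mx mul_row_col !mulmxDl.
  have e1 : (t *m a%:M *m t^T) 0 0 = t 0 0 * a * t 0 0.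
    by rewrite mul_mx_scalar -scalemxAl !mxE big_ord1 mxE; ring.
  have e2 : (w *m b^T *m t^T) 0 0 = t 0 0 * (w *m b^T) 0 0.
    by rewrite mxE big_ord1 [X in _ * X = _]mxE mulrC.
  have e3 : (t *m b *m w^T) 0 0 = t 0 0 * (w *m b^T) 0 0.
    have -> : (t *m b *m w^T) 0 0 = (t *m b *m w^T)^T 0 0 by rewrite [RHS]mxE.
    by rewrite !trmx_mul trmxK mulmxA e2.
  rewrite [LHS]mxE [X in X + _]mxE [X in _ + X]mxE e1 e2 e3; ring.
have a0 : 0 < a.
  have e1 : ((0 : 'rV[R]_n) *m b^T) 0 0 = 0 by rewrite mul0mx mxE.
  have e2 : ((0 : 'rV[R]_n) *m D *m (0 : 'rV[R]_n)^T) 0 0 = 0 by rewrite !mul0mx mxE.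
  have := pP (row_mx 1%:M 0); rewrite -/A form e1 e2 mulr0 !addr0.
  rewrite mxE eqxx !mul1r mulr1; apply.
  apply/eqP => h; have : lsubmx (row_mx (1%:M : 'M[R]_1) (0 : 'rV[R]_n)) = 0.
    by rewrite h linear0.
  by rewrite row_mxKl => /matrixP /(_ 0 0) /eqP; rewrite !mxE eqxx oner_eq0.
pose s := Num.sqrt a; have ss : s * s = a by rewrite -expr2 sqr_sqrtr // ltW.
have s0 : s != 0 by rewrite sqrtr_eq0 -ltNge.
have [|Q' hQ'] := IH (D - a^-1 *: (b^T *m b)).
  split; first by rewrite linearB /= linearZ /= trmx_mul trmxK sD.
  (* This first coordinate minimises the form over extensions of [w], and the minimum is the form of
     the Schur complement at [w]. *)
  move=> w w0; pose y := (w *m b^T) 0 0; pose t : 'rV[R]_1 := (- (a^-1 * y))%:M.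
  have n0 : row_mx t w != 0.
    by apply: contra w0 => /eqP h; rewrite -(row_mxKr t w) h linear0.
  have := pP _ n0; rewrite -/A form -/y.
  have -> : t 0 0 = - (a^-1 * y) by rewrite mxE eqxx mulr1n.
  have -> : (w *m (D - a^-1 *: (b^T *m b)) *m w^T) 0 0 = (w *m D *m w^T) 0 0 - a^-1 * (y * y).
    rewrite mulmxBr mulmxBl -scalemxAr -scalemxAl [LHS]mxE [X in _ + X]mxE [X in _ - X]mxE.
    congr (_ - _ * _).
    have -> : w *m (b^T *m b) *m w^T = (w *m b^T) *m (b *m w^T) by rewrite !mulmxA.
    rewrite mxE big_ord1; congr (_ * _).
    have -> : (b *m w^T) 0 0 = (b *m w^T)^T 0 0 by rewrite [RHS]mxE.
    by rewrite trmx_mul trmxK.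
  by congr (0 < _); field; rewrite gt_eqF.
pose Q : 'M[R]_(1 + n) := block_mx s%:M 0 (s^-1 *: b^T) Q'.
exists Q; change (A = Q *m Q^T); rewrite AE /Q tr_block_mx mulmx_block trmx0 !mul0mx !addr0 mulmx0 addr0 -hQ'.
rewrite tr_scalar_mx -scalar_mxM ss linearZ /= trmxK.
rewrite mul_scalar_mx mul_mx_scalar !scalerA mulfV // !scale1r.
rewrite -scalemxAl -scalemxAr scalerA -invfM ss.
by rewrite addrCA subrr addr0.
Qed.

End Cholesky.

(** * Curvature of a metric with an orthonormal frame *)

Section CurvatureLocality.
Context {R : realType} {n : nat}.

Lemma christoffel_eq_on (U : set 'rV[R]_n) (g h : 'rV[R]_n -> 'M[R]_n) k i j x :
  open U -> (forall y, U y -> g y = h y) -> U x -> christoffel g k i j x = christoffel h k i j x.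
Proof.
move=> oU gh Ux; rewrite /christoffel (gh x Ux); congr (_ * _); apply: eq_bigr => l _.
have E a b e : partial e (fun y => g y a b) x = partial e (fun y => h y a b) x.
  by apply: (partial_eq_on _ oU _ Ux) => y Uy; rewrite gh.
by rewrite (E j l i) (E i l j) (E i j l).
Qed.

Lemma riemann_eq_on (U : set 'rV[R]_n) (g h : 'rV[R]_n -> 'M[R]_n) l k i j x :
  open U -> (forall y, U y -> g y = h y) -> U x -> riemann g l k i j x = riemann h l k i j x.
Proof.
move=> oU gh Ux.
have C a b e y : U y -> christoffel g a b e y = christoffel h a b e y.
  by move=> Uy; exact: christoffel_eq_on oU gh Uy.
have D a b e f : partial f (christoffel g a b e) x = partial f (christoffel h a b e) x.
  by apply: (partial_eq_on _ oU _ Ux) => y Uy; exact: C.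
rewrite /riemann (D l j k i) (D l i k j); congr (_ + _); apply: eq_bigr => m _.
by rewrite (C l i m x Ux) (C m j k x Ux) (C l j m x Ux) (C m i k x Ux).
Qed.

End CurvatureLocality.

(** Contracts one pair of coordinate indices against the Gram matrix [M]: in a basis [B] orthonormal
    for [M] it becomes a plain sum over one frame index. [J] collects the frame indices already
    obtained. *)
Lemma frame_contract {R : realType} {n : nat} (J : finType) (M B : 'M[R]_n) (a : R)
    (x y : J * 'I_n -> R) : B^T *m M *m B = 1%:M ->
  \sum_i \sum_i' a * M i i' *
     (\sum_(e : J) (\sum_d B i d * x (e, d)) * (\sum_d B i' d * y (e, d)))
  = a * \sum_(p : J * 'I_n) x p * y p.
Proof.
move=> BMB; have -> : \sum_(p : J * 'I_n) x p * y p = \sum_e \sum_d x (e, d) * y (e, d).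
  by rewrite pair_bigA /=; apply: eq_bigr => -[].
transitivity (a * \sum_e \sum_i \sum_i' M i i' * ((\sum_d B i d * x (e, d)) * (\sum_d B i' d * y (e, d)))).
  rewrite [X in _ = a * X]exchange_big mulr_sumr; apply: eq_bigr => i _ /=.
  rewrite [X in _ = a * X]exchange_big mulr_sumr; apply: eq_bigr => i' _ /=.
  by rewrite !mulr_sumr; apply: eq_bigr => e _; rewrite -[LHS]mulrA.
congr (_ * _); apply: eq_bigr => e _.
transitivity (\sum_d \sum_d' x (e, d) * y (e, d') * (B^T *m M *m B) d d').
  under eq_bigr => i _ do under eq_bigr => i' _ do rewrite mulr_suml mulr_sumr.
  under eq_bigr => i _ do rewrite exchange_big /=.
  rewrite exchange_big; apply: eq_bigr => d _ /=.
  under eq_bigr => i _ do under eq_bigr => i' _ do rewrite mulr_sumr mulr_sumr.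
  under eq_bigr => i _ do rewrite exchange_big /=.
  rewrite exchange_big; apply: eq_bigr => d' _ /=.
  rewrite exchange_big mxE mulr_sumr; apply: eq_bigr => i' _ /=.
  rewrite mxE mulr_suml mulr_sumr; apply: eq_bigr => i _.
  by rewrite [B^T d i]mxE; ring.
rewrite BMB; apply: eq_bigr => d _; rewrite (bigD1 d) //= big1 => [|d' /negPf dd].
  by rewrite mxE eqxx mulr1 addr0.
by rewrite mxE eq_sym dd mulr0.
Qed.

Section OrthonormalFrame.
Context {R : realType} {n : nat}.
Variables (U : set 'rV[R]_n) (F E : 'rV[R]_n -> 'M[R]_n) (c : 'I_n -> 'M[R]_n)
  (g : 'rV[R]_n -> 'M[R]_n).
Hypotheses (oU : open U)
  (sF : forall i j, Ck_on 2 U (fun x => F x i j))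
  (sE : forall i j, Ck_on 1 U (fun x => E x i j))
  (FE : forall x, U x -> F x *m E x = 1%:M)
  (mc : forall x, U x -> forall k i a,
     pmx k F x i a - pmx i F x k a = - \sum_b \sum_d F x k b * F x i d * c b d a)
  (gF : forall x, U x -> g x = F x *m (F x)^T).

Lemma riemann_orthonormal l k i j x : U x -> riemann g l k i j x =
  \sum_d \sum_e F x i d * F x j e * (F x *m frame_curvature c d e *m E x) k l.
Proof.
move=> Ux; rewrite (riemann_eq_on l k i j oU gF Ux).
exact: (riemann_frame oU sF sE FE mc).
Qed.

Lemma ricci_orthonormal x : bracket_anti c -> unimodular c -> killing_null c -> U x ->
  ricci g x = F x *m ricci_form c *m (F x)^T.
Proof.
move=> anti uni kil Ux; have EF := mulmx1C (FE Ux); apply/matrixP => j k; rewrite [LHS]mxE.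
transitivity (\sum_e \sum_d F x j e * (F x *m frame_curvature c d e) k d).
  transitivity (\sum_d \sum_e F x j e * (F x *m frame_curvature c d e *m E x *m F x) k d).
    under eq_bigr => i _ do rewrite riemann_orthonormal //.
    rewrite exchange_big; apply: eq_bigr => d _ /=.
    rewrite exchange_big; apply: eq_bigr => e _ /=.
    by rewrite [X in _ = _ * X]mxE mulr_sumr; apply: eq_bigr => i _; ring.
  rewrite exchange_big; apply: eq_bigr => e _ /=; apply: eq_bigr => d _.
  by rewrite -[_ *m E x *m F x]mulmxA EF mulmx1.
rewrite -mulmxA mxE; apply: eq_bigr => e _; rewrite -mulr_sumr; congr (_ * _).
rewrite mxE; under eq_bigr => d _ do rewrite mxE.
rewrite exchange_big /=; apply: eq_bigr => f _.
by rewrite -mulr_sumr (ricci_trace _ _ anti uni kil) mulrC [X in _ = _ * X]mxE.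
Qed.

(** In the orthonormal frame the norm is the Euclidean norm of n^4 components, each at most 6 n u;
    the root of n^4 supplies the other factor n^2. *)
Lemma riemann_norm_orthonormal x : bracket_anti c -> U x ->
  riemann_norm g x <= 6 * n%:R ^+ 3 * bracket_norm c.
Proof.
move=> anti Ux; have EF := mulmx1C (FE Ux).
have giE : invmx (g x) = (E x)^T *m E x by rewrite gF // (frame_gram_inv FE).
(* From [K] to [Y] the frame components are converted to coordinates one index at a time, and
   [frame_contract] undoes this in the reverse order. The factor [unit] seeds the index type for the
   first of its four uses. *)
pose K (p : unit * 'I_n * 'I_n * 'I_n) f := frame_curvature c p.1.2 p.1.1.2 p.2 f.
pose V (p : unit * 'I_n * 'I_n * 'I_n) l := \sum_f (E x)^T l f * K p f.
pose Z (p : unit * 'I_n * 'I_n) l k := \sum_h F x k h * V (p, h) l.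
pose Y (p : unit * 'I_n) l k i := \sum_d F x i d * Z (p, d) l k.
have RE l k i j : riemann g l k i j x = \sum_e F x j e * Y (tt, e) l k i.
  rewrite riemann_orthonormal // exchange_big; apply: eq_bigr => e _ /=.
  rewrite mulr_sumr; apply: eq_bigr => d _.
  have -> : (F x *m frame_curvature c d e *m E x) k l = Z (tt, e, d) l k.
    rewrite mxE /Z; under eq_bigr => f _ do rewrite mxE mulr_suml.
    rewrite exchange_big; apply: eq_bigr => h _ /=; rewrite /V mulr_sumr.
    by apply: eq_bigr => f _; rewrite [(E x)^T l f]mxE /K /=; ring.
  by ring.
have cF : (F x)^T *m invmx (g x) *m F x = 1%:M.
  by rewrite giE mulmxA -trmx_mul EF trmx1 mul1mx EF.
have cE : ((E x)^T)^T *m g x *m (E x)^T = 1%:M.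
  by rewrite trmxK gF // mulmxA EF mul1mx -trmx_mul EF trmx1.
pose n4 := \sum_(p : unit * 'I_n * 'I_n * 'I_n * 'I_n) K p.1 p.2 * K p.1 p.2.
have unit_sum (f : unit -> R) : \sum_e f e = f tt.
  by rewrite (bigD1 tt) //= big1 ?addr0 // => -[].
have normE : riemann_norm g x = Num.sqrt n4.
  rewrite /riemann_norm; congr Num.sqrt.
  transitivity (\sum_l \sum_l' \sum_k \sum_k' \sum_i \sum_i'
      g x l l' * invmx (g x) k k' * invmx (g x) i i' *
      \sum_(p : unit * 'I_n) Y p l k i * Y p l' k' i').
    apply: eq_bigr => l _; apply: eq_bigr => l' _; apply: eq_bigr => k _.
    apply: eq_bigr => k' _; apply: eq_bigr => i _; apply: eq_bigr => i' _.
    apply: etrans _ (frame_contract _ (fun p => Y p l k i) (fun p => Y p l' k' i') cF).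
    apply: eq_bigr => j _; apply: eq_bigr => j' _.
    by rewrite unit_sum !RE -mulrA.
  transitivity (\sum_l \sum_l' \sum_k \sum_k' g x l l' * invmx (g x) k k' *
      \sum_(p : unit * 'I_n * 'I_n) Z p l k * Z p l' k').
    apply: eq_bigr => l _; apply: eq_bigr => l' _; apply: eq_bigr => k _; apply: eq_bigr => k' _.
    exact: (frame_contract _ (fun p => Z p l k) (fun p => Z p l' k') cF).
  transitivity (\sum_l \sum_l' g x l l' *
      \sum_(p : unit * 'I_n * 'I_n * 'I_n) V p l * V p l').
    apply: eq_bigr => l _; apply: eq_bigr => l' _.
    exact: (frame_contract _ (fun p => V p l) (fun p => V p l') cF).
  rewrite /n4 -[RHS]mul1r.
  apply: etrans _ (frame_contract 1 (fun p => K p.1 p.2) (fun p => K p.1 p.2) cE).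
  by apply: eq_bigr => l _; apply: eq_bigr => l' _; rewrite mul1r.
rewrite normE -(@ger0_norm _ (6 * n%:R ^+ 3 * bracket_norm c)); last first.
  by rewrite !mulr_ge0 ?exprn_ge0 // bracket_norm_ge0.
rewrite -sqrtr_sqr ler_sqrt ?sqr_ge0 //.
apply: (@le_trans _ _ (\sum_(p : unit * 'I_n * 'I_n * 'I_n * 'I_n) (6 * n%:R * bracket_norm c) ^+ 2)).
  apply: ler_sum => p _; rewrite -expr2 -(real_normK (num_real (K _ _))).
  by rewrite lerXn2r ?nnegrE ?mulr_ge0 ?bracket_norm_ge0 // frame_curvature_le.
rewrite sumr_const !card_prod card_unit !card_ord mul1n -[leLHS]mulr_natl !natrM le_eqVlt.
by apply/orP; left; apply/eqP; ring.
Qed.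

End OrthonormalFrame.

(** * One-sided difference quotients in time *)

Section TimeDerivative.
Context {R : realType}.
Implicit Types (f : R -> R).

Lemma is_derive_quotient f (t D : R) : is_derive t 1 f D ->
  h^-1 * (f (t + h) - f t) @[h --> within [set h | 0 <= t + h] 0^'] --> D.
Proof.
move=> [df <-]; apply: cvg_trans; first by apply: cvg_app; exact: cvg_within.
have E : (fun h : R => h^-1 * (f (t + h) - f t)) = (fun h : R => h^-1 *: ((f \o shift t) (h *: 1) - f t)).
  by apply/funext => h /=; rewrite [h%:A]mulr1 [t + h]addrC.
by rewrite E; exact: df.
Qed.

(** At a positive time the constraint [0 <= t + h] holds for all small [h], so the restricted limit
    is the full one. *)
Lemma quotient_is_derive f (t D : R) : 0 < t ->
  h^-1 * (f (t + h) - f t) @[h --> within [set h | 0 <= t + h] 0^'] --> D ->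
  is_derive t 1 f D.
Proof.
move=> t0 H.
have E : (fun h : R => h^-1 * (f (t + h) - f t)) = (fun h : R => h^-1 *: ((f \o shift t) (h *: 1) - f t)).
  by apply/funext => h /=; rewrite [h%:A]mulr1 [t + h]addrC.
have c : h^-1 *: ((f \o shift t) (h *: 1) - f t) @[h --> 0^'] --> D.
  rewrite -E => A hA.
  have nA : \forall h \near (0 : R)^', 0 <= t + h -> A (h^-1 * (f (t + h) - f t)) := H A hA.
  change (\forall h \near (0 : R)^', A (h^-1 * (f (t + h) - f t))).
  have pos : \forall h \near (0 : R)^', 0 <= t + h.
    apply: nbhs_dnbhs; apply/nbhs_ballP; exists t => //= h.
    by rewrite /ball /= sub0r normrN => /ltW; rewrite ler_norml => /andP[]; lra.
  by apply: (@filterS _ _ (dnbhs_filter (0 : R)) _ _ _ (filterI nA pos)) => h [h1 h2]; exact: h1 h2.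
split; first by apply/cvg_ex; exists D.
exact: cvg_lim.
Qed.

(** A flow says nothing about negative times, so only its even reflection can be claimed continuous
    at 0. *)
Lemma quotient_continuous0 f (D : R) :
  h^-1 * (f (0 + h) - f 0) @[h --> within [set h : R | 0 <= 0 + h] (0 : R)^'] --> D ->
  {for 0, continuous (fun s : R => f `|s|)}.
Proof.
move=> H; apply/cvgrPdist_lt => e e0; rewrite normr0.
have n1 : \forall h \near within [set h : R | 0 <= 0 + h] (0 : R)^',
    `|D - h^-1 * (f (0 + h) - f 0)| < 1.
  by have /cvgrPdist_lt := H; apply.
have {n1} [r /= r0 hr] := (nbhs_ballP _ _).1 n1.
pose M := `|D| + 1; have M0 : 0 < M by rewrite ltr_wpDl.
have q0 : 0 < Num.min r (e / M) by rewrite lt_min r0 divr_gt0.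
apply/nbhs_ballP; exists (Num.min r (e / M)) => //= s.
rewrite /ball /= sub0r normrN lt_min => /andP[sr sM].
have [->|s0] := eqVneq s 0; first by rewrite normr0 subrr normr0.
have as0 : 0 < `|s| by rewrite normr_gt0.
have h1 : `|D - `|s|^-1 * (f (0 + `|s|) - f 0)| < 1.
  apply: hr; [by rewrite /ball /= sub0r normrN normr_id| by rewrite gt_eqF|by rewrite /= add0r].
move: h1; rewrite add0r; set q := _^-1 * _ => h1.
have -> : f 0 - f `|s| = - (`|s| * q) by rewrite /q mulVKf ?gt_eqF // opprB.
rewrite normrN normrM normr_id; apply: (@le_lt_trans _ _ (`|s| * M)).
  rewrite ler_wpM2l // /M -[q](subrK D) addrC.
  by rewrite (le_trans (ler_normD _ _)) // lerD2l distrC ltW.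
by rewrite -ltr_pdivlMr.
Qed.

End TimeDerivative.

Lemma equivariant_inverse {R : comPzRingType} {n} (E1 E2 F1 F2 J : 'M[R]_n) :
  E2 = E1 *m J -> F1 *m E1 = 1%:M -> E2 *m F2 = 1%:M -> J *m F2 = F1.
Proof.
by move=> e FE EF; rewrite -[LHS]mul1mx -FE -!mulmxA [E1 *m _]mulmxA -e EF mulmx1.
Qed.

(** The structure equation under a constant change of coframe. [T k] stands for the derivative of
    the coframe in direction k, which a constant [Q] simply multiplies. *)
Lemma frame_change {R : realType} {n} (F Q S : 'M[R]_n) (T C : 'I_n -> 'M[R]_n) :
  (forall k i a, T k i a - T i k a = - \sum_b \sum_d F k b * F i d * C b d a) ->
  Q *m S = 1%:M ->
  forall k i a, (T k *m Q) i a - (T i *m Q) k a =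
    - \sum_b \sum_d (F *m Q) k b * (F *m Q) i d * frame_bracket S Q C b d a.
Proof.
move=> mc QS k i a.
have scaleE r (M : 'M[R]_n) d j : (r *: M) d j = r * M d j by rewrite mxE.
transitivity (- (F *m (\sum_b F k b *: C b) *m Q) i a).
  rewrite !mxE -sumrB -sumrN; apply: eq_bigr => j _.
  rewrite -mulrBl mc -mulNr; congr (- _ * _); rewrite mxE exchange_big.
  apply: eq_bigr => d _ /=; rewrite summxE mulr_sumr; apply: eq_bigr => b _.
  by rewrite scaleE; ring.
congr (- _).
transitivity ((F *m Q *m (\sum_b (F *m Q) k b *: frame_bracket S Q C b)) i a).
  have -> : \sum_b (F *m Q) k b *: frame_bracket S Q C b = \sum_d F k d *: (S *m C d *m Q).
    rewrite /frame_bracket; under eq_bigr => b _ do rewrite scaler_sumr.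
    rewrite exchange_big; apply: eq_bigr => d _ /=.
    under eq_bigr => b _ do rewrite scalerA.
    rewrite -scaler_suml; congr (_ *: _).
    by rewrite -[F in RHS]mulmx1 -QS mulmxA [RHS]mxE.
  congr (fun_of_matrix _ i a).
  rewrite mulmx_sumr mulmx_suml mulmx_sumr; apply: eq_bigr => d _.
  by rewrite -!scalemxAr -scalemxAl !mulmxA -[_ *m Q *m S]mulmxA QS mulmx1.
rewrite mxE exchange_big; apply: eq_bigr => d _ /=; rewrite summxE mulr_sumr.
by apply: eq_bigr => b _; rewrite scaleE; ring.
Qed.

Section LeftInvariantMetrics.
Context {R : realType} {n : nat} (N : lie_group R n).

Local Notation idx := (chart_index (lg_atlas N)).
Local Notation dom c := (chart_dom (lg_atlas N c)).
Local Notation phi c := (chart_map (lg_atlas N c)).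
Local Notation psi c := (chart_inv (lg_atlas N c)).
Local Notation cod c := (chart_cod (lg_atlas N c)).

Variable c0 : idx.
Hypothesis dom1 : dom c0 1%g.

Local Notation x0 := (phi c0 1%g).
Local Notation F := (coframe c0).
Local Notation C := (lie_bracket c0).

(** The left-invariant tensor whose Gram matrix at the identity is [P], spread by the coframe. *)
Definition invariant_field (P : 'M[R]_n) : tensor_field N :=
  fun c x => F c x *m P *m (F c x)^T.

Lemma coframe_equivariant c d (a : N) x : left_dom c d a x ->
  'J (left_chart c d a) x *m F d (left_chart c d a x) = F c x.
Proof.
move=> dx; have [cx dax] := dx.
have cy : cod d (left_chart c d a x) by exact: chart_mapP.
exact: equivariant_inverse (frame_mx_equivariant dom1 dx) (coframeV dom1 cx) (frameV dom1 cy).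
Qed.

Lemma invariant_field_left_invariant P : left_invariant (invariant_field P).
Proof.
move=> a c d p dp dap.
have cx : left_dom c d a (phi c p).
  by split; [exact: chart_mapP|rewrite chart_mapK].
have e : left_chart c d a (phi c p) = phi d (a * p)%g by rewrite /left_chart /= chart_mapK.
rewrite /invariant_field -(coframe_equivariant cx) e trmx_mul !mulmxA.
by [].
Qed.

Lemma pullback_id (g : tensor_field N) : left_invariant g -> pullback_invariant id g.
Proof.
move=> /(_ 1%g) H c d p dp dp'.
have e : (fun p : N => (1 * p)%g) = id by apply/funext => q; rewrite mul1g.
by move: H; rewrite e => /(_ c d p dp dp').
Qed.

Lemma invariant_field_riemannian (Q S : 'M[R]_n) : Q *m S = 1%:M ->
  riemannian_metric (invariant_field (Q *m Q^T)).
Proof.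
move=> QS; split.
- exact/pullback_id/invariant_field_left_invariant.
- by move=> c x cx; rewrite /invariant_field !trmx_mul !trmxK !mulmxA.
- move=> c x cx v v0.
  have -> : v *m invariant_field (Q *m Q^T) c x *m v^T = (v *m F c x *m Q) *m (v *m F c x *m Q)^T.
    by rewrite /invariant_field !trmx_mul !mulmxA.
  apply: gram_gt0; apply: contra v0 => /eqP h; apply/eqP.
  have {}h : v *m F c x = 0 by rewrite -[LHS]mulmx1 -QS mulmxA h mul0mx.
  by rewrite -[v]mulmx1 -(coframeV dom1 cx) mulmxA h mul0mx.
- move=> c i j k.
  apply: (@Ck_on_eq _ _ _ _ (fun x => \sum_l (\sum_m F c x i m * (Q *m Q^T) m l) * F c x j l)).
  + exact: cod_open.
  + move=> x _; rewrite [RHS]mxE; apply: eq_bigr => l _.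
    by rewrite [X in _ = _ * X]mxE; congr (_ * _); rewrite mxE.
  apply: Ck_on_sum; first exact: cod_open.
  move=> l; apply: Ck_on_mul; [exact: cod_open| |exact: coframe_smooth].
  apply: Ck_on_sum; first exact: cod_open.
  move=> m; apply: Ck_on_mul; [exact: cod_open|exact: coframe_smooth|exact: Ck_on_cst].
Qed.

Lemma left_invariant_gram (g : tensor_field N) c x : left_invariant g -> cod c x ->
  g c x = invariant_field (g c0 x0) c x.
Proof.
move=> li cx; have [dx ex] := chart_invK cx.
have := li (psi c x) c0 c 1%g dom1; rewrite mulg1 => /(_ dx).
rewrite -/(frame_mx c0 c x) ex => ->.
have FE := coframeV dom1 cx.
by rewrite /invariant_field !mulmxA FE mul1mx -mulmxA -trmx_mul FE trmx1 mulmx1.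
Qed.

Lemma riemannian_pos_def (g : tensor_field N) : riemannian_metric g -> pos_def (g c0 x0).
Proof.
move=> [_ sg pg _]; have cx := cod_x0 dom1.
by split; [exact: sg|exact: pg].
Qed.

Section Curvature.
Variables (Q S : 'M[R]_n) (g : 'rV[R]_n -> 'M[R]_n) (c : idx).
Hypotheses (QS : Q *m S = 1%:M)
  (gE : forall x, cod c x -> g x = invariant_field (Q *m Q^T) c x).

Let FQ x := F c x *m Q.
Let SE x := S *m frame_mx c0 c x.
Let k := frame_bracket S Q C.

Lemma FQ_smooth i j : Ck_on 2 (cod c) (fun x => FQ x i j).
Proof.
apply: (@Ck_on_eq _ _ _ _ (fun x => \sum_l F c x i l * Q l j)).
- exact: cod_open.
- by move=> x _; rewrite mxE.
apply: Ck_on_sum; first exact: cod_open.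
by move=> l; apply: Ck_on_mul; [exact: cod_open|exact: coframe_smooth|exact: Ck_on_cst].
Qed.

Lemma SE_smooth i j : Ck_on 1 (cod c) (fun x => SE x i j).
Proof.
apply: (@Ck_on_eq _ _ _ _ (fun x => \sum_l S i l * frame_mx c0 c x l j)).
- exact: cod_open.
- by move=> x _; rewrite mxE.
apply: Ck_on_sum; first exact: cod_open.
by move=> l; apply: Ck_on_mul; [exact: cod_open|exact: Ck_on_cst|exact: frame_mx_smooth].
Qed.

Lemma FQ_SE x : cod c x -> FQ x *m SE x = 1%:M.
Proof.
by move=> cx; rewrite /FQ /SE mulmxA -[_ *m Q *m S]mulmxA QS mulmx1 coframeV.
Qed.

Lemma FQ_maurer_cartan x : cod c x -> forall l i a,
  pmx l FQ x i a - pmx i FQ x l a = - \sum_b \sum_d FQ x l b * FQ x i d * k b d a.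
Proof.
move=> cx l i a.
have dQ j : pmx j FQ x = pmx j (F c) x *m Q.
  have [d e] := pmx_cst j Q x.
  by have [_ ->] := pmx_mul (coframe_dmx dom1 (i := j) cx) d; rewrite e mulmx0 addr0.
rewrite !dQ; exact: frame_change (coframe_maurer_cartan dom1 cx) QS l i a.
Qed.

Lemma invariant_gram x : cod c x -> g x = FQ x *m (FQ x)^T.
Proof. by move=> cx; rewrite gE // /invariant_field /FQ trmx_mul !mulmxA. Qed.

Lemma invariant_ricci x : nilpotent_group N -> cod c x ->
  ricci g x = invariant_field (Q *m ricci_form k *m Q^T) c x.
Proof.
move=> nil cx.
have anti := frame_bracket_anti S Q (@lie_bracket_anti _ _ N c0).
have uni := frame_bracket_unimodular QS (lie_bracket_unimodular dom1 nil).
have kil := frame_bracket_killing QS (lie_bracket_killing dom1 nil).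
rewrite (ricci_orthonormal (@cod_open _ _ N c) FQ_smooth SE_smooth FQ_SE FQ_maurer_cartan
  invariant_gram anti uni kil cx).
by rewrite /FQ /invariant_field trmx_mul !mulmxA.
Qed.

Lemma invariant_riemann_norm x : cod c x ->
  riemann_norm g x <= 6 * n%:R ^+ 3 * bracket_norm k.
Proof.
move=> cx; have anti := frame_bracket_anti S Q (@lie_bracket_anti _ _ N c0).
exact: (riemann_norm_orthonormal (@cod_open _ _ N c) FQ_smooth SE_smooth FQ_SE FQ_maurer_cartan
  invariant_gram anti cx).
Qed.

End Curvature.

End LeftInvariantMetrics.

Lemma pos_def_factor {R : rcfType} {n} (P : 'M[R]_n) : pos_def P ->
  exists Q S : 'M[R]_n, P = Q *m Q^T /\ Q *m S = 1%:M.
Proof.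
move=> pP; have [Q PE] := cholesky pP; exists Q, (invmx Q); split=> //.
apply: mulmxV; rewrite -row_free_unit -kermx_eq0; apply/rowV0P => v /sub_kermxP vQ.
apply/eqP; apply: contraT => v0; have [_ /(_ v v0)] := pP.
by rewrite PE mulmxA vQ !mul0mx mxE ltxx.
Qed.

Lemma gram_inverse {R : comPzRingType} {n} (Q S : 'M[R]_n) : Q *m S = 1%:M ->
  (Q *m Q^T) *m (S^T *m S) = 1%:M.
Proof.
move=> QS; have SQ := mulmx1C QS.
by rewrite -mulmxA [Q^T *m _]mulmxA -trmx_mul SQ trmx1 mul1mx.
Qed.

Lemma invmx_unique {R : comUnitRingType} {n} (A B : 'M[R]_n) : A *m B = 1%:M -> invmx A = B.
Proof. by move=> AB; have [uA _] := mulmx1_unit AB; rewrite -[B]mul1mx -(mulVmx uA) -mulmxA AB mulmx1. Qed.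

Lemma mx_derive_continuous {R : realType} {p q} (M : R -> 'M[R]_(p, q)) t D : mx_derive M t D ->
  forall i j, {for t, continuous (fun s => M s i j)}.
Proof. by move=> dM i j; exact: is_derive_continuous (dM i j). Qed.

Section RicciFlowOfInvariantMetrics.
Context {R : realType} {n : nat} (N : lie_group R n).

Local Notation idx := (chart_index (lg_atlas N)).
Local Notation dom c := (chart_dom (lg_atlas N c)).
Local Notation phi c := (chart_map (lg_atlas N c)).
Local Notation cod c := (chart_cod (lg_atlas N c)).

Variable c0 : idx.
Hypothesis dom1 : dom c0 1%g.
Hypothesis nil : nilpotent_group N.

Local Notation x0 := (phi c0 1%g).
Local Notation C := (lie_bracket c0).
Local Notation ric Q S := (ricci_form (frame_bracket S Q C)).

Lemma invariant_field0 P : invariant_field c0 P c0 x0 = P.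
Proof. by rewrite /invariant_field (coframe0 dom1) trmx1 mulmx1 mul1mx. Qed.

Lemma gram_derive (Q : R -> 'M[R]_n) t r : r^T = r -> mx_derive Q t (- (Q t *m r)) ->
  mx_derive (fun s => Q s *m (Q s)^T) t (- 2 *: (Q t *m r *m (Q t)^T)).
Proof.
move=> sr dQ; apply: (mx_derive_eq (mx_derive_mul dQ (mx_derive_tr dQ))).
rewrite linearN /= trmx_mul sr mulNmx mulmxN mulmxA -opprD.
by rewrite scaleNr; congr (- _); rewrite scaler_nat mulr2n.
Qed.

Lemma invariant_field_derive (P : R -> 'M[R]_n) t D c x : mx_derive P t D ->
  mx_derive (fun s => invariant_field c0 (P s) c x) t (invariant_field c0 D c x).
Proof.
move=> dP; apply: (mx_derive_eq (mx_derive_mul (mx_derive_mul (mx_derive_cst _ _) dP) (mx_derive_cst _ _))).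
by rewrite mul0mx add0r mulmx0 addr0.
Qed.

(** Reads the flow equation at the identity as an equation for the Gram matrix alone. A
    factorisation of that matrix is chosen here, and [gram_ricciE] removes the choice from the
    result. *)
Lemma ricci_at_unit (g : tensor_field N) W : riemannian_metric g -> left_invariant g ->
  W = invmx (g c0 x0) -> ricci (g c0) x0 = gram_ricci C (g c0 x0) W.
Proof.
move=> rg lg ->; have [Q [S [PE QS]]] := pos_def_factor (riemannian_pos_def dom1 rg).
have gE x : cod c0 x -> g c0 x = invariant_field c0 (Q *m Q^T) c0 x.
  by move=> cx; rewrite -PE; exact: left_invariant_gram.
rewrite (invariant_ricci dom1 QS gE nil (cod_x0 dom1)) invariant_field0 gram_ricciE //.
by rewrite PE (invmx_unique (gram_inverse QS)).
Qed.

Section FrameSolution.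
Variables Q S : R -> 'M[R]_n.
Hypothesis QS : forall t : R, 0 <= t -> Q t *m S t = 1%:M.
Hypothesis dQ : forall t : R, 0 <= t -> mx_derive Q t (- (Q t *m ric (Q t) (S t))).
Hypothesis dS : forall t : R, 0 <= t -> mx_derive S t (ric (Q t) (S t) *m S t).

Local Notation P t := (Q t *m (Q t)^T).
Local Notation G := (fun t => invariant_field c0 (P t)).

Lemma frame_solution_ricci_flow : ricci_flow +oo%E G.
Proof.
move=> t t0 _; split; first exact: invariant_field_riemannian (QS t0).
move=> c x i j cx.
have e := invariant_ricci dom1 (QS t0) (fun _ _ => erefl) nil cx.
have d := invariant_field_derive c x (gram_derive (ricci_form_sym _) (dQ t0)).
have -> : - 2 * ricci (invariant_field c0 (P t) c) x i j =
    invariant_field c0 (- 2 *: (Q t *m ric (Q t) (S t) *m (Q t)^T)) c x i j.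
  rewrite e /invariant_field -scalemxAr -scalemxAl.
  by rewrite [RHS]mxE.
exact: is_derive_quotient (d i j).
Qed.

Lemma frame_solution_norm (t : R) : 0 < t ->
  riemann_norm_le (G t) (6 * n%:R ^+ 3 * (2 * n.+1%:R) / t).
Proof.
move=> t0 c x cx; have t0' := ltW t0.
apply: le_trans (invariant_riemann_norm dom1 (QS t0') (fun _ _ => erefl) cx) _.
rewrite -[leRHS]mulrA ler_wpM2l ?mulr_ge0 ?exprn_ge0 //.
apply: (frame_norm_decay (@lie_bracket_anti _ _ N c0)) => //; split; [|split].
- by move=> s i j /andP[s0 _]; exact: mx_derive_continuous (dQ s0) i j.
- by move=> s i j /andP[s0 _]; exact: mx_derive_continuous (dS s0) i j.
- by move=> s /andP[s0 _]; split; [apply: dQ; exact: ltW|apply: dS; exact: ltW].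
Qed.

(** A left-invariant tensor is determined by its value at the identity, so it suffices to compare
    the two Gram matrices there with [gram_flow_unique]. *)
Lemma frame_solution_unique (T : \bar R) (H : R -> tensor_field N) g : tensor_eq (G 0) g ->
  left_invariant_ricci_flow T g H ->
  forall t : R, 0 <= t -> (t%:E < T)%E -> tensor_eq (H t) (G t).
Proof.
move=> Gg [rH lH Hg] t t0 tT.
have cx0 := cod_x0 dom1.
have inT (s : R) : 0 <= s <= t -> (s%:E < T)%E.
  by case/andP => _ st; apply: le_lt_trans tT; rewrite lee_fin.
(* The absolute value supplies values at negative times, so that [P1] is continuous at 0 in the
   two-sided sense. *)
pose P1 (s : R) := H `|s| c0 x0; pose W1 (s : R) := invmx (P1 s).
pose W2 (s : R) := (S s)^T *m S s.
have abs (s : R) : 0 <= s -> `|s| = s by exact: ger0_norm.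
have P1W (s : R) : 0 <= s <= t -> P1 s *m W1 s = 1%:M.
  move=> st; have [s0 _] := andP st; rewrite /W1 /P1 abs //.
  have [rg _] := rH s s0 (inT s st).
  have [Q' [S' [PE QS']]] := pos_def_factor (riemannian_pos_def dom1 rg).
  by rewrite PE (invmx_unique (gram_inverse QS')) gram_inverse.
have dP1 (s : R) : 0 < s -> s <= t -> mx_derive P1 s (- 2 *: gram_ricci C (P1 s) (W1 s)).
  move=> s0 st i j; have st' : 0 <= s <= t by rewrite ltW.
  have [rg q] := rH s (ltW s0) (inT s st').
  have d := quotient_is_derive (f := fun s => H s c0 x0 i j) s0 (q c0 x0 i j cx0).
  rewrite [X in is_derive _ _ _ X]mxE /W1 /P1 abs ?ltW //.
  rewrite -(ricci_at_unit rg (lH s (ltW s0) (inT s st')) erefl).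
  apply: near_eq_is_derive d.
  by near=> u; rewrite ger0_norm // ltW //; near: u; exact: lt_nbhsr.
have cP1 (s : R) i j : 0 <= s <= t -> {for s, continuous (fun s => P1 s i j)}.
  move=> st; have [s0 sT] := andP st; have [s00|s00] := eqVneq s 0.
    have [_ q] := rH s s0 (inT s st).
    by move: q; rewrite s00 => /(_ c0 x0 i j cx0) /(quotient_continuous0 (f := fun s => H s c0 x0 i j)).
  by apply: mx_derive_continuous (dP1 s _ sT) i j; rewrite lt_neqAle eq_sym s00.
have cW1 (s : R) i j : 0 <= s <= t -> {for s, continuous (fun s => W1 s i j)}.
  move=> st; apply: continuous_invmx; first by have [] := mulmx1_unit (P1W s st).
  by move=> k l; exact: cP1.
have dP2 (s : R) : 0 <= s -> mx_derive (fun s => P s) s (- 2 *: gram_ricci C (P s) (W2 s)).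
  by move=> s0; apply: (mx_derive_eq (gram_derive (ricci_form_sym _) (dQ s0))); rewrite gram_ricciE ?QS.
have PP : P1 t = P t.
  apply: (gram_flow_unique (c := C) (P1 := P1) (P2 := fun s => P s) (W1 := W1) (W2 := W2) t0).
  - by move=> s st; split; [exact: P1W|apply/gram_inverse/QS; case/andP: st].
  - by move=> s i j st; split; [exact: cP1|apply: mx_derive_continuous (dP2 s _) i j; case/andP: st].
  - move=> s i j st; split; first exact: cW1.
    have [s0 _] := andP st; have d := mx_derive_mul (mx_derive_tr (dS s0)) (dS s0).
    exact: mx_derive_continuous d i j.
  - by move=> s /andP[s0 st]; split; [apply: dP1 => //; exact: ltW|apply: dP2; exact: ltW].
  - by rewrite /P1 normr0 (Hg _ _ cx0) -(Gg _ _ cx0) invariant_field0.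
move=> c x cx; rewrite (left_invariant_gram dom1 (lH t t0 tT) cx) /invariant_field.
by rewrite -PP /P1 abs.
Unshelve. all: by end_near.
Qed.

End FrameSolution.

End RicciFlowOfInvariantMetrics.

(* The Ricci flow of g is the left-invariant solution; the second conjunct says
   that every left-invariant solution on some [0, T) is a restriction of G. *)
Theorem corollary6p7 (R : realType) (n : nat) :
  exists C : R,
  forall N : lie_group R n, simply_connected R N -> nilpotent_group N ->
  forall g : tensor_field N, riemannian_metric g -> left_invariant g ->
  exists G : R -> tensor_field N,
    [/\ left_invariant_ricci_flow +oo%E g G,
        forall (T : \bar R) (H : R -> tensor_field N),
          left_invariant_ricci_flow T g H ->
          forall t : R, 0 <= t -> (t%:E < T)%E -> tensor_eq (H t) (G t)
      & type_III C G].
Proof.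
(* The product of the curvature constant 6 n^3 and the decay constant 2 (n + 1) of the squared norm
   of the bracket. *)
exists (6 * n%:R ^+ 3 * (2 * n.+1%:R)) => N _ nil g rg lg.
have [c0 dom1] := atlas_cover (lg_atlas N) 1%g.
have [Q0 [S0 [gE QS0]]] := pos_def_factor (riemannian_pos_def dom1 rg).
have [Q [S [Q0E _ QS dQS]]] := frame_flow_exists (@lie_bracket_anti _ _ N c0) QS0.
have dQ (t : R) (t0 : 0 <= t) := (dQS t t0).1; have dS (t : R) (t0 : 0 <= t) := (dQS t t0).2.
have rG := frame_solution_ricci_flow dom1 nil QS dQ.
have G0 : tensor_eq (invariant_field c0 (Q 0 *m (Q 0)^T)) g.
  by move=> c x cx; rewrite Q0E -gE; exact/esym/left_invariant_gram.
exists (fun t => invariant_field c0 (Q t *m (Q t)^T)); split.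
- by split=> // t t0 _; exact: invariant_field_left_invariant.
- by move=> T H; exact: (frame_solution_unique dom1 nil QS dQ dS G0).
- by split=> // t t0; exact: (frame_solution_norm dom1 QS dQ dS).
Qed.
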